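(* Let $F$ be a field of characteristic $p\ge 0$, let $m>l\ge 2$ be integers with $\gcd(l,m)=1$, and $n=lm$. Let $f,g,h,g^*,h^*\in F[x]$ be monic and original with $\deg g=\deg h^*=m$, $\deg h=\deg g^*=l$, $g'(g^* )'\ne 0$, and $f=g\circ h=g^*\circ h^*$. Then either (1) or (2) holds, and (3) is also valid. (1) (First Case) Let $m=sl+k$ be the division with remainder, with $1\le k<l$. There exist a monic $w\in F[x]$ of degree $s$ and $a\in F$ with $$f=(x-a^{kl}w^l(a^l))\circ x^{kl}w^l(x^l)\circ(x+a).$$ Furthermore $kw+lxw'\ne 0$ and $p\nmid l$, and $g=(x-a^{kl}w^l(a^l))\circ x^kw^l\circ(x+a^l)$, $h=(x-a^l)\circ x^l\circ(x+a)$, $g^*=(x-a^{kl}w^l(a^l))\circ x^l\circ(x+a^kw(a^l))$, $h^*=(x-a^kw(a^l))\circ x^kw(x^l)\circ(x+a)$. Conversely, any monic $w\in F[x]$ of degree $s$ and $a\in F$ with $kw+lxw'\ne0$ and $p\nmid l$ yield, via these formulas, polynomials $f,g,h,g^*,h^*$ satisfying all the hypotheses above. If $p\nmid m$, then $(w,a)$ is uniquely determined by $f$ and $l$. (2) (Second Case) There exist $z,a\in F$ with $z\ne 0$ such that $$f=(x-T_n(a,z))\circ T_n(x,z)\circ(x+a),$$ and $(z,a)$ is uniquely determined by $f$. Furthermore $p\nmid n$, and $g=(x-T_n(a,z))\circ T_m(x,z^l)\circ(x+T_l(a,z))$, $h=(x-T_l(a,z))\circ T_l(x,z)\circ(x+a)$,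 $g^*=(x-T_n(a,z))\circ T_l(x,z^m)\circ(x+T_m(a,z))$, $h^*=(x-T_m(a,z))\circ T_m(x,z)\circ(x+a)$. Conversely, if $p\nmid n$, then any $z,a\in F$ with $z\ne0$ yield, via these formulas, polynomials satisfying all the hypotheses above. (3) When $l\ge 3$, the First and Second Cases are mutually exclusive. For $l=2$, every $f$ of the Second Case also occurs in the First Case.
   Context: $g\circ h=g(h)$ denotes composition; a polynomial $f$ is monic if its leading coefficient is 1 and original if $f(0)=0$; $g'$ is the derivative. The notation $x^{kl}w^l(x^l)$ means the polynomial $x^{kl}\cdot(w(x^l))^l$, and $x^kw(x^l)$ means $x^k\cdot w(x^l)$. The Dickson polynomials $T_m\in F[x,y]$ are defined by $T_0=2$, $T_1=x$, $T_m=xT_{m-1}-yT_{m-2}$ for $m\ge 2$; $T_m(x,z)$ denotes substitution of $z$ for $y$. *)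

(* Defs.v *)
From HB Require Import structures.
From mathcomp Require Import all_boot all_order all_algebra.
Set Implicit Arguments.
Unset Strict Implicit.
Unset Printing Implicit Defensive.
Import GRing.Theory.
Local Open Scope ring_scope.

Section Defs.
Variable F : fieldType.

Definition original (p : {poly F}) : Prop := p.[0] = 0.

(* "p does not divide n", where p >= 0 is the characteristic of F
   (for characteristic 0, [pchar F] is empty and the condition holds). *)
Definition char_ndvd (n : nat) : Prop :=
  forall p : nat, p \in [pchar F] -> ~~ (p %| n)%N.

Fixpoint dickson (m : nat) (z : F) {struct m} : {poly F} :=
  match m with
  | 0%N => 2
  | 1%N => 'X
  | (m'.+1 as m1).+1 => 'X * dickson m1 z - z%:P * dickson m' z
  end.

Definition lincomp (c : F) (P : {poly F}) (b : F) : {poly F} :=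
  (('X - c%:P) \Po P) \Po ('X + b%:P).

Definition hyp (l m : nat) (f g h gs hs : {poly F}) : Prop :=
  [/\ [/\ f \is monic, g \is monic, h \is monic, gs \is monic & hs \is monic],
      [/\ original f, original g, original h, original gs & original hs],
      [/\ size g = m.+1, size hs = m.+1, size h = l.+1 & size gs = l.+1],
      g^`() * gs^`() != 0 &
      f = g \Po h /\ f = gs \Po hs].

Section First.
Variables (l m : nat) (w : {poly F}) (a : F).
Let s := (m %/ l)%N.
Let k := (m %% l)%N.
Definition c1 : F := a ^+ (k * l) * (w.[a ^+ l]) ^+ l.
Definition b1 : F := a ^+ k * w.[a ^+ l].
Definition f1 : {poly F} := lincomp c1 ('X^(k * l) * (w \Po 'X^l) ^+ l) a.
Definition g1 : {poly F} := lincomp c1 ('X^k * w ^+ l) (a ^+ l).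
Definition h1 : {poly F} := lincomp (a ^+ l) 'X^l a.
Definition gs1 : {poly F} := lincomp c1 'X^l b1.
Definition hs1 : {poly F} := lincomp b1 ('X^k * (w \Po 'X^l)) a.
Definition wcond : {poly F} := w *+ k + ('X * w^`()) *+ l.
End First.

Section Second.
Variables (l m : nat) (z a : F).
Let n := (l * m)%N.
Definition f2 : {poly F} := lincomp (dickson n z).[a] (dickson n z) a.
Definition g2 : {poly F} :=
  lincomp (dickson n z).[a] (dickson m (z ^+ l)) (dickson l z).[a].
Definition h2 : {poly F} := lincomp (dickson l z).[a] (dickson l z) a.
Definition gs2 : {poly F} :=
  lincomp (dickson n z).[a] (dickson l (z ^+ m)) (dickson m z).[a].
Definition hs2 : {poly F} := lincomp (dickson m z).[a] (dickson m z) a.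
End Second.

Definition first_case (l m : nat) (f g h gs hs : {poly F}) : Prop :=
  exists (w : {poly F}) (a : F),
    [/\ w \is monic /\ size w = (m %/ l).+1,
        f = f1 l m w a,
        wcond l m w != 0 /\ char_ndvd l,
        [/\ g = g1 l m w a, h = h1 l a, gs = gs1 l m w a & hs = hs1 l m w a] &
        (char_ndvd m ->
         forall (w' : {poly F}) (a' : F),
           w' \is monic -> size w' = (m %/ l).+1 -> f = f1 l m w' a' ->
           w' = w /\ a' = a)].

Definition second_case (l m : nat) (f g h gs hs : {poly F}) : Prop :=
  exists z a : F,
    [/\ z != 0,
        f = f2 l m z a,
        (forall z' a' : F, z' != 0 -> f = f2 l m z' a' -> z' = z /\ a' = a),
        char_ndvd (l * m) &
        [/\ g = g2 l m z a, h = h2 l z a, gs = gs2 l m z a & hs = hs2 m z a]].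

End Defs.

(* Main.v *)
Require Import Defs.
From HB Require Import structures.
From mathcomp Require Import all_boot all_order all_algebra.
From mathcomp Require Import closed_field zify ring.
Set Implicit Arguments.
Unset Strict Implicit.
Unset Printing Implicit Defensive.
Import GRing.Theory.
Local Open Scope ring_scope.

(** Over an algebraically closed field, view [g \Po h = gs \Po hs] as a
    parametrisation of the curve [g(x) = gs(y)].  As the degrees are coprime, the
    ramification of [h] at the points over [(x, y)] adds up to that of [gs] at [y].
    Comparing the differents of [h] and [gs] over the critical points of [gs] leaves
    four possibilities: [g] or [gs] is totally ramified; [gs] has two critical
    values with simple ramification; the characteristic is two and [gs] has one
    critical value, with ramification index two; or all ramification indices of [g]
    over some value share a factor, in which case taking roots of [h] and [hs]
    lowers the degrees.  In the second and third possibilities [h] and [hs] solve a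
    quadratic norm equation; substituting [x = w + z / w] turns its solutions into
    units of [K[w, 1/w]], i.e. monomials, so that [h] and [hs] are Dickson
    polynomials up to translations.  Total ramification makes [h] a power up to
    translations, which is the First Case.  All the parameters can be read off the
    coefficients, hence they descend to [F]. *)

(** Ramification may be wild, also at infinity, so counting ramification indices is not enough: the
    counting uses exponents of differents, i.e. multiplicities of zeros of derivatives, and
    [size_balance] plays the part of the point at infinity. What it produces is local: a critical
    point of [gs] above which the different of [h] is no larger than that of [gs]. The possibilities
    arise from the kinds of such points. The counting treats [g] and [gs] unequally. A common factor
    of indices is found for [g], and by exchanging the decompositions for [gs]; only both together,
    over one common value, allow the degrees to be lowered. Therefore the induction runs on [l + m]
    over a statement that is symmetric in the two decompositions, and the order [l < m] enters after
    it. The descent compares two fields neither of which contains the other: the given one and a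
    closed one, joined by the subfield that the coefficients generate. *)

(* The size of one polynomial can occur with several canonical-structure paths,
   which [lia] would treat as distinct atoms. *)
Ltac slia :=
  repeat match goal with
  | H : is_true (leq _ _) |- _ => revert H
  | H : @eq nat _ _ |- _ => revert H
  end;
  repeat match goal with |- context [@size ?T (@polyseq ?R ?p)] =>
    let n := fresh "n" in
    pose (n := @size T (@polyseq R p));
    repeat match goal with |- context [@size ?T' (@polyseq ?R' ?p')] =>
      change (@size T' (@polyseq R' p')) with n end;
    clearbody n end;
  lia.

(** * Multiplicities and zeros *)

Section Multiplicity.
Variable F : fieldType.
Implicit Types (p q h : {poly F}) (x t : F).

Lemma mup0 x : mup x 0 = 0%N.
Proof.
rewrite /mup; set i := [arg max_(_ > _ | _) _].
by case: i => i /=; rewrite size_poly0 ltnS leqn0 => /eqP.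
Qed.

Lemma root_mup x p : p != 0 -> root p x = (0 < mup x p)%N.
Proof. by move=> p0; rewrite -XsubC_dvd // dvdp_XsubCl. Qed.

Lemma mup_exp x p n : p != 0 -> mup x (p ^+ n) = (n * mup x p)%N.
Proof.
move=> p0; elim: n => [|n IHn]; first by rewrite mupNroot ?root1.
by rewrite exprS mupM ?expf_neq0 // IHn mulSn.
Qed.

Lemma mupZ x c p : c != 0 -> mup x (c *: p) = mup x p.
Proof.
by move=> c0; rewrite -mul_polyC mupMr // rootC.
Qed.

Lemma mupP x p : p != 0 ->
  exists2 q, ~~ root q x & p = ('X - x%:P) ^+ mup x p * q.
Proof.
move=> p0; have [k [q]] := multiplicity_XsubC p x; rewrite p0 /= => qx ->.
by exists q; rewrite // mupMr // mup_XsubCX eqxx mulrC.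
Qed.

Lemma mup_comp t p h : p != 0 -> (1 < size h)%N ->
  mup t (p \Po h) = (mup h.[t] p * mup t (h - h.[t]%:P))%N.
Proof.
move=> p0 sh; have [q qx Dp] := mupP h.[t] p0.
rewrite {1}Dp.
rewrite comp_polyM rmorphXn /= comp_polyB comp_polyX comp_polyC.
rewrite mupMl; last by rewrite /root horner_comp.
rewrite mup_exp // subr_eq0; apply: contraTneq sh => ->.
by rewrite size_polyC; case: eqP.
Qed.

(** The boolean multiples merge two cases. For positive multiplicity this is the product rule; for
    multiplicity zero, where the predecessor truncates, the first summand is switched off and the
    derivative of [q] remains. *)
Lemma deriv_mup x p : p != 0 -> exists2 q, ~~ root q x &
  p = ('X - x%:P) ^+ mup x p * q /\
  p^`() = ('X - x%:P) ^+ (mup x p).-1 *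
     (q *+ mup x p + ('X - x%:P) * q^`() *+ (0 < mup x p)%N)
     + q^`() *+ (mup x p == 0%N).
Proof.
move=> p0; have [q qx Dp] := mupP x p0; exists q => //; split=> //.
rewrite {1}Dp derivM deriv_exp derivXsubC.
case: (mup x p) => [|k] /=.
  by rewrite !(mulr0n, mulr1n, expr0, mul0r, mul1r, mulr0, addr0, add0r).
rewrite mulr0n mulr1n addr0 mul1r exprSr.
by rewrite [RHS]mulrDr mulrnAr mulrnAl mulrA.
Qed.

Lemma mup_deriv_ge x p : p^`() != 0 -> ((mup x p).-1 <= mup x p^`())%N.
Proof.
move=> dp; have p0 : p != 0 by apply: contra_neq dp => ->; rewrite deriv0.
rewrite mup_geq //; have [q qx [_ ->]] := deriv_mup x p0.
case: (mup x p) => [|k] /=; first by rewrite expr0 dvd1p.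
by rewrite mulr0n addr0 dvdp_mulIl.
Qed.

Lemma mup_deriv_tame x p : (mup x p)%:R != 0 :> F ->
  mup x p^`() = (mup x p).-1.
Proof.
have [->|p0] := eqVneq p 0; first by rewrite deriv0 mup0 eqxx.
have [q qx [_ ->]] := deriv_mup x p0.
case: (mup x p) => [|k] k0 /=; first by rewrite eqxx in k0.
rewrite mulr0n mulr1n addr0 mupMl ?mup_XsubCX ?eqxx //.
by rewrite /root !hornerE hornerMn subrr mul0r addr0 -mulr_natr mulf_neq0.
Qed.

Lemma mup_deriv_wild x p : p^`() != 0 -> (mup x p)%:R = 0 :> F ->
  (mup x p <= mup x p^`())%N.
Proof.
move=> dp k0; have p0 : p != 0 by apply: contra_neq dp => ->; rewrite deriv0.
rewrite mup_geq //; have [q qx [_ ->]] := deriv_mup x p0.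
case: (mup x p) k0 => [|k] k0 /=; first by rewrite expr0 dvd1p.
have -> : q *+ k.+1 = 0 by rewrite -mulr_natr -polyC_natr k0 mulr0.
rewrite add0r mulr0n addr0 mulr1n mulrA.
by rewrite -exprSr dvdp_mulIl.
Qed.

End Multiplicity.

(** * Zeros, norms and families of polynomials over an algebraically closed field *)

Section Zeros.
Variable K : closedFieldType.
Implicit Types (p q h : {poly K}) (x t : K).

(** For [p = 0] the list is arbitrary, as the leading coefficient is zero; hence the assumptions
    [p != 0] below. *)
Definition zeros p : seq K := sval (closed_field_poly_normal p).
Definition rts p : seq K := undup (zeros p).

Lemma zerosE p : p = lead_coef p *: \prod_(x <- zeros p) ('X - x%:P).
Proof. by rewrite /zeros; case: closed_field_poly_normal. Qed.

Lemma zeros_monic p : p \is monic -> p = \prod_(x <- zeros p) ('X - x%:P).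
Proof. by move=> /monicP pm; rewrite {1}[p]zerosE pm scale1r. Qed.

Lemma mem_zeros p x : p != 0 -> (x \in zeros p) = root p x.
Proof.
move=> p0; rewrite [in RHS](zerosE p) rootZ ?lead_coef_eq0 //.
by rewrite root_prod_XsubC.
Qed.

Lemma size_zeros p : p != 0 -> size (zeros p) = (size p).-1.
Proof.
move=> p0.
by rewrite [in RHS](zerosE p) size_scale ?lead_coef_eq0 // size_prod_XsubC.
Qed.

Lemma count_zeros p x : p != 0 -> count_mem x (zeros p) = mup x p.
Proof.
move=> p0; rewrite [in RHS](zerosE p) mupZ ?lead_coef_eq0 //.
by rewrite mu_prod_XsubC.
Qed.

Lemma rts_uniq p : uniq (rts p).
Proof. exact: undup_uniq. Qed.

Lemma mem_rts p x : p != 0 -> (x \in rts p) = root p x.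
Proof. by move=> p0; rewrite mem_undup mem_zeros. Qed.

Lemma sum_count_mem (s r : seq K) (P : pred K) :
  uniq s -> (\sum_(x <- s | P x) count_mem x r)%N =
    count (predI P (mem s)) r.
Proof.
move=> us; elim: r => [|y r IHr] /=; first by rewrite big1.
rewrite big_split /= IHr; congr (_ + _)%N.
rewrite big_mkcond /=; elim: s us {IHr} => [|z s IHs] /=.
  by rewrite big_nil andbF.
move=> /andP[zs us]; rewrite big_cons IHs // inE.
have [->|yz] := eqVneq y z; last by case: (P z).
by rewrite (negPf zs) andbF andbT addn0 /=; case: (P z).
Qed.

Lemma sum_mup (s : seq K) (P : pred K) p : p != 0 -> uniq s ->
  {in zeros p, forall x, P x -> x \in s} ->
  (\sum_(x <- s | P x) mup x p)%N = count P (zeros p).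
Proof.
move=> p0 us sub; under eq_bigr do rewrite -count_zeros //.
rewrite sum_count_mem //; apply: eq_in_count => x xz /=.
by case Px: (P x) => //=; rewrite sub.
Qed.

Lemma sum_mup_le (s : seq K) (P : pred K) p : p != 0 -> uniq s ->
  (\sum_(x <- s | P x) mup x p <= count P (zeros p))%N.
Proof.
move=> p0 us; under eq_bigr do rewrite -count_zeros //.
by rewrite sum_count_mem //; apply: sub_count => x /= /andP[].
Qed.

Lemma sum_mup_rts p : p != 0 -> (\sum_(x <- rts p) mup x p)%N = (size p).-1.
Proof.
move=> p0; rewrite (@sum_mup _ predT) ?rts_uniq // => [|x xz _].
  by rewrite count_predT size_zeros.
by rewrite mem_undup.
Qed.

Lemma exists_fresh (s : seq K) : exists x, x \notin s.
Proof.
have /closed_nonrootP[x] : \prod_(y <- s) ('X - y%:P) != 0.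
  by rewrite monic_neq0 // monic_prod_XsubC.
by rewrite root_prod_XsubC; exists x.
Qed.

Lemma poly_eq0_cofinite (s : seq K) p :
  (forall x, x \notin s -> p.[x] = 0) -> p = 0.
Proof.
move=> px; apply/eqP; apply/negPn/negP => p0.
have [x] := exists_fresh (s ++ zeros p).
rewrite mem_cat negb_or mem_zeros // => /andP[xs /negP]; apply.
by apply/rootP/px.
Qed.

Lemma poly_ext p q : (forall x, p.[x] = q.[x]) -> p = q.
Proof.
move=> pq; apply/eqP; rewrite -subr_eq0; apply/eqP.
by apply: (@poly_eq0_cofinite [::]) => x _; rewrite !hornerE pq subrr.
Qed.

Lemma horner_zeros p x : p \is monic -> p.[x] = \prod_(y <- zeros p) (x - y).
Proof.
move=> pm; rewrite {1}(zeros_monic pm) horner_prod.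
by apply: eq_bigr => y _; rewrite !hornerE.
Qed.

Lemma size_subC h c : (1 < size h)%N -> size (h - c%:P) = size h.
Proof.
by move=> sh; rewrite size_polyDl // size_polyN size_polyC; case: eqP => //; lia.
Qed.

Lemma monic_subC h c : (1 < size h)%N -> h \is monic -> h - c%:P \is monic.
Proof.
move=> sh hm; rewrite monicE lead_coefDl ?(eqP hm) //.
by rewrite size_polyN size_polyC; case: eqP => //; lia.
Qed.

Lemma subC_neq0 h c : (1 < size h)%N -> h - c%:P != 0.
Proof. by move=> sh; rewrite -size_poly_gt0 size_subC //; lia. Qed.

(* The norm of [phi] along [h] is again a polynomial: by bilinearity of the
   product of differences of zeros, its zeros are the images under [h] of those
   of [phi]. *)
Lemma norm_poly h (phi : {poly K}) : (1 < size h)%N -> h \is monic -> phi != 0 ->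
  exists2 c : K, c != 0 & forall x,
    \prod_(t <- zeros (h - x%:P)) phi.[t] =
      (c *: \prod_(u <- zeros phi) ('X - h.[u]%:P)).[x].
Proof.
move=> sh hm phi0; set l := (size h).-1.
exists (lead_coef phi ^+ l * \prod_(u <- zeros phi) ((-1) ^+ l * -1)).
  rewrite mulf_neq0 ?expf_neq0 ?lead_coef_eq0 // prodf_seq_neq0.
  by apply/allP => u _ /=; rewrite mulf_neq0 ?expf_neq0 // oppr_eq0 oner_eq0.
move=> x; rewrite hornerZ horner_prod -mulrA -big_split /=.
have sz : size (zeros (h - x%:P)) = l by rewrite size_zeros ?subC_neq0 // size_subC.
have -> : lead_coef phi ^+ l = \prod_(t <- zeros (h - x%:P)) lead_coef phi.
  by rewrite big_const_seq count_predT sz -Monoid.iteropE.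
under eq_bigr => t _ do rewrite {1}[phi]zerosE hornerZ horner_prod.
rewrite big_split /=; congr (_ * _); rewrite exchange_big /=.
apply: eq_bigr => u _; rewrite !hornerE -mulrA mulN1r opprB.
have -> : h.[u] - x = (h - x%:P).[u] by rewrite !hornerE.
rewrite (horner_zeros _ (monic_subC x sh hm)).
have -> : (-1) ^+ l = \prod_(t <- zeros (h - x%:P)) (-1 : K).
  by rewrite big_const_seq count_predT sz -Monoid.iteropE.
by rewrite -big_split /=; apply: eq_bigr => t _; rewrite !hornerE mulN1r opprB.
Qed.

(** Newton interpolation: the value at a fresh [y0] is split off and the rest divided by
    ['X - y0%:P], which lowers the degree bound. The quotient is known to be polynomial in [x] only
    away from [y0], so the exceptional set [s] grows. The coefficients of [D] are polynomials in
    [x], evaluated by [horner_eval x]. *)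
Lemma poly_dependence n : forall (s : seq K) (d : K -> {poly K}),
  (forall x, (size (d x) <= n)%N) ->
  (forall y, y \notin s -> exists N : {poly K}, forall x, (d x).[y] = N.[x]) ->
  exists2 D : {poly {poly K}}, (size D <= n)%N &
    forall x, d x = map_poly (horner_eval x) D.
Proof.
elim: n => [|n IHn] s d sd dN.
  exists 0 => [|x]; first by rewrite size_poly0.
  by apply/eqP; rewrite rmorph0 -size_poly_leq0.
have [y0 ys] := exists_fresh s; have [N0 dN0] := dN _ ys.
pose e x := (d x - (N0.[x])%:P) %/ ('X - y0%:P).
have De x : d x = e x * ('X - y0%:P) + (N0.[x])%:P.
  rewrite divpK ?subrK // dvdp_XsubCl /root !hornerE dN0 subrr //.
have [||D sD eD] := IHn (y0 :: s) e.
- move=> x; rewrite size_divp ?polyXsubC_eq0 // size_XsubC leq_subLR.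
  rewrite (leq_trans (size_polyD _ _)) // geq_max size_polyN size_polyC.
  by rewrite add1n sd /=; case: eqP.
- move=> y; rewrite inE negb_or => /andP[yy0 /dN[N dy]].
  exists ((y - y0)^-1 *: (N - N0)) => x.
  have nz : y - y0 != 0 by rewrite subr_eq0.
  apply: (mulfI nz); rewrite hornerZ mulVKf // hornerD hornerN -dy De.
  by rewrite !hornerE addrK mulrC.
exists (D * ('X - y0%:P%:P) + N0%:P) => [|x].
  rewrite (leq_trans (size_polyD _ _)) // geq_max size_polyC.
  rewrite (leq_trans (size_polyMleq _ _)) ?size_XsubC ?addn2 //=.
  by case: eqP.
rewrite De rmorphD rmorphM /= -eD map_polyC rmorphB /= map_polyX map_polyC /=.
by rewrite /horner_eval hornerC.
Qed.

Lemma mulmod_inj l m i j : coprime l m ->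
  (m * i = m * j %[mod l])%N -> (i = j %[mod l])%N.
Proof.
move=> co; wlog le_ij : i j / (i <= j)%N => [IH|].
  by case/orP: (leq_total i j) => /IH // ji /esym/ji.
move/esym/eqP; rewrite eqn_mod_dvd ?leq_mul2l ?le_ij ?orbT // -mulnBr.
by rewrite Gauss_dvdr // -eqn_mod_dvd // => /eqP.
Qed.

(* The exponents of [h ^+ i * hs ^+ k] with [k < l] are pairwise distinct. *)
Lemma bivariate_indep l m (h hs : {poly K}) (D : {poly {poly K}}) :
  size h = l.+1 -> size hs = m.+1 -> coprime l m -> (0 < l)%N ->
  (size D <= l)%N -> (map_poly (comp_poly h) D).[hs] = 0 -> D = 0.
Proof.
move=> sh shs co l0 sD; apply: contra_eq => D0.
have szt (i : nat) : D`_i != 0 ->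
  (size ((D`_i \Po h) * hs ^+ i)).-1 = ((size (D`_i)%R).-1 * l + m * i)%N.
  move=> Di; have hs0 : hs != 0 by rewrite -size_poly_gt0 shs.
  rewrite size_mul ?expf_neq0 ?comp_poly_eq0 ?sh ?ltnS // .
  have := size_comp_poly (D`_i) h; have := size_exp hs i; rewrite sh shs /=.
  have : hs ^+ i != 0 by rewrite expf_neq0.
  have : D`_i \Po h != 0 by rewrite comp_poly_eq0 // sh ltnS.
  rewrite -!size_poly_gt0 => a0 b0 <- <-.
  by case: (size _) a0 => // a _; case: (size _) b0 => // b _; rewrite /= addnS.
have lead (i : nat) : D`_i != 0 -> (D`_i \Po h) * hs ^+ i != 0.
  move=> Di; have hs0 : hs != 0 by rewrite -size_poly_gt0 shs.
  by rewrite mulf_neq0 ?expf_neq0 // comp_poly_eq0 // sh ltnS.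
rewrite horner_coef size_map_poly_id0; last first.
  by rewrite comp_poly_eq0 ?lead_coef_eq0 // sh ltnS.
have Dl : ((size D).-1 < size D)%N by rewrite ltn_predL size_poly_gt0.
pose i0 := Ordinal Dl; have Di0 : D`_i0 != 0 by rewrite -lead_coefE lead_coef_eq0.
have [/= j Dj jmax] := @arg_maxnP _ i0 (fun i => D`_i != 0)
   (fun i : 'I_(size D) => ((size (D`_i)%R).-1 * l + m * i)%N) Di0.
set N := (_ + _)%N in jmax.
apply: contra_neq (lead _ Dj) => /(congr1 (fun p : {poly K} => p`_N)).
rewrite coef0 coef_sum (bigD1 j) //= big1 => [|i ij]; last first.
  rewrite coef_map /= nth_default //.
  have [->|Di] := eqVneq (D`_i) 0; first by rewrite comp_poly0 mul0r size_poly0.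
  have := szt _ Di; have := lead _ Di; rewrite -size_poly_gt0.
  have := jmax _ Di; rewrite leq_eqVlt => /orP[/eqP eqN|]; last first.
    by move=> lt s0 /esym s1; move: lt; rewrite s1; case: (size _) s0.
  case/eqP: ij; apply: val_inj => /=.
  have il : (i < l)%N by exact: leq_trans (ltn_ord i) sD.
  have jl : (j < l)%N by exact: leq_trans (ltn_ord j) sD.
  have : (m * i = m * j %[mod l])%N.
    by have /(congr1 (modn^~ l)) := eqN; rewrite !modnMDl.
  by move/(mulmod_inj co); rewrite !modn_small.
rewrite addr0 coef_map /= => c0.
have /eqP := szt _ Dj; rewrite -/N => /eqP sN.
by apply/eqP; rewrite -lead_coef_eq0 lead_coefE sN c0.
Qed.

End Zeros.

(** * Fibres of a bidecomposition *)

(** The hypotheses freed from [f], from normalisation at the origin and from an order between [l]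
    and [m]: this form is stable under exchanging the decompositions and under the root extractions
    of the induction. *)
Record bidec (F : fieldType) (l m : nat) (g h gs hs : {poly F}) : Prop := Bidec {
  bidec_l : (1 < l)%N;
  bidec_m : (1 < m)%N;
  bidec_co : coprime l m;
  bidec_gm : g \is monic;
  bidec_hm : h \is monic;
  bidec_gsm : gs \is monic;
  bidec_hsm : hs \is monic;
  bidec_sg : size g = m.+1;
  bidec_sh : size h = l.+1;
  bidec_sgs : size gs = l.+1;
  bidec_shs : size hs = m.+1;
  bidec_dg : g^`() != 0;
  bidec_dgs : gs^`() != 0;
  bidec_eq : g \Po h = gs \Po hs }.

Lemma bidec_sym (F : fieldType) (l m : nat) (g h gs hs : {poly F}) :
  bidec l m g h gs hs -> bidec m l gs hs g h.
Proof. by case=> *; constructor; rewrite 1?coprime_sym. Qed.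

Lemma bidec_val (F : fieldType) l m (g h gs hs : {poly F}) t :
  bidec l m g h gs hs -> g.[h.[t]] = gs.[hs.[t]].
Proof. by move=> B; rewrite -!horner_comp (bidec_eq B). Qed.

Section Sizes.
Variables (F : fieldType) (l m : nat) (g h gs hs : {poly F}).
Hypothesis B : bidec l m g h gs hs.

Lemma bidec_sg1 : (1 < size g)%N.
Proof. by rewrite (bidec_sg B) ltnS ltnW // (bidec_m B). Qed.
Lemma bidec_shs1 : (1 < size hs)%N.
Proof. by rewrite (bidec_shs B) ltnS ltnW // (bidec_m B). Qed.
Lemma bidec_sgs1 : (1 < size gs)%N.
Proof. by rewrite (bidec_sgs B) ltnS ltnW // (bidec_l B). Qed.
Lemma bidec_sh1 : (1 < size h)%N.
Proof. by rewrite (bidec_sh B) ltnS ltnW // (bidec_l B). Qed.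

End Sizes.

Lemma size_monicB (F : fieldType) n (p q : {poly F}) : p \is monic -> q \is monic ->
  size p = n.+1 -> size q = n.+1 -> (size (p - q)%R <= n)%N.
Proof.
move=> pm qm sp sq; apply/leq_sizeP => j; rewrite leq_eqVlt => /orP[/eqP <-|nj].
  by rewrite coefB; move/monicP: pm; move/monicP: qm;
     rewrite !lead_coefE sp sq /= => -> ->; rewrite subrr.
by rewrite coefB !nth_default ?subrr // ?sp ?sq.
Qed.

Section Fibres.
Variable K : closedFieldType.
Implicit Types (p q g h gs hs : {poly K}) (x y t c : K).
Variables (l m : nat) (g h gs hs : {poly K}).
Hypothesis B : bidec l m g h gs hs.

(** The difference of the two sides has degree below [l], has coefficients polynomial in [x], and
    vanishes when [x] and the variable are replaced by [h] and [hs]; for coprime degrees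
    [bivariate_indep] makes it zero. Thus [gs - g.[x]%:P] is the characteristic polynomial of [hs]
    over [h], at [h = x]. *)
Lemma bidec_fibre x :
  \prod_(t <- zeros (h - x%:P)) ('X - hs.[t]%:P) = gs - g.[x]%:P.
Proof.
have [l1 m1 co gm hm gsm hsm sg sh sgs shs _ _ _] := B.
have sh1 : (1 < size h)%N by rewrite sh ltnS ltnW.
have shs1 : (1 < size hs)%N by rewrite shs ltnS ltnW.
have sgs1 : (1 < size gs)%N by rewrite sgs ltnS ltnW.
pose d x := \prod_(t <- zeros (h - x%:P)) ('X - hs.[t]%:P) - (gs - g.[x]%:P).
have [||D sD dD] := @poly_dependence _ l [::] d.
- move=> z; apply: size_monicB; rewrite ?monic_prod_XsubC ?monic_subC //.
    by rewrite size_prod_XsubC size_zeros ?subC_neq0 // size_subC // sh.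
  by rewrite size_subC.
(* The value of the product at [y] is the norm of [y%:P - hs] along [h], hence polynomial in [x]. *)
- move=> y _; have phi0 : y%:P - hs != 0.
    by rewrite -opprB oppr_eq0 subC_neq0.
  have [c c0 Nc] := norm_poly sh1 hm phi0.
  exists (c *: \prod_(u <- zeros (y%:P - hs)) ('X - h.[u]%:P) + g - gs.[y]%:P) => z.
  rewrite /d !hornerE -addrA -[X in _ = X + _]hornerZ -Nc horner_prod.
  congr (_ + _); last by rewrite opprB.
  by apply: eq_bigr => t _; rewrite !hornerE.
suff D0 : D = 0.
  by apply/eqP; rewrite -subr_eq0 -[_ - _]/(d x) dD D0 rmorph0.
apply: (bivariate_indep sh shs co (ltnW l1) sD).
apply: poly_ext => t; rewrite -[LHS]/(horner_eval t _) -horner_map /=.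
rewrite -map_poly_comp (eq_map_poly (g := horner_eval h.[t])); last first.
  by move=> p /=; rewrite /horner_eval horner_comp.
rewrite -dD /d /horner_eval !hornerE -(bidec_val t B) subrr oppr0 addr0.
(* [t] itself lies in the fibre of [h] over [h.[t]], so one factor vanishes at [hs.[t]]. *)
rewrite horner_prod (big_rem t) /= ?hornerE ?subrr ?mul0r //.
by rewrite mem_zeros ?subC_neq0 // /root !hornerE subrr.
Qed.

Lemma bidec_fibre_perm x :
  perm_eq [seq hs.[t] | t <- zeros (h - x%:P)] (zeros (gs - g.[x]%:P)).
Proof.
apply: prod_XsubC_eq; rewrite big_map bidec_fibre -zeros_monic //.
by rewrite monic_subC ?(bidec_gsm B) // (bidec_sgs B) ltnS ltnW ?(bidec_l B).
Qed.

Lemma fibre_sum x y : 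
  (\sum_(t <- rts (h - x%:P) | hs.[t] == y) mup t (h - x%:P) =
   mup y (gs - g.[x]%:P))%N.
Proof.
have sh1 := bidec_sh1 B.
have sgs1 := bidec_sgs1 B.
rewrite sum_mup ?rts_uniq ?subC_neq0 //; last by move=> t; rewrite mem_undup.
rewrite -count_zeros ?subC_neq0 // -(permP (bidec_fibre_perm x)) count_map.
by apply: eq_count.
Qed.

End Fibres.

(** Degree count for the chain rule in [size_balance]: [a] and [b] are the sizes of the derivatives
    of [h] and [gs], while [A] and [C] are the sizes of the derivatives of [g] and [gs] composed
    with [h] and [hs]. *)
Lemma balance_arith l m a b A C : (0 < m)%N -> (0 < b)%N -> (0 < a)%N ->
  (b <= l)%N -> (a <= l)%N -> (0 < C)%N -> (0 < A)%N ->
  (A + a).-1 = (C + m).-1 ->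
  C.-1 = (b.-1 * m)%N -> A.-1 = (m.-1 * l)%N -> (l - a = m * (l - b))%N.
Proof.
case: m => // m _; case: b => // b _ a0 /subnK; set e := (l - _)%N => <-.
by move=> ? ? ? e1 e2 e3; move: e1; rewrite /= in e2 e3 *; lia.
Qed.

Lemma size_deriv_tame (F : fieldType) n (p : {poly F}) : p \is monic ->
  size p = n.+1 -> n%:R != 0 :> F -> size p^`() = n.
Proof.
move=> pm sp n0; have n_gt0 : (0 < n)%N by case: n n0 {sp} => //; rewrite eqxx.
apply/eqP; rewrite eqn_leq; apply/andP; split.
  by rewrite -ltnS -sp lt_size_deriv // -size_poly_gt0 sp.
rewrite -(prednK n_gt0) ltnNge; apply/negP => /leq_sizeP/(_ _ (leqnn _)).
rewrite coef_deriv prednK //; move/monicP: pm; rewrite lead_coefE sp /= => ->.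
by apply/eqP.
Qed.

Lemma size_deriv_le (F : fieldType) n (p : {poly F}) :
  size p = n.+1 -> (size p^`() <= n)%N.
Proof. by move=> sp; rewrite -ltnS -sp lt_size_deriv // -size_poly_gt0 sp. Qed.

Lemma coprime_tame (F : fieldType) l m : coprime l m ->
  (l%:R != 0 :> F) || (m%:R != 0 :> F).
Proof.
move=> co; rewrite -negb_and; apply/negP => /andP[/eqP l0 /eqP m0].
have [l_0|l_gt0] := posnP l.
  by move: co m0; rewrite l_0 /coprime gcd0n => /eqP ->; apply/eqP/oner_neq0.
case: (egcdnP m l_gt0) => u v uv _; have := congr1 (fun n => n%:R : F) uv.
rewrite (eqP co) natrM natrD natrM l0 m0 !mulr0 add0r => /esym/eqP.
by rewrite oner_eq0.
Qed.

(** * Ramification *)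

Section Ram.
Variable F : fieldType.
Implicit Types (p : {poly F}) (x : F).
(* For the covering of the line by [p]: ramification index and exponent of the
   different at [x]. *)
Definition ram (p : {poly F}) x := mup x (p - p.[x]%:P).
Definition dif (p : {poly F}) x := mup x p^`().

Lemma ram_gt0 p x : (1 < size p)%N -> (0 < ram p x)%N.
Proof.
move=> sp; rewrite -root_mup; first by rewrite /root !hornerE subrr.
have le : (size (- (p.[x])%:P)%R <= 1)%N by rewrite size_polyN size_polyC leq_b1.
by rewrite -size_poly_gt0 size_polyDl ?(leq_ltn_trans le) // ltnW.
Qed.

Lemma dif_ge p x : p^`() != 0 -> ((ram p x).-1 <= dif p x)%N.
Proof.
move=> dp; have := @mup_deriv_ge _ x (p - p.[x]%:P).
by rewrite derivB derivC subr0; apply.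
Qed.

Lemma ram1_dif0 p x : p^`() != 0 -> (1 < size p)%N -> dif p x = 0%N -> ram p x = 1%N.
Proof.
by move=> dp sp d0; have := dif_ge x dp; have := ram_gt0 x sp; rewrite d0; lia.
Qed.

Lemma dif_tame p x : (ram p x)%:R != 0 :> F -> dif p x = (ram p x).-1.
Proof. by move=> /mup_deriv_tame; rewrite derivB derivC subr0. Qed.

Lemma dif_wild p x : p^`() != 0 -> (ram p x)%:R = 0 :> F ->
  (ram p x <= dif p x)%N.
Proof.
move=> dp; have := @mup_deriv_wild _ x (p - p.[x]%:P).
by rewrite derivB derivC subr0; apply.
Qed.

Lemma dif1 p x : ram p x = 1%N -> dif p x = 0%N.
Proof. by move=> r1; rewrite dif_tame r1 ?oner_eq0. Qed.

End Ram.

Section Ramification.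
Variable K : closedFieldType.
Implicit Types (p q g h gs hs : {poly K}) (x y t c : K).

Lemma mup_eq_ram p x c : p.[x] = c -> mup x (p - c%:P) = ram p x.
Proof. by move=> <-. Qed.

Lemma mem_fibre p x c : (1 < size p)%N -> (x \in rts (p - c%:P)) = (p.[x] == c).
Proof. by move=> sp; rewrite mem_rts ?subC_neq0 // /root !hornerE subr_eq0. Qed.

Lemma sum_ram p c n : size p = n.+2 ->
  (\sum_(x <- rts (p - c%:P)) ram p x)%N = n.+1.
Proof.
move=> sp; have sp1 : (1 < size p)%N by rewrite sp.
transitivity (\sum_(x <- rts (p - c%:P)) mup x (p - c%:P))%N; last first.
  by rewrite sum_mup_rts ?subC_neq0 // size_subC // sp.
by apply: eq_big_seq => x; rewrite mem_fibre // => /eqP /mup_eq_ram.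
Qed.

Variables (l m : nat) (g h gs hs : {poly K}).
Hypothesis B : bidec l m g h gs hs.

Let sg1 : (1 < size g)%N := bidec_sg1 B.
Let shs1 : (1 < size hs)%N := bidec_shs1 B.
Let sgs1 : (1 < size gs)%N := bidec_sgs1 B.
Let sh1 : (1 < size h)%N := bidec_sh1 B.

Lemma deriv_bidec : (g^`() \Po h) * h^`() = (gs^`() \Po hs) * hs^`().
Proof. by rewrite -!deriv_comp (bidec_eq B). Qed.

(** Coprimality makes [l] or [m] nonzero in [K]; in the latter case the derivative of [hs] is
    nonzero and the chain rule carries this over to [h]. *)
Lemma bidec_dh : h^`() != 0.
Proof.
have dg := bidec_dg B; have dgs := bidec_dgs B.
case/orP: (coprime_tame K (bidec_co B)) => n0.
  by rewrite -size_poly_gt0 (size_deriv_tame (bidec_hm B) (bidec_sh B) n0)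
     (ltnW (bidec_l B)).
have : hs^`() != 0.
  by rewrite -size_poly_gt0 (size_deriv_tame (bidec_hsm B) (bidec_shs B) n0)
     (ltnW (bidec_m B)).
apply: contra_neq => dh; apply/eqP.
have /eqP := deriv_bidec; rewrite dh mulr0 eq_sym mulf_eq0 comp_poly_eq0 //.
by rewrite (negPf dgs).
Qed.

Lemma ram_mul t : (ram g h.[t] * ram h t = ram gs hs.[t] * ram hs t)%N.
Proof.
rewrite /ram -!mup_comp ?subC_neq0 //.
by rewrite !comp_polyB !comp_polyC (bidec_eq B) (bidec_val t B).
Qed.

Lemma fibre_ram x y : g.[x] = gs.[y] ->
  (\sum_(t <- rts (h - x%:P) | hs.[t] == y) ram h t = ram gs y)%N.
Proof.
move=> xy; rewrite /ram -xy -(fibre_sum B); rewrite big_seq_cond [RHS]big_seq_cond.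
apply: eq_bigr => t /andP[]; rewrite mem_fibre // => /eqP ht _.
by rewrite ht.
Qed.

End Ramification.

Section FibreSums.
Variable K : closedFieldType.
Implicit Types (p q g h gs hs : {poly K}) (x y t c : K).
Variables (l m : nat) (g h gs hs : {poly K}).
Hypothesis B : bidec l m g h gs hs.

Let sg1 : (1 < size g)%N := bidec_sg1 B.
Let shs1 : (1 < size hs)%N := bidec_shs1 B.
Let sgs1 : (1 < size gs)%N := bidec_sgs1 B.
Let sh1 : (1 < size h)%N := bidec_sh1 B.
Let dh : h^`() != 0 := bidec_dh B.
Let dhs : hs^`() != 0 := bidec_dh (bidec_sym B).

(** Transitivity of the different along the two towers below [t]. *)
Lemma dif_chain t :
  (ram h t * dif g h.[t] + dif h t = ram hs t * dif gs hs.[t] + dif hs t)%N.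
Proof.
have dg := bidec_dg B; have dgs := bidec_dgs B.
have := congr1 (mup t) (deriv_bidec B).
rewrite !mupM ?comp_poly_eq0 // !mup_comp //.
by rewrite /dif /ram mulnC [in RHS](mulnC (mup _ gs^`())).
Qed.

Definition fib x y := [seq t <- rts (h - x%:P) | hs.[t] == y].

Lemma mem_fib x y t : (t \in fib x y) = (h.[t] == x) && (hs.[t] == y).
Proof. by rewrite mem_filter mem_fibre // andbC. Qed.

Lemma fib_uniq x y : uniq (fib x y).
Proof. by rewrite filter_uniq // rts_uniq. Qed.

Lemma fib_ram_h x y : g.[x] = gs.[y] -> (\sum_(t <- fib x y) ram h t)%N = ram gs y.
Proof. by move=> xy; rewrite big_filter (fibre_ram B). Qed.

Lemma fib_ram_hs x y : g.[x] = gs.[y] -> (\sum_(t <- fib x y) ram hs t)%N = ram g x.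
Proof.
move=> xy; rewrite -(fibre_ram (bidec_sym B) (esym xy)) -[RHS]big_filter.
apply: perm_big; apply: uniq_perm; rewrite ?fib_uniq ?filter_uniq ?rts_uniq //.
by move=> t; rewrite mem_fib mem_filter mem_fibre.
Qed.

Lemma fib_neq0 x y : g.[x] = gs.[y] -> exists t, t \in fib x y.
Proof.
move=> xy; have : (0 < ram gs y)%N by rewrite ram_gt0.
rewrite -(fib_ram_h xy); case: (fib x y) => [|t s]; first by rewrite big_nil.
by exists t; rewrite inE eqxx.
Qed.

Lemma sum_uniq_pred1 (s : seq K) z (n : nat) : uniq s -> z \in s ->
  (\sum_(x <- s | z == x) n)%N = n.
Proof.
by move=> us zs; rewrite (big_rem z) //= eqxx big_seq_cond big1 ?addn0 // => x;
   rewrite mem_rem_uniq // inE eq_sym => /andP[/andP[/negPf->]].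
Qed.

Lemma sum_fibre_hs y (phi : K -> nat) :
  (\sum_(t <- rts (hs - y%:P)) phi t =
   \sum_(x <- rts (g - gs.[y]%:P)) \sum_(t <- fib x y) phi t)%N.
Proof.
transitivity (\sum_(x <- rts (g - gs.[y]%:P))
    \sum_(t <- rts (hs - y%:P) | h.[t] == x) phi t)%N; last first.
  apply: eq_bigr => x _; rewrite -big_filter.
  apply: perm_big; apply: uniq_perm; rewrite ?fib_uniq ?filter_uniq ?rts_uniq //.
  by move=> t; rewrite mem_fib mem_filter mem_fibre.
under [RHS]eq_bigr do rewrite big_mkcond.
rewrite exchange_big /=; apply: eq_big_seq => t; rewrite mem_fibre // => /eqP ty.
rewrite -big_mkcond sum_uniq_pred1 ?rts_uniq //.
by rewrite mem_fibre // (bidec_val t B) ty.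
Qed.

(* The degree of the different of [h] along the fibre of [hs] over [y]. *)
Definition tot y := count (fun t => hs.[t] == y) (zeros h^`()).

Lemma totE y : tot y = (\sum_(t <- rts (hs - y%:P)) dif h t)%N.
Proof.
rewrite /tot -(@sum_mup _ (rts (hs - y%:P))) ?rts_uniq //.
  rewrite big_seq_cond [RHS]big_seq; apply: eq_bigl => t.
  by rewrite mem_fibre // andbb.
by move=> t _ /eqP ty; rewrite mem_fibre // ty.
Qed.

Lemma tot_fib y :
  tot y = (\sum_(x <- rts (g - gs.[y]%:P)) \sum_(t <- fib x y) dif h t)%N.
Proof. by rewrite totE sum_fibre_hs. Qed.

Lemma sum_tot (s : seq K) : uniq s -> (\sum_(y <- s) tot y <= (size h^`()).-1)%N.
Proof.
move=> us; rewrite -(size_zeros dh) -(size_map (horner hs)).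
rewrite (eq_bigr (fun y => count_mem y [seq hs.[t] | t <- zeros h^`()])); last first.
  by move=> y _; rewrite count_map.
by rewrite sum_count_mem // count_size.
Qed.

(** The defect [l - size] of a derivative measures wild ramification at infinity. Either [l] is
    nonzero in [K] and both defects vanish, or [m] is, and the degrees in the chain rule give the
    factor [m]. *)
Lemma size_balance : ((l - size h^`()) = m * (l - size gs^`()))%N.
Proof.
have [l1 m1 co gm hm gsm hsm sg sh sgs shs dg dgs _] := B.
case/orP: (coprime_tame K co) => n0.
  by rewrite !(size_deriv_tame _ _ n0) // !subnn muln0.
have := congr1 (fun p : {poly K} => size p) (deriv_bidec B); rewrite /=.
have := size_comp_poly g^`() h; have := size_comp_poly gs^`() hs.
rewrite (size_deriv_tame gm sg n0) sh shs /=.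
rewrite !size_mul ?comp_poly_eq0 // (size_deriv_tame hsm shs n0).
have : (0 < size (g^`() \Po h))%N by rewrite size_poly_gt0 comp_poly_eq0.
have : (0 < size (gs^`() \Po hs))%N by rewrite size_poly_gt0 comp_poly_eq0.
have : (size h^`() <= l)%N by rewrite size_deriv_le.
have : (size gs^`() <= l)%N by rewrite size_deriv_le.
have : (0 < size h^`())%N by rewrite size_poly_gt0.
have : (0 < size gs^`())%N by rewrite size_poly_gt0.
move=> b0 a0 bl al C0 A0 e1 e2 e3.
exact: (balance_arith (ltnW m1) b0 a0 bl al C0 A0 e3 e1 e2).
Qed.

End FibreSums.

Lemma sum_eq1 (T : eqType) (s : seq T) (f : T -> nat) :
  (forall t, t \in s -> 0 < f t)%N -> (\sum_(t <- s) f t = 1)%N ->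
  exists2 t, s = [:: t] & f t = 1%N.
Proof.
case: s => [|t [|u s]] pos; first by rewrite big_nil.
  by rewrite big_seq1 => ft; exists t.
rewrite !big_cons => e; have := pos t (mem_head _ _).
have : (0 < f u)%N by rewrite pos // !inE eqxx orbT.
by move: e; move: (\sum_(_ <- _) _)%N => k; lia.
Qed.

Lemma sum_le_eq (T : eqType) (s : seq T) (f g : T -> nat) :
  (forall t, t \in s -> f t <= g t)%N ->
  (\sum_(t <- s) g t <= \sum_(t <- s) f t)%N ->
  forall t, t \in s -> f t = g t.
Proof.
move=> fg le t ts; move: le; rewrite !(big_rem t ts) /=.
have le1 := fg _ ts.
have : (\sum_(y <- rem t s) f y <= \sum_(y <- rem t s) g y)%N.
  by rewrite big_seq [leqRHS]big_seq; apply: leq_sum => u /mem_rem /fg.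
by move: (\sum_(_ <- _) _)%N (\sum_(_ <- _) _)%N => a b; lia.
Qed.

Section Heavy.
Variable K : closedFieldType.
Implicit Types (p h : {poly K}) (x t : K).

Definition heavy h x := forall t, h.[t] = x -> (1 < ram h t)%N.

Lemma sum_dif_fibre h x : h^`() != 0 -> (1 < size h)%N ->
  (\sum_(t <- rts (h - x%:P)) dif h t)%N =
  count (fun t => h.[t] == x) (zeros h^`()).
Proof.
move=> dh sh1; rewrite -(@sum_mup _ (rts (h - x%:P))) ?rts_uniq //.
  rewrite big_seq [RHS]big_seq_cond; apply: eq_bigl => t.
  by rewrite mem_fibre // andbb.
by move=> t _ /eqP ty; rewrite mem_fibre // ty.
Qed.

(* A heavy value takes up at least half of [deg h], but only [deg h - 1] zeros of
   the derivative are available. *)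
Lemma heavy_unique h x x' : h^`() != 0 -> (1 < size h)%N ->
  heavy h x -> heavy h x' -> x = x'.
Proof.
move=> dh sh hx hx'; apply/eqP/negPn/negP => xx'.
have half y : heavy h y ->
    ((size h).-1 <= 2 * count (fun t => h.[t] == y) (zeros h^`()))%N.
  move=> hy; rewrite -sum_dif_fibre // big_distrr /=.
  have [n sn] : exists n, size h = n.+2 by case: (size h) sh => [|[|n]] // _; exists n.
  rewrite sn -(sum_ram y sn) /= big_seq [leqRHS]big_seq; apply: leq_sum => t.
  rewrite mem_fibre // => /eqP /hy; have := dif_ge t dh; lia.
have := half _ hx; have := half _ hx'.
have : (count (fun t => h.[t] == x) (zeros h^`()) +
        count (fun t => h.[t] == x') (zeros h^`()) <= (size h).-2)%N.
  rewrite -count_predUI (@eq_count _ (predI _ _) pred0) ?count_pred0 ?addn0.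
    rewrite (leq_trans (count_size _ _)) // size_zeros //.
    have [n sn] : exists n, size h = n.+2 by case: (size h) sh => [|[|n]] // _; exists n.
    by have := size_deriv_le sn; rewrite sn /=; case: (size _).
  by move=> t /=; apply/negP => /andP[/eqP-> /eqP e]; rewrite e eqxx in xx'.
by case: (size h) sh => [|[|k]] // _; lia.
Qed.

End Heavy.

(** * Comparing the differents of [h] and [gs] over a point of [gs] *)

Section Local.
Variable K : closedFieldType.
Implicit Types (x y t c : K).
Variables (l m : nat) (g h gs hs : {poly K}).
Hypothesis B : bidec l m g h gs hs.

Let sg1 : (1 < size g)%N := bidec_sg1 B.
Let shs1 : (1 < size hs)%N := bidec_shs1 B.
Let sgs1 : (1 < size gs)%N := bidec_sgs1 B.
Let sh1 : (1 < size h)%N := bidec_sh1 B.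
Let dh : h^`() != 0 := bidec_dh B.
Let dhs : hs^`() != 0 := bidec_dh (bidec_sym B).

Lemma sum_dif_le (s : seq K) : uniq s -> (\sum_(x <- s) dif g x <= m.-1)%N.
Proof.
move=> us; have dg := bidec_dg B.
rewrite (leq_trans (@sum_mup_le _ s predT _ dg us)) // count_predT size_zeros //.
have := size_deriv_le (bidec_sg B); have := bidec_m B.
by case: (size _) => [|k]; case: m => //=; lia.
Qed.

Lemma ram_sum_g y : (\sum_(x <- rts (g - y%:P)) ram g x)%N = m.
Proof.
have [n mn] : exists n, m = n.+1 by case: m (bidec_m B) => // n; exists n.
by rewrite mn; apply: sum_ram; rewrite -mn (bidec_sg B).
Qed.

Lemma ram_sum_hs y : (\sum_(t <- rts (hs - y%:P)) ram hs t)%N = m.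
Proof.
have [n mn] : exists n, m = n.+1 by case: m (bidec_m B) => // n; exists n.
by rewrite mn; apply: sum_ram; rewrite -mn (bidec_shs B).
Qed.

(** The indices of [hs] over [(x, y)] add up to [ram g x = 1], so there is a single point,
    unramified for [hs]; the chain rule then copies index and different of [gs] at [y] to [h]. *)
Lemma fib_unram x y : g.[x] = gs.[y] -> ram g x = 1%N ->
  exists2 t, fib h hs x y = [:: t] &
    [/\ h.[t] = x, hs.[t] = y, ram hs t = 1%N, ram h t = ram gs y &
        dif h t = dif gs y].
Proof.
move=> xy r1; have := fib_ram_hs B xy; rewrite r1.
case/sum_eq1 => [t _|t ft rt]; first by rewrite ram_gt0.
exists t => //.
have : t \in fib h hs x y by rewrite ft inE.
rewrite (mem_fib B) => /andP[/eqP htx /eqP hty].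
have := fib_ram_h B xy; rewrite ft big_seq1 => rh; split => //.
have := dif_chain B t; rewrite htx hty rt mul1n.
by rewrite (dif1 r1) (dif1 rt) muln0 add0n addn0.
Qed.

Lemma tot_unram y (s : seq K) : uniq s ->
  (forall x, x \in s -> g.[x] = gs.[y] /\ ram g x = 1%N) ->
  (size s * dif gs y + \sum_(x <- rts (g - gs.[y]%:P) | x \notin s)
      \sum_(t <- fib h hs x y) dif h t)%N = tot h hs y.
Proof.
move=> us su; rewrite (tot_fib B) [RHS](bigID (mem s)) /=; congr (_ + _)%N.
rewrite -big_filter.
have -> : size s = size (filter (mem s) (rts (g - gs.[y]%:P))).
  apply: perm_size; apply: uniq_perm; rewrite ?filter_uniq ?rts_uniq //.
  move=> x; rewrite mem_filter mem_fibre //= .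
  by case xs: (x \in s) => //; have [-> _] := su _ xs; rewrite eqxx.
rewrite big_seq (eq_bigr (fun _ => dif gs y)) => [|x].
  by rewrite -big_seq big_const_seq count_predT iter_addn_0 mulnC.
rewrite mem_filter => /andP[/su[xy r1] _].
by have [t -> [_ _ _ _ e]] := fib_unram xy r1; rewrite big_seq1.
Qed.

Lemma tot_ge y x : g.[x] = gs.[y] -> ram g x = 1%N -> (dif gs y <= tot h hs y)%N.
Proof.
move=> xy r1; rewrite -(@tot_unram y [:: x]) //= ?mul1n ?leq_addr // => z.
by rewrite inE => /eqP ->.
Qed.

(** [dif_chain] summed over the fibre of [hs] at [y]: the indices of [h] over each [(x, y)] add up
    to [ram gs y], those of [hs] to [m]. *)
Lemma tot_balance y :
  (ram gs y * (\sum_(x <- rts (g - gs.[y]%:P)) dif g x) + tot h hs y =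
   m * dif gs y + \sum_(t <- rts (hs - y%:P)) dif hs t)%N.
Proof.
rewrite (totE B).
transitivity (\sum_(t <- rts (hs - y%:P))
    (ram h t * dif g h.[t] + dif h t))%N.
  rewrite big_split /=; congr (_ + _)%N; rewrite (sum_fibre_hs B) big_distrr /=.
  rewrite big_seq [RHS]big_seq; apply: eq_bigr => x.
  rewrite mem_fibre // => /eqP xy.
  rewrite big_seq (eq_bigr (fun t => (ram h t * dif g x)%N)).
    by rewrite -big_seq -big_distrl /= (fib_ram_h B xy).
  by move=> t; rewrite (mem_fib B) => /andP[/eqP ->].
rewrite -[in RHS](ram_sum_hs y) big_distrl -big_split /=.
rewrite big_seq [RHS]big_seq; apply: eq_bigr => t; rewrite mem_fibre // => /eqP ty.
by rewrite (dif_chain B) ty.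
Qed.

Lemma ram_gt1 t : ~~ (ram gs hs.[t] %| ram g h.[t])%N -> (1 < ram h t)%N.
Proof.
apply: contraR; rewrite -leqNgt => le1.
have r1 : ram h t = 1%N by apply/eqP; rewrite eqn_leq le1 ram_gt0.
by apply/dvdnP; exists (ram hs t); have := ram_mul B t; rewrite r1 muln1 mulnC.
Qed.

(** By [ram_gt1] every point over [(x, y)] is ramified for [h], and an index [e >= 2] costs at least
    [e - 1 >= e / 2] in the different. *)
Lemma fib_dif_half x y : g.[x] = gs.[y] -> ~~ (ram gs y %| ram g x)%N ->
  (ram gs y <= 2 * \sum_(t <- fib h hs x y) dif h t)%N.
Proof.
move=> xy nd; rewrite -(fib_ram_h B xy) big_distrr /=.
rewrite big_seq [leqRHS]big_seq; apply: leq_sum => t.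
rewrite (mem_fib B) => /andP[/eqP htx /eqP hty].
have := @ram_gt1 t; rewrite htx hty => /(_ nd).
by have := dif_ge t dh; lia.
Qed.

(* Such a [y] exists because [deg h^`() <= deg gs^`()]. *)
Definition nice y := (0 < dif gs y)%N /\ (tot h hs y <= dif gs y)%N.

Lemma nice_exists : exists y, nice y.
Proof.
have dgs : gs^`() != 0 := bidec_dgs B; have l1 := bidec_l B; have m1 := bidec_m B.
have bal := size_balance B.
have sgs' : (size gs^`() <= l)%N := size_deriv_le (bidec_sgs B).
have sh' : (size h^`() <= l)%N := size_deriv_le (bidec_sh B).
have sh0 : (0 < size h^`())%N by rewrite size_poly_gt0.
have bal2 := leq_mul m1 (leqnn (l - size gs^`())%N); rewrite -bal in bal2.
(* Were the derivative of [gs] constant, its defect would be [l - 1], and that of [h], at least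
   twice as large by [bal2], would exceed the maximum [l - 1]. *)
have s1 : (1 < size gs^`())%N by lia.
have le : (size h^`() <= size gs^`())%N by lia.
have : has (fun y => tot h hs y <= dif gs y)%N (rts gs^`()).
  apply/negPn/negP => /hasPn all_gt.
  have := sum_tot B (rts_uniq gs^`()).
  have := sum_mup_rts dgs.
  have : (\sum_(y <- rts gs^`()) (dif gs y).+1 <= \sum_(y <- rts gs^`()) tot h hs y)%N.
    by rewrite big_seq [leqRHS]big_seq; apply: leq_sum => y /all_gt; rewrite ltnNge.
  rewrite (eq_bigr (fun y => (dif gs y + 1)%N)); last by move=> y _; rewrite addn1.
  rewrite big_split /= sum1_size /dif => ge e tt; move: ge; rewrite e => ge.
  have : (0 < size (rts gs^`()))%N.
    rewrite -has_predT; apply/hasP.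
    have /closed_rootP[y ry] : size gs^`() != 1%N by rewrite neq_ltn s1 orbT.
    by exists y => //; rewrite mem_rts.
  by move: ge tt; move: (\sum_(_ <- _) _)%N (size (rts _)) => a b; slia.
case/hasP => y; rewrite mem_rts // root_mup // => y0 tl.
by exists y.
Qed.

(** The degree of the derivative of [gs] is the sum of [dif gs], at most the sum of [tot], at most
    the degree of the derivative of [h], which by [size_balance] is at most the first. So all are
    equal, and equal defects with ratio [m > 1] vanish. *)
Lemma tot_eq_dif : (forall y, (0 < dif gs y)%N -> (dif gs y <= tot h hs y)%N) ->
  size gs^`() = l /\ forall y, tot h hs y = dif gs y.
Proof.
move=> ge; have dgs : gs^`() != 0 := bidec_dgs B; have l1 := bidec_l B; have m1 := bidec_m B.
have bal := size_balance B.
have sgs' : (size gs^`() <= l)%N := size_deriv_le (bidec_sgs B).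
have sh' : (size h^`() <= l)%N := size_deriv_le (bidec_sh B).
have sh0 : (0 < size h^`())%N by rewrite size_poly_gt0.
have sgs0 : (0 < size gs^`())%N by rewrite size_poly_gt0.
have geS y : y \in rts gs^`() -> (dif gs y <= tot h hs y)%N.
  by rewrite mem_rts // root_mup // => /ge.
have S1 := sum_tot B (rts_uniq gs^`()).
have S2 : (\sum_(y <- rts gs^`()) dif gs y)%N = _ := sum_mup_rts dgs.
have S3 : (\sum_(y <- rts gs^`()) dif gs y <= \sum_(y <- rts gs^`()) tot h hs y)%N.
  by rewrite big_seq [leqRHS]big_seq; apply: leq_sum => y /geS.
have bal2 := leq_mul m1 (leqnn (l - size gs^`())%N); rewrite -bal in bal2.
have le : (size h^`() <= size gs^`())%N by lia.
have eqs : size h^`() = size gs^`() by lia.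
split; first by lia.
move=> y; case yr: (y \in rts gs^`()).
  apply/esym/(sum_le_eq geS) => //.
  by apply: leq_trans S1 _; rewrite eqs -S2.
have := sum_tot B (s := y :: rts gs^`()); rewrite /= yr rts_uniq => /(_ isT).
move/negbT: yr; rewrite mem_rts // root_mup // -leqNgt leqn0 => /eqP e0.
rewrite big_cons => le2; rewrite /dif e0; apply/eqP.
rewrite -leqn0 -(leq_add2r (\sum_(y <- rts gs^`()) tot h hs y)) add0n.
by apply: leq_trans le2 _; rewrite eqs -S2.
Qed.

(** Each exceptional [x] costs at least half of [ram gs y] in [tot], while a tame nice point allows
    only [ram gs y - 1]. *)
Lemma nice_tame y x x' : nice y -> (ram gs y)%:R != 0 :> K ->
  g.[x] = gs.[y] -> g.[x'] = gs.[y] ->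
  ~~ (ram gs y %| ram g x)%N -> ~~ (ram gs y %| ram g x')%N -> x = x'.
Proof.
move=> [pos le] /dif_tame tame gx gx' nx nx'; apply/eqP/negPn/negP => xx'.
have := fib_dif_half gx nx; have := fib_dif_half gx' nx'.
move: le; rewrite (tot_fib B) tame (big_rem x) /=; last by rewrite mem_fibre ?gx.
have x'r : x' \in rem x (rts (g - gs.[y]%:P)).
  rewrite mem_rem_uniq ?rts_uniq // inE mem_fibre // gx' eqxx andbT.
  by rewrite eq_sym.
rewrite (big_rem x' x'r) /=.
by move: pos; rewrite tame; move: (\sum_(_ <- _) _)%N => *; lia.
Qed.

End Local.

Lemma sum_eq1_uniq (T : eqType) (s : seq T) (f : T -> nat) : uniq s ->
  (\sum_(t <- s) f t = 1)%N ->
  exists2 u, u \in s & f u = 1%N /\ {in s, forall t, t != u -> f t = 0%N}.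
Proof.
move=> us e; have [u us1 fu] : exists2 u, u \in s & (0 < f u)%N.
  apply/hasP/negPn/negP => /hasPn f0; move: e; rewrite big_seq big1 // => t /f0.
  by rewrite lt0n negbK => /eqP.
exists u => //; move: e; rewrite (big_rem u) //= => e.
split; first by lia.
move=> t ts tu; have tr : t \in rem u s by rewrite mem_rem_uniq // inE tu.
by move: e; rewrite (big_rem t tr) /=; lia.
Qed.

Lemma modp_sum (F : fieldType) (I : Type) (r : seq I) (P : pred I) (f : I -> {poly F}) q :
  (\sum_(i <- r | P i) f i) %% q = \sum_(i <- r | P i) (f i %% q).
Proof. by apply: (big_morph (fun p => p %% q)) => [p1 p2|]; rewrite ?modpD ?mod0p. Qed.

(** Taking remainders modulo [N] is linear, so a fixed coefficient of the remainder of the value at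
    [a] is a polynomial in [a]; it vanishes identically. *)
Lemma dvdp_coef_family (K : closedFieldType) (N : {poly K}) (V : {poly {poly K}}) :
  (forall a, N %| V.[a%:P]) -> forall i, N %| V`_i.
Proof.
move=> dv i; have [le|lt] := leqP (size V) i; first by rewrite nth_default ?dvdp0.
rewrite /dvdp; apply/eqP/polyP => j; rewrite coef0.
pose P := \poly_(k < size V) (V`_k %% N)`_j.
have P0 : P = 0.
  apply: poly_ext => a; rewrite horner0 horner_poly.
  transitivity ((V.[a%:P] %% N)`_j); last by rewrite modp_eq0 ?coef0.
  rewrite horner_coef modp_sum coef_sum; apply: eq_bigr => k _.
  by rewrite -polyC_exp [in RHS]mulrC mul_polyC modpZl coefZ mulrC.
by have := congr1 (fun p : {poly K} => p`_i) P0; rewrite coef_poly lt coef0.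
Qed.

(** * Wild critical points *)

Section Wild.
Variable K : closedFieldType.
Implicit Types (x y t c : K).
Variables (l m : nat) (g h gs hs : {poly K}).
Hypothesis B : bidec l m g h gs hs.

Let sg1 : (1 < size g)%N := bidec_sg1 B.
Let shs1 : (1 < size hs)%N := bidec_shs1 B.
Let sgs1 : (1 < size gs)%N := bidec_sgs1 B.
Let sh1 : (1 < size h)%N := bidec_sh1 B.
Let dh : h^`() != 0 := bidec_dh B.
Let dhs : hs^`() != 0 := bidec_dh (bidec_sym B).
Let dg : g^`() != 0 := bidec_dg B.
Let dgs : gs^`() != 0 := bidec_dgs B.

(** [E], [b], [T] stand for [dif gs y], [ram gs y], [tot h hs y]; [D] and [R] sum the differents of
    [g] and [hs] over their fibres. The bounds give [n * E + R <= b * n.-1 + E], and [b <= E] turns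
    every inequality into an equality. *)
Lemma wild_arith E b D T R n : (1 < n)%N -> (0 < b)%N -> (b <= E)%N -> (T <= E)%N ->
  (D <= n.-1)%N -> (b * D + T = n * E + R)%N ->
  [/\ E = b, D = n.-1, T = b & R = 0%N].
Proof.
case: n => // n n1 b0 bE TE /= Dn e.
have h1 : (b * D <= b * n)%N by rewrite leq_mul2l Dn orbT.
have h2 : (n * b <= n * E)%N by rewrite leq_mul2l bE orbT.
have e1 : (n * E + R <= b * n)%N by rewrite mulSn in e; lia.
have R0 : R = 0%N by rewrite mulnC in h2; lia.
have nE : (n * E = n * b)%N by rewrite mulnC in e1; rewrite mulnC; lia.
have Eb : E = b by apply/eqP; rewrite -(@eqn_pmul2l n) ?nE //; lia.
move: e; rewrite Eb R0 => e.
have bD : (b * n <= b * D)%N by rewrite mulSn mulnC in e; rewrite [in leqLHS]mulnC; lia.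
have Dn' : D = n by apply/eqP; rewrite eqn_leq Dn -(@leq_pmul2l b).
by split=> //; rewrite Dn' mulSn mulnC in e; lia.
Qed.

Lemma wild_nice y : nice h gs hs y -> (ram gs y)%:R = 0 :> K ->
  [/\ dif gs y = ram gs y,
      (\sum_(x <- rts (g - gs.[y]%:P)) dif g x = m.-1)%N &
      forall t, hs.[t] = y -> dif hs t = 0%N /\ ram hs t = 1%N].
Proof.
move=> [pos le] w.
have Dle := sum_dif_le B (rts_uniq (g - gs.[y]%:P)).
have [E1 D1 T1 R1] := wild_arith (bidec_m B) (ram_gt0 y sgs1) (dif_wild dgs w) le
  Dle (tot_balance B y).
split=> // t ht.
have d0 : dif hs t = 0%N.
  apply/eqP; rewrite -leqn0 -R1 (big_rem t) ?leq_addr //=.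
  by rewrite mem_fibre // ht.
by split=> //; have := dif_ge t dhs; have := ram_gt0 t shs1; lia.
Qed.

(** As [hs] is unramified over [y], the chain rule gives [dif g x <= ram g x] on the fibre, with
    total slack [m - (m - 1) = 1]. The slack sits at one point [x1], which is tame because a wild
    point has none. The other points are wild, [h] is unramified above them, and so they share the
    index of [gs] at [y]. *)
Lemma wild_fibre y : nice h gs hs y -> (ram gs y)%:R = 0 :> K ->
  exists x1, [/\ g.[x1] = gs.[y], (ram g x1)%:R != 0 :> K,
    (ram g x1 %| ram gs y)%N &
    forall x, x != x1 -> g.[x] = gs.[y] ->
      [/\ ram g x = ram gs y, dif g x = ram gs y &
       forall t, h.[t] = x -> hs.[t] = y -> [/\ dif h t = 0%N, dif hs t = 0%N,
          ram h t = 1%N & ram hs t = 1%N]]].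
Proof.
move=> ny w; have [Eb Dm hsu] := wild_nice ny w.
have b0 := ram_gt0 y sgs1.
have key x t : h.[t] = x -> hs.[t] = y ->
    (ram g x * ram h t = ram gs y)%N /\ (ram h t * dif g x + dif h t = ram gs y)%N.
  move=> ht hst; have [d0 r1] := hsu _ hst; split.
    by rewrite -ht (ram_mul B) hst r1 muln1.
  by have := dif_chain B t; rewrite ht hst d0 r1 Eb mul1n addn0.
have Dle x : g.[x] = gs.[y] -> (dif g x <= ram g x)%N.
  move=> xy; have [t] := fib_neq0 B xy.
  rewrite (mem_fib B) => /andP[/eqP ht /eqP hst].
  have [k1 k2] := key _ _ ht hst.
  rewrite -(@leq_pmul2l (ram h t)) ?ram_gt0 // [leqRHS]mulnC k1 -k2.
  exact: leq_addr.
have S1 : (\sum_(x <- rts (g - gs.[y]%:P)) (ram g x - dif g x) = 1)%N.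
  have e : (\sum_(x <- rts (g - gs.[y]%:P)) (ram g x - dif g x) + m.-1 = m)%N.
    rewrite -Dm -big_split /= -[RHS](ram_sum_g B gs.[y]).
    rewrite big_seq [RHS]big_seq; apply: eq_bigr => x.
    by rewrite mem_fibre // => /eqP /Dle /subnK.
  by have := bidec_m B; lia.
have wildx x t : h.[t] = x -> hs.[t] = y -> g.[x] = gs.[y] -> (ram g x)%:R = 0 :> K ->
    [/\ ram g x = ram gs y, dif g x = ram gs y, dif h t = 0%N & ram h t = 1%N].
  move=> ht hst xy xw; have [k1 k2] := key _ _ ht hst.
  have dx : dif g x = ram g x.
    by apply/eqP; rewrite eqn_leq Dle // dif_wild.
  have d0 : dif h t = 0%N.
    by apply/eqP; rewrite -(eqn_add2l (ram h t * dif g x)%N) k2 dx addn0 mulnC k1.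
  have r1 : ram h t = 1%N by have := dif_ge t dh; have := ram_gt0 t sh1; lia.
  by move: k1; rewrite r1 muln1 => k1; rewrite dx.
have [x1] := sum_eq1_uniq (rts_uniq _) S1.
rewrite mem_fibre // => /eqP x1y [f1 f0].
exists x1; split=> //.
- apply/eqP => xw; have [t] := fib_neq0 B x1y.
  rewrite (mem_fib B) => /andP[/eqP ht /eqP hst].
  by have [a1 a2 _ _] := wildx _ _ ht hst x1y xw; move: f1; rewrite a1 a2 subnn.
- have [t] := fib_neq0 B x1y; rewrite (mem_fib B) => /andP[/eqP ht /eqP hst].
  by have [k1 _] := key _ _ ht hst; apply/dvdnP; exists (ram h t); rewrite mulnC.
move=> x xx1 xy.
have xw : (ram g x)%:R = 0 :> K.
  apply/eqP/negPn/negP => /dif_tame dx; have := ram_gt0 x sg1.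
  have := f0 x; rewrite mem_fibre // xy eqxx => /(_ isT xx1); rewrite dx; lia.
have [t] := fib_neq0 B xy; rewrite (mem_fib B) => /andP[/eqP ht /eqP hst].
have [-> -> _ _] := wildx _ _ ht hst xy xw; split=> // u hu hsu'.
by have [_ _ -> ->] := wildx _ _ hu hsu' xy xw; have [-> ->] := hsu _ hsu'.
Qed.

Lemma comp_neq (X : {poly K}) : X \Po hs - h != 0.
Proof.
rewrite subr_eq0; apply/eqP => e; have := size_comp_poly X hs.
rewrite e (bidec_sh B) (bidec_shs B) /= => el.
have := bidec_co B; rewrite el coprimeMl => /andP[_].
by rewrite /coprime gcdnn => /eqP m1; have := bidec_m B; rewrite m1.
Qed.

(** Intersection of the curve with the graph [x = X(y)]: by [bidec_fibre] with the sides exchanged,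
    [(g \Po X) - gs] is the norm of [X \Po hs - h] along [hs]. *)
Lemma norm_comp (X : {poly K}) : exists2 c, c != 0 &
  (g \Po X) - gs = c *: \prod_(u <- zeros (X \Po hs - h)) ('X - hs.[u]%:P).
Proof.
have [c c0 Nc] := norm_poly shs1 (bidec_hsm B) (comp_neq X).
exists c => //; apply: poly_ext => y; rewrite -Nc.
have := congr1 (horner^~ X.[y]) (bidec_fibre (bidec_sym B) y).
rewrite horner_prod !hornerE /= horner_comp => <-.
rewrite big_seq [RHS]big_seq; apply: eq_bigr => u.
rewrite mem_zeros ?subC_neq0 // /root !hornerE subr_eq0 => /eqP uy.
  by rewrite horner_comp uy.
Qed.

Lemma norm_mup (X : {poly K}) (s : seq K) y : uniq s ->
  {in s, forall u, hs.[u] = y} ->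
  (g \Po X) - gs != 0 /\
  (\sum_(u <- s) mup u (X \Po hs - h) <= mup y ((g \Po X) - gs))%N.
Proof.
move=> us su; have [c c0 e] := norm_comp X.
have P0 : \prod_(u <- zeros (X \Po hs - h)) ('X - hs.[u]%:P) != 0.
  by rewrite -(big_map (horner hs) predT (fun z => 'X - z%:P)) monic_neq0 ?monic_prod_XsubC.
rewrite e scaler_eq0 negb_or c0 P0; split=> //.
rewrite mupZ // -(big_map (horner hs) predT (fun z => 'X - z%:P)) mu_prod_XsubC count_map.
apply: leq_trans (sum_mup_le (fun u => hs.[u] == y) (comp_neq X) us).
rewrite big_seq [leqRHS]big_seq_cond leq_eqVlt; apply/orP; left; apply/eqP.
by apply: eq_bigl => u; case us1: (u \in s) => //=; rewrite su // eqxx.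
Qed.

Lemma mup_ge2 t (p : {poly K}) : p != 0 -> p.[t] = 0 -> p^`().[t] = 0 ->
  (1 < mup t p)%N.
Proof.
move=> p0 pt dpt; have [q qt [Dp Dd]] := deriv_mup t p0.
rewrite ltnNge; apply/negP => le1.
have : (0 < mup t p)%N by rewrite -root_mup // /root pt.
move: dpt; rewrite Dd.
case: (mup t p) le1 => [|[|k]] // _ + _; rewrite mulr0n addr0 !mulr1n expr0 mul1r.
rewrite !hornerE subrr mul0r addr0 => /eqP; exact/negP.
Qed.

(* Where both curves have the same slope [mu] at all the points above [(x,y)],
   the parabolas [x + mu (Y-y) + a (Y-y)^2] all meet the curve with multiplicity at
   least twice the number of points; comparing them for varying [a] bounds it. *)
Lemma parabola_bound (x y mu : K) (s : seq K) : uniq s -> mu != 0 ->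
  {in s, forall t, [/\ h.[t] = x, hs.[t] = y & h^`().[t] = mu * hs^`().[t]]} ->
  (2 * size s <= dif g x + 2)%N.
Proof.
move=> us mu0 ss; pose Y := 'X - y%:P : {poly K}.
pose X a := x%:P + mu *: Y + a *: Y ^+ 2.
have Xy a : (X a).[y] = x.
  by rewrite /X /Y expr2 !(hornerD, hornerC, hornerZ, hornerM, hornerX, hornerN, subrr); ring.
have dXy a : (X a)^`().[y] = mu.
  rewrite /X /Y expr2 !derivD derivC !derivZ derivM derivXsubC.
  by rewrite !(hornerD, hornerC, hornerZ, hornerM, hornerX, hornerN, subrr); ring.
have dvX a : Y ^+ (2 * size s) %| (g \Po X a) - gs.
  have [N0 N1] := @norm_mup (X a) s y us (fun u us1 => let: And3 _ e _ := ss u us1 in e).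
  rewrite -mup_geq // (leq_trans _ N1) // -(sum1_size s) big_distrr /=.
  rewrite big_seq [leqRHS]big_seq; apply: leq_sum => t /ss[ht hst slope].
  apply: mup_ge2; first exact: comp_neq.
    by rewrite hornerD hornerN horner_comp hst Xy ht subrr.
  by rewrite derivB deriv_comp hornerD hornerN hornerM horner_comp hst dXy slope subrr.
(* The parameter [a] becomes the variable of [W]. The linear coefficient is the derivative of [g]
   along the line, times [Y ^+ 2]; as [mu != 0], its multiplicity at [y] is [dif g x + 2]. *)
pose W := (map_poly polyC g) \Po ((x%:P + mu *: Y)%:P + (Y ^+ 2)%:P * 'X) - gs%:P.
have : Y ^+ (2 * size s) %| W`_1.
  apply: dvdp_coef_family => a.
  rewrite /W !hornerE horner_comp !hornerE; have := dvX a; rewrite /X /comp_poly.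
  by rewrite mulrC mul_polyC.
have -> : W`_1 = (g^`() \Po (x%:P + mu *: Y)) * Y ^+ 2.
  have -> : W`_1 = W^`().[0] by rewrite horner_coef0 coef_deriv.
  rewrite /W derivB derivC subr0 deriv_comp derivD derivC add0r.
  rewrite deriv_mulC derivX mulr1; set Q := Y ^+ 2.
  rewrite hornerM hornerC horner_comp hornerD hornerC hornerM hornerC hornerX.
  by rewrite mulr0 addr0 deriv_map.
have sl : (size (mu *: Y + x%:P)%R = 2)%N.
  by rewrite size_polyDl size_scale // ?size_XsubC // size_polyC; case: eqP.
have C0 : g^`() \Po (x%:P + mu *: Y) != 0.
  by rewrite comp_poly_eq0 // addrC sl.
have Y0 : Y != 0 by rewrite polyXsubC_eq0.
rewrite /Y -mup_geq ?mulf_neq0 ?expf_neq0 // mupM ?expf_neq0 // mup_XsubCX eqxx -/Y.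
rewrite mup_comp // 1?addrC ?sl //.
have -> : (mu *: Y + x%:P).[y] = x by rewrite !hornerE subrr mulr0 add0r.
by rewrite addrK mupZ // (@mup_XsubCX _ 1) eqxx muln1.
Qed.

End Wild.

Section MonicRoots.
Variable K : closedFieldType.
Implicit Types (p q : {poly K}) (x : K).

Lemma monic_mup_ext p q : p \is monic -> q \is monic ->
  (forall x, mup x p = mup x q) -> p = q.
Proof.
move=> pm qm pq; rewrite (zeros_monic pm) (zeros_monic qm); apply: perm_big.
by apply/allP => x _ /=; rewrite !count_zeros ?monic_neq0 // pq.
Qed.

Lemma mup_split p x1 : p \is monic -> exists2 r, r \is monic &
  p = ('X - x1%:P) ^+ mup x1 p * r /\
  forall x, mup x r = if x == x1 then 0%N else mup x p.
Proof.
move=> pm; have p0 := monic_neq0 pm; have [r rx Dp] := mupP x1 p0.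
have rm : r \is monic.
  by move: pm; rewrite {1}Dp monicMl ?monic_exp ?monicXsubC.
exists r => //; split=> // x; have [->|xx1] := eqVneq x x1.
  by rewrite mupNroot.
rewrite [in RHS]Dp mupM ?mup_XsubCX ?expf_neq0 ?polyXsubC_eq0 ?monic_neq0 //.
by rewrite eq_sym (negPf xx1).
Qed.

Lemma root_extract p n : p \is monic -> (forall x, n %| mup x p)%N ->
  exists2 q, q \is monic & p = q ^+ n.
Proof.
have [k] := ubnP (size p); elim: k p => // k IHk p sp pm dv.
have p0 := monic_neq0 pm.
have [s1|] := eqVneq (size p) 1%N.
  exists 1; rewrite ?monic1 // expr1n; apply/eqP.
  by rewrite -eqp_monic ?monic1 // -size_poly_eq1 s1.
case/closed_rootP => x rx; have [r rm [Dp mr]] := mup_split x pm.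
have [||q qm Dr] := IHk r _ rm.
- have : (0 < mup x p)%N by rewrite -root_mup.
  have := sp; rewrite {1}Dp size_Mmonic ?expf_neq0 ?polyXsubC_eq0 //.
  by rewrite size_exp_XsubC /=; lia.
- by move=> z; rewrite mr; case: ifP; rewrite ?dvdn0.
have /dvdnP[j ej] := dv x; exists (('X - x%:P) ^+ j * q).
  by rewrite monicMl ?monic_exp ?monicXsubC.
by rewrite exprMn -Dr -exprM -ej -Dp.
Qed.

Lemma mup_le_dvdp p q : p != 0 -> q != 0 -> (forall x, mup x p <= mup x q)%N ->
  p %| q.
Proof.
have [k] := ubnP (size p); elim: k p q => // k IHk p q sp p0 q0 le.
have [s1|] := eqVneq (size p) 1%N.
  by move/eqP: s1; rewrite size_poly_eq1 => /eqp_dvdl ->; rewrite dvd1p.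
case/closed_rootP => x rx; have [r rrx Dp] := mupP x p0.
have r0 : r != 0 by apply: contraNneq rrx => ->; rewrite root0.
have /dvdpP[q1 Dq] : ('X - x%:P) ^+ mup x p %| q by rewrite -mup_geq.
have q10 : q1 != 0 by apply: contraNneq q0 => e; rewrite Dq e mul0r.
rewrite Dp Dq mulrC dvdp_mul // IHk //.
  have : (0 < mup x p)%N by rewrite -root_mup.
  have := sp; rewrite {1}Dp mulrC size_Mmonic ?monic_exp ?monicXsubC //.
  by rewrite size_exp_XsubC; move: r0; rewrite -size_poly_gt0; slia.
move=> z; have := le z; rewrite {1}Dp {1}Dq !mupM ?expf_neq0 ?polyXsubC_eq0 //.
by rewrite addnC leq_add2r.
Qed.

End MonicRoots.

(** A logarithmic derivative with denominators cleared: a power whose exponent vanishes in [F] does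
    not contribute. *)
Lemma deriv_pow_wild (F : fieldType) (A Q : {poly F}) k b : b%:R = 0 :> F ->
  (A ^+ k * Q ^+ b)^`() * A = (A^`() *+ k) * (A ^+ k * Q ^+ b).
Proof.
move=> b0; rewrite derivM !deriv_exp.
have -> : Q^`() * Q ^+ b.-1 *+ b = 0.
  by rewrite -mulr_natr -polyC_natr b0 mulr0.
rewrite mulr0 addr0; case: k => [|k]; first by rewrite !mulr0n !mul0r.
by rewrite /= exprS -!mulrnAl; ring.
Qed.

Definition totram (F : fieldType) (p : {poly F}) :=
  exists c x0, p - c%:P = ('X - x0%:P) ^+ (size p).-1.

(** The pattern of odd-degree Dickson polynomials in characteristic two: one critical value, over
    which one point is simple and the others are double with different exponent two. The point [x2]
    records that [g] is not injective over [c]. *)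
Definition wild_data (K : closedFieldType) l (g h gs hs : {poly K}) :=
  exists c x1 x2, [/\ 2%:R = 0 :> K,
   [/\ g.[x1] = c, ram g x1 = 1%N, x2 != x1 & g.[x2] = c],
   (forall x, x != x1 -> g.[x] = c -> ram g x = 2%N /\ dif g x = 2%N),
   (forall y, (0 < dif gs y)%N -> [/\ gs.[y] = c, ram gs y = 2%N & dif gs y = 2%N]) &
   size gs^`() = l /\ forall y, tot h hs y = dif gs y].

(** For [g], the pattern of odd-degree Dickson polynomials outside characteristic two. Of [gs] only
    the critical points are described, so that its degree may be even. *)
Definition tame_data (K : closedFieldType) l m (g h gs hs : {poly K}) :=
  exists c c' x1 x1', [/\ 2%:R != 0 :> K /\ c != c',
   [/\ g.[x1] = c, ram g x1 = 1%N, g.[x1'] = c' & ram g x1' = 1%N] /\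
   (forall x, g.[x] = c /\ x != x1 \/ g.[x] = c' /\ x != x1' -> ram g x = 2%N),
   (forall y, (0 < dif gs y)%N ->
      [/\ gs.[y] = c \/ gs.[y] = c', ram gs y = 2%N & dif gs y = 1%N]),
   size g^`() = m & size gs^`() = l /\ forall y, tot h hs y = dif gs y].

Section WildClass.
Variable K : closedFieldType.
Implicit Types (x y t c : K).
Variables (l m : nat) (g h gs hs : {poly K}).
Hypothesis B : bidec l m g h gs hs.

Let sg1 : (1 < size g)%N := bidec_sg1 B.
Let shs1 : (1 < size hs)%N := bidec_shs1 B.
Let sgs1 : (1 < size gs)%N := bidec_sgs1 B.
Let sh1 : (1 < size h)%N := bidec_sh1 B.
Let dh : h^`() != 0 := bidec_dh B.
Let dhs : hs^`() != 0 := bidec_dh (bidec_sym B).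
Let dg : g^`() != 0 := bidec_dg B.
Let dgs : gs^`() != 0 := bidec_dgs B.

(** The logarithmic derivative of [(g \Po h) - c%:P], computed once through [h] and once through
    [hs]; the powers with exponent [b] drop out. *)
Lemma slope_identity c x1 y k b (q U : {poly K}) : b%:R = 0 :> K ->
  g - c%:P = ('X - x1%:P) ^+ k * q ^+ b ->
  gs - c%:P = ('X - y%:P) ^+ b * U ->
  (h^`() *+ k) * (U \Po hs) = (h - x1%:P) * ((U^`() \Po hs) * hs^`()).
Proof.
move=> b0 eg egs; set f := g \Po h - c%:P.
have f0 : f != 0.
  have ml : (0 < m * l)%N by rewrite muln_gt0 (ltnW (bidec_m B)) (ltnW (bidec_l B)).
  have := size_comp_poly g h; rewrite (bidec_sg B) (bidec_sh B) /= => e.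
  rewrite subC_neq0 //; move: ml; rewrite -e.
  by case: (size _) => [|[|n]].
have e1 : f = (h - x1%:P) ^+ k * (q \Po h) ^+ b.
  rewrite /f -[c%:P](comp_polyC c h) -comp_polyB eg comp_polyM !rmorphXn /=.
  by rewrite comp_polyB comp_polyX comp_polyC.
have e2 : f = (hs - y%:P) ^+ b * (U \Po hs).
  rewrite /f (bidec_eq B) -[c%:P](comp_polyC c hs) -comp_polyB egs comp_polyM rmorphXn /=.
  by rewrite comp_polyB comp_polyX comp_polyC.
have d1 : f^`() * (h - x1%:P) = (h^`() *+ k) * f.
  by rewrite {1}e1 deriv_pow_wild // -e1 derivB derivC subr0.
have d2 : f^`() * (U \Po hs) = f * ((U^`() \Po hs) * hs^`()).
  rewrite {1 2}e2 derivM deriv_exp -mulr_natr -polyC_natr b0 mulr0 mul0r add0r.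
  by rewrite deriv_comp; ring.
by apply: (mulfI f0); rewrite mulrA [f * _]mulrC -d1 mulrAC d2; ring.
Qed.

(** By [slope_identity] the derivatives of [h] and [hs] have the same quotient at all points over
    [(x2, y)]. There are [b] such points, [h] being unramified there, so [parabola_bound] gives
    [2 * b <= b + 2]; and [b != 1] as [b] vanishes in [K]. *)
Lemma wild_two y x2 : nice h gs hs y -> (ram gs y)%:R = 0 :> K ->
  forall x1, g.[x1] = gs.[y] -> (ram g x1)%:R != 0 :> K -> 
  (ram g x1 %| ram gs y)%N ->
  (forall x, x != x1 -> g.[x] = gs.[y] ->
      [/\ ram g x = ram gs y, dif g x = ram gs y &
       forall t, h.[t] = x -> hs.[t] = y -> [/\ dif h t = 0%N, dif hs t = 0%N,
          ram h t = 1%N & ram hs t = 1%N]]) ->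
  x2 != x1 -> g.[x2] = gs.[y] ->
  [/\ ram gs y = 2%N, 2%:R = 0 :> K & ram g x1 = 1%N].
Proof.
move=> ny w x1 x1y k0 kb oth x21 x2y.
set b := ram gs y in w kb oth *; set k := ram g x1 in k0 kb; set c := gs.[y].
have gm : g - c%:P \is monic by rewrite monic_subC // (bidec_gm B).
have gsm : gs - c%:P \is monic by rewrite monic_subC // (bidec_gsm B).
have [r rm [Dg mr]] := mup_split x1 gm.
rewrite (mup_eq_ram x1y) -/k in Dg.
have [q _ Dr] : exists2 q, q \is monic & r = q ^+ b.
  apply: root_extract => // x; rewrite mr; case: eqP => [|/eqP xx1]; first by rewrite dvdn0.
  have [/eqP xy|/eqP nxy] := boolP (g.[x] == c).
    by rewrite (mup_eq_ram xy); have [->] := oth _ xx1 xy.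
  rewrite mupNroot ?dvdn0 // /root !hornerE subr_eq0; exact/eqP.
rewrite {}Dr in Dg.
have [U Uy Dgs] := mupP y (monic_neq0 gsm).
rewrite (mup_eq_ram (erefl c)) -/b in Dgs.
have slope := slope_identity w Dg Dgs.
have fibP t : t \in fib h hs x2 y -> [/\ h.[t] = x2, hs.[t] = y,
    h^`().[t] != 0, hs^`().[t] != 0 & ram h t = 1%N].
  rewrite (mem_fib B) => /andP[/eqP ht /eqP hst].
  have [_ _ /(_ _ ht hst)[d1 d2 r1 _]] := oth _ x21 x2y; split=> //.
    by move: d1 => /eqP; apply: contraLR; rewrite negbK -lt0n /dif -root_mup.
  by move: d2 => /eqP; apply: contraLR; rewrite negbK -lt0n /dif -root_mup.
have slopet t : t \in fib h hs x2 y ->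
   k%:R * U.[y] * h^`().[t] = (x2 - x1) * U^`().[y] * hs^`().[t].
  move=> /fibP[ht hst _ _ _]; have := congr1 (horner^~ t) slope.
  rewrite !hornerM hornerMn !horner_comp hornerD hornerN hornerC ht hst => e.
  by rewrite -[RHS]mulrA -e -mulr_natr; ring.
have kU : k%:R * U.[y] != 0 by rewrite mulf_neq0.
pose mu := (x2 - x1) * U^`().[y] / (k%:R * U.[y]).
have mut t : t \in fib h hs x2 y -> h^`().[t] = mu * hs^`().[t].
  by move=> /slopet e; apply: (mulfI kU); rewrite e /mu [RHS]mulrA [in RHS](mulrC (k%:R * _)) divfK.
have mu0 : mu != 0.
  have [t tf] := fib_neq0 B x2y; have [_ _ ht _ _] := fibP _ tf.
  by move: ht; rewrite (mut _ tf) mulf_eq0 negb_or => /andP[].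
have := @parabola_bound _ _ _ _ _ _ _ B x2 y mu (fib h hs x2 y)
   (fib_uniq _ _ _ _) mu0.
have -> : size (fib h hs x2 y) = b.
  rewrite /b -(fib_ram_h B x2y) -sum1_size big_seq [RHS]big_seq.
  by apply: eq_bigr => t /fibP[_ _ _ _ ->].
have [_ -> _] := oth _ x21 x2y.
move=> /(_ (fun t tf => let: And5 a1 a2 _ _ _ := fibP t tf in And3 a1 a2 (mut t tf))).
have b0 : (0 < b)%N by rewrite ram_gt0.
have b1 : b != 1%N by apply: contra_eq_neq w => ->; rewrite oner_neq0.
move=> le; have b2 : b = 2%N.
  by case: (b) le b0 b1 => [|[|[|n]]] //; rewrite mul2n -addnn leq_add2l.
have two0 : 2%:R = 0 :> K by rewrite -w b2.
split=> //; move: kb; rewrite b2 dvdn_divisors // !inE => /orP[/eqP //|/eqP k2].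
by move: k0; rewrite k2 two0 eqxx.
Qed.

(** The point over [x1] already contributes [dif gs y], which is all of [tot h hs y]; hence no other
    point over [y] is critical for [h]. *)
Lemma tot_unram_branch t x1 : (forall y, tot h hs y = dif gs y) ->
  g.[x1] = gs.[hs.[t]] -> ram g x1 = 1%N -> (0 < dif h t)%N ->
  [/\ h.[t] = x1, dif h t = dif gs hs.[t] & ram h t = ram gs hs.[t]].
Proof.
move=> te x1y r1 d0; set y := hs.[t] in x1y *.
have unr x : x \in [:: x1] -> g.[x] = gs.[y] /\ ram g x = 1%N.
  by rewrite inE => /eqP ->.
have := tot_unram B (isT : uniq [:: x1]) unr.
rewrite te mul1n => /eqP; rewrite -[X in _ == X]addn0 eqn_add2l => /eqP rest0.
have ht : h.[t] = x1.
  apply/eqP/negPn/negP => ne; move/eqP: rest0.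
  rewrite (big_rem h.[t]) /=; last by rewrite mem_fibre // (bidec_val t B).
  rewrite inE ne (big_rem t) /=; last by rewrite (mem_fib B) !eqxx.
  by rewrite !addn_eq0 [dif h t == _]eqn0Ngt d0.
have [u fu [hu hsu _ e1 e2]] := fib_unram B x1y r1.
have : t \in fib h hs x1 y by rewrite (mem_fib B) ht !eqxx.
by rewrite fu inE => /eqP ->; rewrite e1 e2.
Qed.

Lemma totram_one c x1 : g.[x1] = c -> (forall x, g.[x] = c -> x = x1) -> totram g.
Proof.
move=> x1c un; exists c, x1.
have gm : g - c%:P \is monic by rewrite monic_subC // (bidec_gm B).
have [r rm [Dg mr]] := mup_split x1 gm.
have r1 : r = 1.
  apply: monic_mup_ext; rewrite ?monic1 // => x.
  rewrite mr [RHS]mupNroot ?root1 //; case: eqP => // xx1.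
  rewrite mupNroot // /root !hornerE subr_eq0; apply/eqP => /un; exact: xx1.
rewrite Dg r1 mulr1; congr (_ ^+ _).
have := congr1 (fun p : {poly K} => size p) Dg.
by rewrite /= r1 mulr1 size_subC // size_exp_XsubC => ->.
Qed.

Lemma wild_class y : nice h gs hs y -> (ram gs y)%:R = 0 :> K ->
  totram g \/ wild_data l g h gs hs.
Proof.
move=> ny w; have [x1 [x1c k0 kb oth]] := wild_fibre B ny w.
have [Eb Dm _] := wild_nice B ny w.
set c := gs.[y] in x1c oth Dm.
have [/hasP[x2 x2r x21]|/hasPn none] := boolP (has (predC1 x1) (rts (g - c%:P))); last first.
  left; apply: (@totram_one c x1) => // x xc; apply/eqP.
  by have := none x; rewrite mem_fibre // xc eqxx => /(_ isT); rewrite negbK.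
right; exists c, x1, x2.
move: x2r; rewrite mem_fibre // => /eqP x2c.
have [b2 two0 r1] := wild_two ny w x1c k0 kb oth x21 x2c.
have othc x : x != x1 -> g.[x] = c -> ram g x = 2%N /\ dif g x = 2%N.
  by move=> xx1 xc; have [-> ->] := oth _ xx1 xc; rewrite b2.
(* The fibre over [c] exhausts the different of [g], bounded by [m.-1]. *)
have nonc x : g.[x] != c -> ram g x = 1%N.
  move=> xc; have d0 : dif g x = 0%N.
    have := @sum_dif_le _ _ _ _ _ _ _ B (x :: rts (g - c%:P)).
    rewrite /= mem_fibre // xc rts_uniq big_cons Dm => /(_ isT).
    by rewrite -[leqRHS]add0n leq_add2r leqn0 => /eqP.
  exact: ram1_dif0.
have ge y' : (dif gs y' <= tot h hs y')%N.
  have [e|ne] := eqVneq gs.[y'] c; first by apply: (tot_ge B (x := x1)); rewrite ?e.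
  have /closed_rootP[x] : size (g - gs.[y']%:P) != 1%N by rewrite size_subC // neq_ltn sg1 orbT.
  rewrite /root !hornerE subr_eq0 => /eqP xe.
  by apply: (tot_ge B xe); rewrite nonc // xe.
have [sgs' te] := tot_eq_dif B (fun y' _ => ge y').
split=> //; move=> y' d0.
(* Otherwise all [m] points over [gs.[y']] are unramified, and each contributes [dif gs y'] to
   [tot]. *)
have nc : gs.[y'] = c.
  apply/eqP/negPn/negP => ne.
  have unr x : x \in rts (g - gs.[y']%:P) -> g.[x] = gs.[y'] /\ ram g x = 1%N.
    by rewrite mem_fibre // => /eqP xe; rewrite nonc ?xe.
  have := tot_unram B (rts_uniq _) unr.
  have -> : size (rts (g - gs.[y']%:P)) = m.
    rewrite -(ram_sum_g B gs.[y']) -sum1_size big_seq [RHS]big_seq.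
    by apply: eq_bigr => x /unr[_ ->].
  rewrite te => e; have := bidec_m B => m1.
  have : (2 * dif gs y' <= dif gs y')%N.
    by rewrite -[leqRHS]e (leq_trans (leq_mul m1 (leqnn _))) // leq_addr.
  by lia.
have ny' : nice h gs hs y' by split; rewrite ?te.
(* For a tame [y'] the index does not divide [ram g x1 = 1], so by [nice_tame] it divides
   [ram g x2 = 2]; but two is zero in [K]. *)
have w' : (ram gs y')%:R = 0 :> K.
  apply/eqP/negPn/negP => tame.
  have dt := dif_tame tame.
  have r2 : (1 < ram gs y')%N by move: d0; rewrite dt; lia.
  have n1 : ~~ (ram gs y' %| ram g x1)%N.
    by rewrite r1 dvdn1 neq_ltn r2 orbT.
  have dv2 : (ram gs y' %| ram g x2)%N.
    apply: contraTT x21 => n2; rewrite negbK; apply/eqP.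
    exact: (nice_tame B ny' tame (etrans x2c (esym nc)) (etrans x1c (esym nc)) n2 n1).
  move: dv2; have [-> _] := othc _ x21 x2c.
  rewrite dvdn_divisors // !inE => /orP[/eqP e|/eqP e]; first by rewrite e in r2.
  by move: tame; rewrite e two0 eqxx.
have [x1' [x1c' k0' _ oth']] := wild_fibre B ny' w'.
have x21' : x2 != x1'.
  apply: contra_neq k0' => <-; have [-> _] := othc _ x21 x2c; exact: two0.
have [e _ _] := oth' _ x21' (etrans x2c (esym nc)).
have [Eb' _ _] := wild_nice B ny' w'.
have [e2 _] := othc _ x21 x2c.
by rewrite Eb' -e e2.
Qed.

End WildClass.

Lemma dvd2_eq b : (1 < b)%N -> (b %| 2)%N -> b = 2%N.
Proof. by move=> b1 /(dvdn_leq (isT : 0 < 2)%N); lia. Qed.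

(** * Tame critical points *)

Section Tame.
Variable K : closedFieldType.
Implicit Types (x y t c : K).
Variables (l m : nat) (g h gs hs : {poly K}).
Hypothesis B : bidec l m g h gs hs.

Let sg1 : (1 < size g)%N := bidec_sg1 B.
Let shs1 : (1 < size hs)%N := bidec_shs1 B.
Let sgs1 : (1 < size gs)%N := bidec_sgs1 B.
Let sh1 : (1 < size h)%N := bidec_sh1 B.
Let dh : h^`() != 0 := bidec_dh B.
Let dhs : hs^`() != 0 := bidec_dh (bidec_sym B).
Let dg : g^`() != 0 := bidec_dg B.
Let dgs : gs^`() != 0 := bidec_dgs B.

Lemma fibre_nonempty c : exists x, g.[x] = c.
Proof.
have /closed_rootP[x] : size (g - c%:P) != 1%N by rewrite size_subC // neq_ltn sg1 orbT.
by rewrite /root !hornerE subr_eq0 => /eqP xe; exists x.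
Qed.

Lemma nice_tame_exc y : nice h gs hs y -> (ram gs y)%:R != 0 :> K ->
  exists2 x1, g.[x1] = gs.[y] & forall x, x != x1 -> g.[x] = gs.[y] ->
     (ram gs y %| ram g x)%N.
Proof.
move=> ny ty.
have [/hasP[x1]|/hasPn all] :=
  boolP (has (fun x => ~~ (ram gs y %| ram g x)%N) (rts (g - gs.[y]%:P))).
  rewrite mem_fibre // => /eqP x1y n1; exists x1 => // x xx1 xy.
  apply: contraNT xx1 => n2; apply/eqP; exact: (nice_tame B ny ty xy x1y n2 n1).
have [x1 x1y] := fibre_nonempty gs.[y]; exists x1 => // x _ xy.
by have := all x; rewrite mem_fibre // xy eqxx negbK; apply.
Qed.

Lemma half_count c x1 : g.[x1] = c ->
  (forall x, x != x1 -> g.[x] = c -> (1 < ram g x)%N) ->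
  (2 * size (rts (g - c%:P)) <= m.+1)%N /\
  ((2 * size (rts (g - c%:P)) = m.+1)%N ->
     ram g x1 = 1%N /\ forall x, x != x1 -> g.[x] = c -> ram g x = 2%N).
Proof.
move=> x1c gt1; set s := rts (g - c%:P).
have x1s : x1 \in s by rewrite mem_fibre // x1c.
pose T := (\sum_(x <- rem x1 s) ram g x)%N.
have S : (ram g x1 + T = m)%N by rewrite -(ram_sum_g B c) -/s (big_rem x1 x1s).
have sz : (size (rem x1 s) + 1 = size s)%N.
  by rewrite size_rem // addn1 prednK // -has_predT; apply/hasP; exists x1.
have gt1s x : x \in rem x1 s -> (2 <= ram g x)%N.
  by rewrite mem_rem_uniq ?rts_uniq // inE mem_fibre // => /andP[n /eqP]; apply: gt1.
have S2 : (2 * size (rem x1 s) <= T)%N.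
  rewrite -sum1_size big_distrr /= big_seq [leqRHS]big_seq.
  by apply: leq_sum => x /gt1s.
have r0 := ram_gt0 x1 sg1.
split; first by lia.
move=> e; split; first by lia.
move=> x xx1 xc; apply/esym; apply: (@sum_le_eq _ (rem x1 s) (fun _ => 2%N)) => //.
  rewrite -/T; apply: (@leq_trans (2 * size (rem x1 s))%N); first by lia.
  by rewrite -sum1_size big_distrr.
by rewrite mem_rem_uniq ?rts_uniq // inE xx1 mem_fibre // xc eqxx.
Qed.

Lemma dif_fibre_ge c :
  (m <= \sum_(x <- rts (g - c%:P)) dif g x + size (rts (g - c%:P)))%N.
Proof.
rewrite -(ram_sum_g B c) -sum1_size -big_split /=; apply: leq_sum => x _.
by have := dif_ge x dg; lia.
Qed.

Lemma fibres_uniq c c' : c != c' -> uniq (rts (g - c%:P) ++ rts (g - c'%:P)).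
Proof.
move=> cc'; rewrite cat_uniq !rts_uniq andbT /=; apply/hasPn => x.
by rewrite !mem_fibre // => /eqP ->; rewrite eq_sym.
Qed.

Lemma nice_ram2 y : nice h gs hs y -> (ram gs y)%:R != 0 :> K -> (1 < ram gs y)%N.
Proof. by move=> [pos _] /dif_tame e; move: pos; rewrite e; lia. Qed.

(** By [half_count] each of the two fibres of [g] has at most [(m + 1) / 2] points and so
    contributes at least [(m - 1) / 2] to the different of [g], which totals at most [m - 1].
    Equality fixes all indices and leaves [g] unramified elsewhere. *)
Lemma tame_two y y' : nice h gs hs y -> (ram gs y)%:R != 0 :> K ->
  nice h gs hs y' -> (ram gs y')%:R != 0 :> K -> gs.[y] != gs.[y'] ->
  tame_data l m g h gs hs.
Proof.
move=> ny ty ny' ty' cc'.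
set c := gs.[y] in cc' *; set c' := gs.[y'] in cc' *.
have [x1 x1c e1] := nice_tame_exc ny ty; have [x1' x1c' e1'] := nice_tame_exc ny' ty'.
have b2 := nice_ram2 ny ty; have b2' := nice_ram2 ny' ty'.
have gt1 x : x != x1 -> g.[x] = c -> (1 < ram g x)%N.
  move=> xx1 xc; apply: leq_trans b2 _; apply: dvdn_leq; last exact: e1.
  exact: ram_gt0.
have gt1' x : x != x1' -> g.[x] = c' -> (1 < ram g x)%N.
  move=> xx1 xc; apply: leq_trans b2' _; apply: dvdn_leq; last exact: e1'.
  exact: ram_gt0.
have [h1 h2] := half_count x1c gt1; have [h1' h2'] := half_count x1c' gt1'.
have D1 := dif_fibre_ge c; have D1' := dif_fibre_ge c'.
have DD := sum_dif_le B (fibres_uniq cc'); rewrite big_cat /= in DD.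
have m1 := bidec_m B.
move: h1 h2 h1' h2' D1 D1' DD; rewrite -/c -/c'.
set s := size _; set s' := size (rts (g - c'%:P)).
set d := (\sum_(_ <- _) _)%N; set d' := (\sum_(_ <- rts (g - c'%:P)) _)%N.
move=> h1 h2 h1' h2' D1 D1' DD.
have [r1 r2] := h2 ltac:(lia); have [r1' r2'] := h2' ltac:(lia).
have dE : (2 * d = m.-1)%N by lia.
have dE' : (2 * d' = m.-1)%N by lia.
have s2 : (1 < s)%N by lia.
have s2' : (1 < s')%N by lia.
have other z zc : (1 < size (rts (g - zc%:P)))%N -> exists2 x, x != z & g.[x] = zc.
  move=> sz; have [/hasP[x xr xz]|/hasPn none] := boolP (has (predC1 z) (rts (g - zc%:P))).
    by exists x => //; apply/eqP; rewrite -mem_fibre.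
  have /(uniq_leq_size (rts_uniq _)) : {subset rts (g - zc%:P) <= [:: z]}.
    by move=> x /none /=; rewrite negbK inE.
  by rewrite leqNgt sz.
have [x2 x21 x2c] := other x1 c s2.
have [x2' x21' x2c'] := other x1' c' s2'.
have two : 2%:R != 0 :> K.
  by have := e1 _ x21 x2c; rewrite (r2 _ x21 x2c) => /(dvd2_eq b2) <-.
have dm : (d + d' = m.-1)%N by move: dE dE'; clear; lia.
have sg' : size g^`() = m.
  have := @sum_mup_le _ _ predT _ dg (fibres_uniq cc').
  rewrite big_cat count_predT size_zeros // -/d -/d' => le.
  have le2 : (size g^`() <= m)%N := size_deriv_le (bidec_sg B).
  have : (m.-1 <= (size g^`()).-1)%N by rewrite -dm.
  by move: le2 m1; clear; case: (size _) => [|n]; case: (m) => //=; lia.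
have nonc x : g.[x] != c -> g.[x] != c' -> ram g x = 1%N.
  move=> xc xc'; have d0 : dif g x = 0%N.
    have := @sum_dif_le _ _ _ _ _ _ _ B (x :: rts (g - c%:P) ++ rts (g - c'%:P)).
    rewrite cons_uniq (fibres_uniq cc') mem_cat !mem_fibre // negb_or xc xc' => /(_ isT).
    rewrite big_cons big_cat /= -/d -/d' dm.
    by rewrite -[leqRHS]add0n leq_add2r leqn0 => /eqP.
  exact: ram1_dif0.
have ge z : (dif gs z <= tot h hs z)%N.
  have [e|ne] := eqVneq gs.[z] c; first by apply: (tot_ge B (x := x1)); rewrite ?e.
  have [e'|ne'] := eqVneq gs.[z] c'; first by apply: (tot_ge B (x := x1')); rewrite ?e'.
  have [x xe] := fibre_nonempty gs.[z].
  by apply: (tot_ge B xe); rewrite nonc // xe.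
have [sgs' te] := tot_eq_dif B (fun z _ => ge z).
exists c, c', x1, x1'; split=> //.
  by split=> // x [[xc xx1]|[xc xx1]]; [apply: r2 | apply: r2'].
move=> z d0.
have nz : nice h gs hs z by split; rewrite ?te.
have zc : gs.[z] = c \/ gs.[z] = c'.
  have [e|ne] := eqVneq gs.[z] c; first by left.
  have [e'|ne'] := eqVneq gs.[z] c'; first by right.
  have unr x : x \in rts (g - gs.[z]%:P) -> g.[x] = gs.[z] /\ ram g x = 1%N.
    by rewrite mem_fibre // => /eqP xe; rewrite nonc ?xe.
  have := tot_unram B (rts_uniq _) unr.
  have -> : size (rts (g - gs.[z]%:P)) = m.
    rewrite -(ram_sum_g B gs.[z]) -sum1_size big_seq [RHS]big_seq.
    by apply: eq_bigr => x /unr[_ ->].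
  rewrite te => e.
  have : (2 * dif gs z <= dif gs z)%N.
    by rewrite -[leqRHS]e (leq_trans (leq_mul m1 (leqnn _))) // leq_addr.
  by move: d0; clear; lia.
(* A wild [z] would need the whole different [m.-1] of [g] over one value, but each value carries
   half of it. *)
have tz : (ram gs z)%:R != 0 :> K.
  apply/eqP => w; have [_ + _] := wild_nice B nz w.
  by case: zc => ->; rewrite -?/d -?/d'; move: dE dE' m1 s2; clear; lia.
have r2z : ram gs z = 2%N.
  have b2z := nice_ram2 nz tz.
  have main u v uc : g.[u] = uc -> ram g u = 1%N -> v != u -> g.[v] = uc -> ram g v = 2%N ->
     gs.[z] = uc -> ram gs z = 2%N.
    move=> gu ru vu gv rv zu.
    have n1 : ~~ (ram gs z %| ram g u)%N by rewrite ru dvdn1 neq_ltn b2z orbT.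
    have : (ram gs z %| ram g v)%N.
      apply: contraTT vu => n2; rewrite negbK; apply/eqP.
      exact: (nice_tame B nz tz (etrans gv (esym zu)) (etrans gu (esym zu)) n2 n1).
    by rewrite rv; apply: dvd2_eq.
  case: zc; first by apply: (main x1 x2) => //; apply: r2.
  by apply: (main x1' x2') => //; apply: r2'.
by split=> //; rewrite (dif_tame tz) r2z.
Qed.

(** Let [x1] be the possible exception in [nice_tame_exc]. Were its index coprime to [ram gs y],
    then by [ram_mul] the index of [h] at a point over [(x1, y)] would be a multiple of [ram gs y],
    and its different alone would reach [dif gs y]. *)
Lemma nice_lt_gcd y : nice h gs hs y -> (ram gs y)%:R != 0 :> K ->
  (tot h hs y < dif gs y)%N ->
  exists2 A, (1 < A)%N & forall x, g.[x] = gs.[y] -> (A %| ram g x)%N.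
Proof.
move=> ny ty lt; have b2 := nice_ram2 ny ty.
have [x1 x1y e1] := nice_tame_exc ny ty.
exists (gcdn (ram g x1) (ram gs y)); last first.
  move=> x xy; have [->|xx1] := eqVneq x x1; first exact: dvdn_gcdl.
  exact: dvdn_trans (dvdn_gcdr _ _) (e1 _ xx1 xy).
rewrite ltn_neqAle gcdn_gt0 ram_gt0 // andbT eq_sym; apply/negP => co.
have [t tf] := fib_neq0 B x1y; have := tf; rewrite (mem_fib B) => /andP[/eqP ht /eqP hst].
have dv : (ram gs y %| ram h t)%N.
  have := ram_mul B t; rewrite ht hst => e.
  have : (ram gs y %| ram g x1 * ram h t)%N by rewrite e dvdn_mulr.
  by rewrite Gauss_dvdr // coprime_sym.
have le1 : (ram gs y <= ram h t)%N by rewrite dvdn_leq ?ram_gt0.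
have le2 : (dif h t <= tot h hs y)%N.
  by rewrite (totE B) (big_rem t) /= ?leq_addr // mem_fibre // hst.
by move: lt; rewrite (dif_tame ty); have := dif_ge t dh; lia.
Qed.

(** The different of [gs] has degree [l - 1] and lies over [c]. Being tame, it equals [l] minus the
    number of points there, so there is just one. *)
Lemma tot_eq_totram c : (forall y, (0 < dif gs y)%N ->
     [/\ gs.[y] = c, (ram gs y)%:R != 0 :> K & (dif gs y <= tot h hs y)%N]) ->
  totram gs.
Proof.
move=> H; have [sgs' _] := tot_eq_dif B (fun y d0 => let: And3 _ _ e := H y d0 in e).
have l1 := bidec_l B.
have deq y : gs.[y] = c -> (dif gs y + 1 = ram gs y)%N.
  move=> yc; have r0 := ram_gt0 y sgs1; have [d0|d0] := posnP (dif gs y).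
    by have := dif_ge y dgs; lia.
  by have [_ /dif_tame -> _] := H _ d0; lia.
have S1 : (\sum_(y <- rts (gs - c%:P)) dif gs y)%N = l.-1.
  rewrite (@sum_mup _ _ predT) ?rts_uniq // => [|y].
    by rewrite count_predT size_zeros // sgs'.
  rewrite mem_zeros // root_mup // => d0 _; rewrite mem_fibre //.
  by have [-> _ _] := H _ d0.
have S2 := ram_sum_g (bidec_sym B) c.
have sz : size (rts (gs - c%:P)) = 1%N.
  have : (\sum_(y <- rts (gs - c%:P)) dif gs y + size (rts (gs - c%:P)) = l)%N.
    rewrite -[RHS]S2 -sum1_size -big_split /= big_seq [RHS]big_seq.
    by apply: eq_bigr => y; rewrite mem_fibre // => /eqP /deq.
  by rewrite S1; lia.
case e : (rts (gs - c%:P)) sz => [|y [|]] // _.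
have y1 : gs.[y] = c by apply/eqP; rewrite -mem_fibre // e inE.
apply: (totram_one (bidec_sym B) y1) => x /eqP.
by rewrite -mem_fibre // e inE => /eqP.
Qed.

(** For monic [p] this says that [p - c%:P] is a proper power, by [root_extract]. *)
Definition power_data (p : {poly K}) :=
  exists c, exists2 A, (1 < A)%N & forall x, p.[x] = c -> (A %| ram p x)%N.

(** Cases on the nice points: one is wild; two have different values; one has [tot] strictly
    smaller. Otherwise [tot_eq_dif] makes every critical point of [gs] nice, hence tame and over a
    single value. *)
Lemma classify : [\/ totram g \/ totram gs, wild_data l g h gs hs,
  tame_data l m g h gs hs | power_data g].
Proof.
pose ns := [seq y <- rts gs^`() | (tot h hs y <= dif gs y)%N].
have nsP y : y \in ns -> nice h gs hs y.
  by rewrite mem_filter mem_rts // root_mup // => /andP[].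
have nsI y : nice h gs hs y -> y \in ns.
  by case=> a b; rewrite mem_filter b mem_rts // root_mup.
have [/hasP[y yn /eqP w]|/hasPn tame] := boolP (has (fun y => (ram gs y)%:R == 0 :> K) ns).
  by have [tr|] := wild_class B (nsP _ yn) w; [constructor 1; left | constructor 2].
have [y0 /nsI y0n] := nice_exists B.
have [/hasP[y yn yc]|/hasPn same] := boolP (has (fun y => gs.[y] != gs.[y0]) ns).
  by constructor 3; apply: (tame_two (nsP _ yn) (tame _ yn) (nsP _ y0n) (tame _ y0n)).
have [/hasP[y yn lt]|/hasPn ge] := boolP (has (fun y => tot h hs y < dif gs y)%N ns).
  constructor 4; exists gs.[y].
  exact: (nice_lt_gcd (nsP _ yn) (tame _ yn) lt).
constructor 1; right; apply: (@tot_eq_totram gs.[y0]).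
have ge2 y : (0 < dif gs y)%N -> (dif gs y <= tot h hs y)%N.
  move=> d0; rewrite leqNgt; apply/negP => lt.
  by have := ge y (nsI _ (conj d0 (ltnW lt))); rewrite lt.
have [_ te] := tot_eq_dif B ge2.
move=> y d0; have yn : y \in ns by apply: nsI; split; rewrite ?te.
split; rewrite ?ge2 //; last exact: tame.
by have := same _ yn; rewrite negbK => /eqP.
Qed.

End Tame.

(** * Characterisations of Dickson polynomials *)

Section DicksonBasics.
Variable F : fieldType.
Implicit Types (z w a : F) (n : nat).

Lemma dicksonSS n z :
  dickson n.+2 z = 'X * dickson n.+1 z - z%:P * dickson n z :> {poly F}.
Proof. by []. Qed.

Lemma dickson_val n z w : w != 0 ->
  (dickson n z).[w + z / w] = w ^+ n + (z / w) ^+ n.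
Proof.
move=> w0; elim/ltn_ind: n => -[|[|n]] IH.
- by rewrite /= -polyC_natr hornerC !expr0.
- by rewrite /= hornerX !expr1.
rewrite dicksonSS hornerD hornerN !hornerM hornerX hornerC !IH //.
by rewrite !exprS; field.
Qed.

Lemma dickson_lead n z :
  size (dickson n.+1 z : {poly F}) = n.+2 /\ (dickson n.+1 z : {poly F}) \is monic.
Proof.
elim/ltn_ind: n => -[|n] IH; first by rewrite /= size_polyX monicX.
have [s1 m1] := IH n (ltnSn _).
have sX : size ('X * dickson n.+1 z : {poly F}) = n.+3.
  by rewrite mulrC size_mulX ?monic_neq0 // s1.
have s2 : (size (- (z%:P * dickson n z) : {poly F})%R < size ('X * dickson n.+1 z : {poly F})%R)%N.
  rewrite size_polyN sX.
  rewrite (leq_ltn_trans (size_polyMleq _ _)) //.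
  have le : (size (dickson n z : {poly F}) <= n.+1)%N.
    case: n IH {s1 m1 sX} => [|n] IH; last by have [-> _] := IH n (leqnSn _).
    by rewrite /= -polyC_natr size_polyC leq_b1.
  have := leq_b1 (z != 0); rewrite -size_polyC; move: le.
  move: (size (dickson n z)) (size z%:P) => u v; clear; lia.
rewrite dicksonSS size_polyDl //; split=> //.
by rewrite monicE lead_coefDl // lead_coefM lead_coefX mul1r -monicE.
Qed.

End DicksonBasics.

Section Units.
Variable K : closedFieldType.
Implicit Types (z w : K) (p P Q : {poly K}).

(** Stated for every large [M], so that two polynomials can be cleared of denominators by the same
    power. *)
Lemma homog z p : exists N, forall M, (N <= M)%N ->
  exists q, forall w, w != 0 -> q.[w] = w ^+ M * p.[w + z / w].
Proof.
elim/poly_ind: p => [|p c [N IH]].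
  by exists 0%N => M _; exists 0 => w _; rewrite !horner0 mulr0.
exists N.+1 => -[|M] // le; have [q Hq] := IH M le.
exists (q * ('X ^+ 2 + z%:P) + c *: 'X^(M.+1)) => w w0.
rewrite hornerD hornerZ hornerXn !hornerM hornerD hornerC hornerXn Hq //.
by rewrite hornerD hornerM hornerX hornerC !exprS; field.
Qed.

(* [P + w Q], with [w] and [z / w] the roots of [T^2 - x T + z], is a unit of
   [K[w, 1/w]] as soon as its norm [P^2 + x P Q + z Q^2] is constant. *)
Lemma norm_unit z P Q k : z != 0 -> k != 0 ->
  P ^+ 2 + 'X * P * Q + z *: Q ^+ 2 = k%:P ->
  exists (c : K) (i j : nat), c != 0 /\ forall w, w != 0 ->
    w ^+ i * (P.[w + z / w] + w * Q.[w + z / w]) = c * w ^+ j.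
Proof.
move=> z0 k0 nrm; have [N1 H1] := homog z P; have [N2 H2] := homog z Q.
pose N := maxn N1 N2.
have [P' HP] := H1 N (leq_maxl _ _); have [Q' HQ] := H2 N (leq_maxr _ _).
(* At [x = w + z / w] these are [w ^+ N * (P + w Q)] and [w ^+ N.+1 * (P + (z / w) Q)]; their
   product is a power of [w] times the norm. *)
pose A := P' + 'X * Q'; pose C := 'X * P' + z *: Q'.
have AC : A * C = k *: 'X^(2 * N + 1).
  apply/eqP; rewrite -subr_eq0; apply/eqP; apply: (@poly_eq0_cofinite _ [:: 0]) => w.
  rewrite inE => w0; have := congr1 (horner^~ (w + z / w)) nrm.
  rewrite !(hornerD, hornerM, hornerZ, hornerX, hornerC, horner_exp) => e.
  rewrite hornerN hornerZ hornerXn.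
  rewrite HP // HQ // exprD expr1 mulnC exprM -e.
  set u := P.[_]; set v := Q.[_]; set W := w ^+ N.
  by rewrite !expr2; field.
have : A %| ('X - 0%:P) ^+ (2 * N + 1).
  by rewrite subr0 -(dvdpZr _ _ k0) -AC dvdp_mulIl.
case/dvdp_exp_XsubCP => j _; rewrite subr0 => /eqpP[[c1 c2] /= /andP[c10 c20] e].
exists (c2 / c1), N, j; split; first by rewrite mulf_neq0 ?invr_eq0.
move=> w w0; have eA : A = (c2 / c1) *: 'X^j.
  by apply: (scalerI c10); rewrite e scalerA mulrCA divff ?mulr1.
have : A.[w] = c2 / c1 * w ^+ j by rewrite eA hornerZ hornerXn.
move=> <-; rewrite /A hornerD hornerM hornerX HP // HQ //; ring.
Qed.

Lemma joukowski_surj z x : z != 0 -> exists2 w, w != 0 & x = w + z / w.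
Proof.
move=> z0; have /closed_rootP[w] : size ('X ^+ 2 - x *: 'X + z%:P : {poly K}) != 1%N.
  rewrite -addrA size_polyDl size_polyXn //.
  rewrite (leq_ltn_trans (size_polyD _ _)) // gtn_max size_polyN.
  rewrite (leq_ltn_trans (size_scale_leq _ _)) ?size_polyX //.
  by rewrite (leq_ltn_trans (size_polyC_leq1 _)).
rewrite /root !(hornerD, hornerN, hornerZ, hornerX, hornerC, hornerXn) => /eqP e.
have w0 : w != 0.
  apply: contra_neq z0 => w0; move: e.
  by rewrite w0 expr0n mulr0 subr0 /= add0r.
exists w => //; apply: (mulIf w0); rewrite mulrDl divfK //.
by rewrite -[LHS]addr0 -e expr2; ring.
Qed.

(** Since [w * (z / w) = z], the smaller of the exponents [i], [j] cancels up to a constant, and the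
    right-hand side becomes a multiple of [dickson k z] with [k] their difference. Size and leading
    coefficient do the rest. *)
Lemma dickson_of_sum z (H : {poly K}) (c d : K) (i j n : nat) : z != 0 -> c != 0 ->
  size H = n.+2 -> H \is monic ->
  d != 0 -> (forall w, w != 0 ->
    d * w ^+ i * (z / w) ^+ i * H.[w + z / w] =
      c * (w ^+ j * (z / w) ^+ i + (z / w) ^+ j * w ^+ i)) ->
  H = dickson n.+1 z.
Proof.
move=> z0 c0 sH Hm d0 e.
wlog ij : i j d c d0 c0 e / exists k : nat, (i = 0%N /\ j = k).
  move=> wl; have [le|lt] := leqP i j.
    apply: (wl 0%N (j - i)%N d c d0 c0); last by exists (j - i)%N.
    move=> w w0; have u0 : w ^+ i * (z / w) ^+ i != 0.
      by rewrite mulf_neq0 ?expf_neq0 // mulf_neq0 ?invr_eq0.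
    apply: (mulfI u0); have := e w w0; rewrite -(subnK le) !exprD addnK.
    by set u := w ^+ i; set v := (z / w) ^+ i => e'; rewrite !expr0; ring: e'.
  apply: (wl 0%N (i - j)%N (d * z ^+ (i - j)) c _ c0); last by exists (i - j)%N.
    by rewrite mulf_neq0 // expf_neq0.
  move=> w w0; have u0 : w ^+ j * (z / w) ^+ j != 0.
    by rewrite mulf_neq0 ?expf_neq0 // mulf_neq0 ?invr_eq0.
  apply: (mulfI u0); have := e w w0; rewrite -(subnK (ltnW lt)) !exprD addnK.
  have -> : z ^+ (i - j) = w ^+ (i - j) * (z / w) ^+ (i - j).
    by rewrite -exprMn mulrCA divff ?mulr1.
  by set u := w ^+ j; set v := (z / w) ^+ j => e'; rewrite !expr0; ring: e'.
case: ij => k [i0 jk]; move: e; rewrite {}i0 {}jk => e.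
have eH : d *: H = c *: dickson k z.
  apply: poly_ext => x; have [w w0 ->] := joukowski_surj x z0.
  by have := e _ w0; rewrite !expr0 !mulr1 !hornerZ dickson_val // => ->.
case: k e eH => [|k] e eH.
  have := congr1 (fun p : {poly K} => size p) eH.
  rewrite size_scale // sH size_scale // => /esym/eqP.
  by rewrite /= -polyC_natr size_polyC; case: (_ != 0).
have [sd md] := dickson_lead k z.
have kn : k = n.
  have := congr1 (fun p : {poly K} => size p) eH.
  by rewrite !size_scale // sH sd => -[].
have cd : d = c.
  have := congr1 lead_coef eH; rewrite !lead_coefZ.
  by move/monicP: md => ->; move/monicP: Hm => ->; rewrite !mulr1.
by move: eH; rewrite cd kn; apply: scalerI.
Qed.

Lemma pell_dickson n (H R : {poly K}) (e z : K) : 2%:R != 0 :> K -> z != 0 -> e != 0 ->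
  size H = n.+2 -> H \is monic ->
  H ^+ 2 - (e ^+ 2)%:P = ('X ^+ 2 - (4%:R * z)%:P) * R ^+ 2 ->
  H = dickson n.+1 z.
Proof.
move=> two z0 e0 sH Hm pell.
(* At [x = w + z / w] one has [x ^+ 2 - 4 z = (w - z / w) ^+ 2], and with these arguments [P + w Q]
   is [H + (w - z / w) R]. Exchanging [w] and [z / w] gives the conjugate, and the two add up to
   [2 H]. *)
have [||c [i [j [c0 Hc]]]] := @norm_unit z (H - 'X * R) (2%:R *: R) (e ^+ 2) z0.
- by rewrite expf_neq0.
- have -> : (e ^+ 2)%:P = H ^+ 2 - ('X ^+ 2 - (4%:R * z)%:P) * R ^+ 2.
    by rewrite -pell opprB addrC subrK.
  rewrite -!mul_polyC !polyCM !polyC_natr; ring.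
apply: (@dickson_of_sum z H c 2%:R i j n) => // w w0.
have zw0 : z / w != 0 by rewrite mulf_neq0 ?invr_eq0.
have := Hc _ zw0; have := Hc _ w0.
have -> : z / w + z / (z / w) = w + z / w by rewrite addrC; field; rewrite w0.
rewrite !(hornerD, hornerN, hornerZ, hornerM, hornerX).
set x := w + z / w; set v := z / w; move=> e1 e2.
have -> : c * (w ^+ j * v ^+ i + v ^+ j * w ^+ i) =
  v ^+ i * (c * w ^+ j) + w ^+ i * (c * v ^+ j) by ring.
by rewrite -e1 -e2 -/x /x -/v; ring.
Qed.

(* Completing the square turns the factorisation of (H-c)(H-c') into Pell's
   equation. *)
Lemma two_values_dickson n (H r : {poly K}) (c c' t1 t2 : K) : 2%:R != 0 :> K -> c != c' -> t1 != t2 ->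
  size H = n.+2 -> H \is monic ->
  (H - c%:P) * (H - c'%:P) = ('X - t1%:P) * ('X - t2%:P) * r ^+ 2 ->
  H = dickson n.+1 (((t1 - t2) / 4%:R) ^+ 2) \Po ('X + (- (t1 + t2) / 2%:R)%:P)
      + ((c + c') / 2%:R)%:P.
Proof.
move=> two cc' tt sH Hm eq.
have four : 4%:R != 0 :> K by rewrite (natrM _ 2 2) mulf_neq0.
(* [a] and [d] centre the pairs [t1], [t2] and [c], [c'] at zero; [4 z] is then the square of
   [(t1 - t2) / 2]. *)
set z := _ ^+ 2; set a := - (t1 + t2) / 2%:R; set d := (c + c') / 2%:R.
have z0 : z != 0 by rewrite expf_neq0 // mulf_neq0 ?invr_eq0 // subr_eq0.
have sx : size ('X - a%:P : {poly K}) = 2%N by rewrite size_XsubC.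
have sH1 : (1 < size H)%N by rewrite sH.
pose H0 := (H - d%:P) \Po ('X - a%:P).
have sH0 : size H0 = n.+2 by rewrite size_comp_poly2 // size_subC.
have mH0 : H0 \is monic.
  rewrite monicE lead_coef_comp ?sx // lead_coefXsubC expr1n mulr1 -monicE.
  by rewrite monic_subC.
have -> : H = (H0 \Po ('X + a%:P)) + d%:P.
  have XX : ('X - a%:P) \Po ('X + a%:P) = 'X.
    by rewrite comp_polyB comp_polyX comp_polyC addrK.
  by rewrite /H0 -comp_polyA XX comp_polyXr subrK.
congr (_ \Po _ + _).
apply: (@pell_dickson n H0 (r \Po ('X - a%:P)) ((c - c') / 2%:R) z) => //.
  by rewrite mulf_neq0 ?invr_eq0 // subr_eq0.
have -> : 'X ^+ 2 - (4%:R * z)%:P = (('X - t1%:P) * ('X - t2%:P)) \Po ('X - a%:P).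
  rewrite comp_polyM !comp_polyB comp_polyX !comp_polyC.
  have -> : ('X - a%:P - t1%:P) * ('X - a%:P - t2%:P) =
    'X ^+ 2 - ((2%:R * a + t1 + t2) *: 'X) + ((a + t1) * (a + t2))%:P :> {poly K}.
    by rewrite -mul_polyC !(polyC_natr, polyCM, polyCD); ring.
  have -> : 2%:R * a + t1 + t2 = 0 by rewrite /a; field.
  rewrite scale0r subr0 -polyCN; congr (_ + _%:P).
  by rewrite /a /z; field; rewrite two.
have -> : (r \Po ('X - a%:P)) ^+ 2 = r ^+ 2 \Po ('X - a%:P) by rewrite !expr2 comp_polyM.
rewrite -comp_polyM -eq comp_polyM /H0 !comp_polyB !comp_polyC.
set G := H \Po _.
have -> : (((c - c') / 2%:R) ^+ 2)%:P = (d ^+ 2 - c * c')%:P :> {poly K}.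
  by congr _%:P; rewrite /d; field.
have -> : (G - c%:P) * (G - c'%:P) = G ^+ 2 - (2%:R * d)%:P * G + (c * c')%:P.
  have -> : 2%:R * d = c + c' by rewrite /d; field.
  by rewrite polyCD polyCM; ring.
by rewrite !(polyC_natr, polyCB, polyCM, polyC_exp); ring.
Qed.

End Units.

(** * Dickson polynomials in characteristic two *)

Section CharTwo.
Variable K : closedFieldType.
Hypothesis two0 : 2%:R = 0 :> K.
Implicit Types (x y : K) (p : {poly K}).

Lemma addxx2 x : x + x = 0.
Proof. by rewrite -mulr2n -mulr_natr two0 mulr0. Qed.

Lemma oppr2 x : - x = x.
Proof. by apply/eqP; rewrite -subr_eq0 -opprD addxx2 oppr0. Qed.

Lemma addpp2 p : p + p = 0.
Proof. by rewrite -mulr2n -mulr_natr -polyC_natr two0 mulr0. Qed.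

Lemma oppp2 p : - p = p.
Proof. by apply/eqP; rewrite -subr_eq0 -opprD addpp2 oppr0. Qed.

Lemma sqrDx x y : (x + y) ^+ 2 = x ^+ 2 + y ^+ 2.
Proof. by rewrite sqrrD mulr2n addxx2 addr0. Qed.

Lemma sqrDp p q : (p + q) ^+ 2 = p ^+ 2 + q ^+ 2.
Proof. by rewrite sqrrD mulr2n addpp2 addr0. Qed.

Lemma sqrt_ex x : exists y, y ^+ 2 = x.
Proof.
have /closed_rootP[y] : size ('X^2 - x%:P : {poly K}) != 1%N by rewrite size_XnsubC.
by rewrite /root !(hornerD, hornerN, hornerXn, hornerC) subr_eq0 => /eqP; exists y.
Qed.

Lemma sqr_decomp p : exists o e : {poly K}, p = o ^+ 2 + 'X * e ^+ 2.
Proof.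
elim/poly_ind: p => [|p c [o [e ->]]].
  by exists 0, 0; rewrite !expr2 !mulr0 addr0.
have [s <-] := sqrt_ex c; exists ('X * e + s%:P), o.
by rewrite sqrDp -polyC_exp; ring.
Qed.

(** The summands have even and odd degree, so the larger degree survives; the degree of ['X * e * o]
    exceeds their mean by one half and hence is at most the larger. *)
Lemma size_sqr_decomp o e n : size (o ^+ 2 + 'X * e ^+ 2 : {poly K}) = n.+1 ->
  (size ('X * e * o : {poly K})%R <= n.+1)%N.
Proof.
have [->|o0] := eqVneq o 0; first by rewrite mulr0 size_poly0.
have [->|e0] := eqVneq e 0; first by rewrite mulr0 mul0r size_poly0.
have so := size_exp o 2; have se := size_exp e 2.
have so0 : (0 < size o)%N by rewrite size_poly_gt0.
have se0 : (0 < size e)%N by rewrite size_poly_gt0.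
have so2 : (0 < size (o ^+ 2)%R)%N by rewrite size_poly_gt0 expf_neq0.
have se2 : (0 < size (e ^+ 2)%R)%N by rewrite size_poly_gt0 expf_neq0.
have sX : size ('X * e ^+ 2) = (size (e ^+ 2)%R).+1.
  by rewrite mulrC size_mulX ?expf_neq0.
have sXeo : size ('X * e * o) = (size e + size o)%N.
  by rewrite size_mul ?mulf_neq0 ?polyX_eq0 // [in LHS]mulrC size_mulX.
have szD : size (o ^+ 2 + 'X * e ^+ 2) =
    maxn (size (o ^+ 2)%R) (size ('X * e ^+ 2)%R).
  have ne : size (o ^+ 2) != size ('X * e ^+ 2).
    apply/eqP; rewrite sX => es; have : odd (size (o ^+ 2)%R) = odd (size (e ^+ 2)%R).+1.
      by rewrite es.
    rewrite -(prednK so2) -(prednK se2) so se /= !oddM !andbF //.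
  case: (ltngtP (size (o ^+ 2)%R) (size ('X * e ^+ 2)%R)) ne => // lt _.
    by rewrite addrC size_polyDl.
  by rewrite size_polyDl.
rewrite szD sXeo sX => e1.
move: so se so0 se0 so2 se2 e1; clear.
move: (size o) (size e) (size (o ^+ 2)%R) (size (e ^+ 2)%R) => a b c d; lia.
Qed.

Lemma deriv_sqr_decomp o e : (o ^+ 2 + 'X * e ^+ 2 : {poly K})^`() = e ^+ 2.
Proof.
have sq p : (p ^+ 2)^`() = 0.
  by rewrite expr2 derivM mulrC addpp2.
by rewrite derivD derivM derivX !sq mulr0 add0r addr0 mul1r.
Qed.

Lemma horner_norm (P Q : {poly K}) z v :
  (P ^+ 2 + 'X * P * Q + z *: Q ^+ 2).[v] =
  P.[v] ^+ 2 + v * P.[v] * Q.[v] + z * Q.[v] ^+ 2.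
Proof. by rewrite !expr2 !(hornerD, hornerZ, hornerM, hornerX). Qed.

(* Write [rho = o^2 + X e^2]: then [X e o + kap] vanishes at the zeros of [rho], so
   it is [lam rho], a quadratic norm equation for [o] and [e] in the variable
   [sqrt X]. *)
Lemma char2_dickson d (rho : {poly K}) kap :
  rho \is monic -> size rho = d.+1 -> rho.[0] != 0 -> kap != 0 ->
  (forall t, root rho t -> t ^+ 3 * rho^`().[t] ^+ 2 = kap ^+ 2) ->
  'X * rho ^+ 2 = dickson (2 * d).+1 ((kap / rho.[0]) ^+ 4).
Proof.
move=> rm sr r0 k0 Hr; set lam := kap / rho.[0].
have lam0 : lam != 0 by rewrite mulf_neq0 ?invr_eq0.
have [o [e Dr]] := sqr_decomp rho.
have rhox x : rho.[x] = o.[x] ^+ 2 + x * e.[x] ^+ 2.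
  by rewrite Dr hornerD !horner_exp [('X * _).[_]]hornerM hornerX horner_exp.
have de : rho^`() = e ^+ 2 by rewrite Dr deriv_sqr_decomp.
have root_eq t : root rho t -> t * e.[t] * o.[t] = kap /\ rho^`().[t] != 0.
  move=> rt; have := Hr _ rt; rewrite de horner_exp => e1.
  have o2 : o.[t] ^+ 2 = t * e.[t] ^+ 2.
    move/eqP: rt; rewrite rhox => /eqP.
    by rewrite addr_eq0 oppr2 => /eqP.
  split; last first.
    by apply: contra_neq k0 => e0; move: e1; rewrite e0 expr0n mulr0 => /eqP; rewrite eq_sym expf_eq0 /= => /eqP.
  have : (t * e.[t] * o.[t] + kap) ^+ 2 = 0.
    rewrite sqrDx -e1 !exprMn o2.
    have -> : t ^+ 2 * e.[t] ^+ 2 * (t * e.[t] ^+ 2) = t ^+ 3 * (e.[t] ^+ 2) ^+ 2 by ring.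
    by rewrite addxx2.
  by move/eqP; rewrite expf_eq0 /= addr_eq0 oppr2 => /eqP.
have M0 : 'X * e * o + kap%:P != 0.
  apply: contra_neq k0 => /(congr1 (horner^~ 0)).
  by rewrite /= !(hornerD, hornerM, hornerX, hornerC, horner0, mul0r, add0r).
have /dvdpP[q Mq] : rho %| 'X * e * o + kap%:P.
  apply: mup_le_dvdp => //; first exact: monic_neq0.
  move=> t; have [rt|nrt] := boolP (root rho t); last by rewrite mupNroot.
  have [e1 nd] := root_eq _ rt.
  have rM : root ('X * e * o + kap%:P) t.
    by rewrite /root !(hornerD, hornerM, hornerX, hornerC) e1 addxx2.
  have : (0 < mup t ('X * e * o + kap%:P))%N by rewrite -root_mup.
  apply: leq_trans; rewrite leqNgt; apply/negP => m2.
  move: nd; have [|] := eqVneq (rho^`()) 0 => [->|dr0]; first by rewrite horner0 eqxx.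
  move/negP; apply; rewrite -/(root _ _) root_mup //.
  by apply: leq_trans (mup_deriv_ge t dr0); case: (mup t rho) m2 => [|[]].
have q0 : q != 0 by apply: contra_neq M0; rewrite Mq => ->; rewrite mul0r.
have sq : (size q <= 1)%N.
  have : (size (q * rho)%R <= d.+1)%N.
    rewrite -Mq (leq_trans (size_polyD _ _)) // geq_max size_sqr_decomp ?size_polyC -?Dr //.
    by rewrite (leq_trans (leq_b1 _)).
  by rewrite size_Mmonic // sr addnS /=; clear; slia.
have [c Dq] : exists c, q = c%:P by exists q`_0; apply: size1_polyC.
have cl : c = lam.
  have := congr1 (horner^~ 0) Mq.
  rewrite /= Dq !(hornerD, hornerM, hornerX, hornerC, mul0r, add0r) /lam => ->.
  by rewrite mulfK.
have eqx x : lam * rho.[x] = x * e.[x] * o.[x] + kap.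
  have := congr1 (horner^~ x) Mq.
  by rewrite /= Dq cl !(hornerD, hornerM, hornerX, hornerC) => ->.
(* Substituting [x = (lam v) ^+ 2] turns [lam rho = x e o + kap] into
   [P ^+ 2 + v P Q + Q ^+ 2 = kap / lam], the norm equation with [z = 1]. *)
pose S := (lam ^+ 2) *: 'X^2 : {poly K}.
pose P := o \Po S; pose Q := (lam *: 'X) * (e \Po S).
have Sv v : S.[v] = (lam * v) ^+ 2 by rewrite /S hornerZ horner_exp hornerX -exprMn.
have Pv v : P.[v] = o.[(lam * v) ^+ 2] by rewrite /P horner_comp Sv.
have Qv v : Q.[v] = lam * v * e.[(lam * v) ^+ 2].
  by rewrite /Q hornerM horner_comp Sv hornerZ hornerX.
have nrm : P ^+ 2 + 'X * P * Q + 1 *: Q ^+ 2 = (kap / lam)%:P.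
  apply: poly_ext => v.
  rewrite horner_norm hornerC mul1r Pv Qv.
  apply: (mulfI lam0); rewrite [RHS]mulrCA divff // mulr1.
  have := eqx ((lam * v) ^+ 2); rewrite rhox.
  set y := (lam * v) ^+ 2; set a := o.[y]; set b := e.[y] => e1.
  have -> : lam * (a ^+ 2 + v * a * (lam * v * b) + (lam * v * b) ^+ 2) =
     lam * (a ^+ 2 + y * b ^+ 2) + y * b * a by rewrite /y; ring.
  by rewrite e1 addrAC addxx2 add0r.
have k1 : kap / lam != 0 by rewrite mulf_neq0 ?invr_eq0.
have [c0 [i [j [c00 Hc]]]] := norm_unit (oner_neq0 K) k1 nrm.
have z0 : lam ^+ 4 != 0 by rewrite expf_neq0.
apply: (@dickson_of_sum _ _ _ (lam ^+ (2 * i + 1 + 2 * i + 1 + 2) * c0 ^+ 4)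
   (lam ^+ (4 * j)) (2 * i + 1) (2 * j)) => //.
- by rewrite mulf_neq0 ?expf_neq0.
- rewrite mulrC size_mulX ?expf_neq0 ?monic_neq0 //.
  have := size_exp rho 2; rewrite sr /= mulnC => <-.
  by rewrite prednK // size_poly_gt0 expf_neq0 // monic_neq0.
- by rewrite monicMl ?monicX ?monic_exp.
- by rewrite expf_neq0.
(* The two parametrisations match through [u = lam ^+ 2 * w ^+ 2] and [v = w + 1 / w]: then
   [u + lam ^+ 4 / u = (lam v) ^+ 2]. *)
move=> u u0; have [w Dw] := sqrt_ex (u / lam ^+ 2).
have w0 : w != 0.
  apply: contra_neq u0 => w0; move: Dw; rewrite w0 expr0n /= => /esym/eqP.
  by rewrite mulf_eq0 invr_eq0 expf_eq0 /= (negPf lam0) orbF => /eqP.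
have Du : u = lam ^+ 2 * w ^+ 2 by rewrite Dw mulrC divfK // expf_neq0.
pose wi := w^-1; have wi0 : wi != 0 by rewrite invr_eq0.
have wwi : w * wi = 1 by rewrite divff.
have Dz : lam ^+ 4 / u = lam ^+ 2 * wi ^+ 2.
  by rewrite Du /wi; field; rewrite w0.
pose v := w + wi.
have xv : u + lam ^+ 4 / u = (lam * v) ^+ 2.
  by rewrite Dz Du -mulrDr -sqrDx -exprMn.
have v1 : w + 1 / w = v by rewrite div1r.
have v2 : wi + 1 / wi = v by rewrite div1r /wi invrK addrC.
have := Hc _ w0; have := Hc _ wi0; rewrite v1 v2 Pv Qv.
have HX y : ('X * rho ^+ 2).[y] = y * rho.[y] ^+ 2.
  by rewrite hornerM hornerX horner_exp.
rewrite xv HX rhox.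
set a := o.[_]; set b := lam * v * _; set V := (lam * v) ^+ 2.
have -> : a ^+ 2 + V * e.[V] ^+ 2 = (a + b) ^+ 2 by rewrite sqrDx /b /V; ring.
set A' := a + wi * b; set A := a + w * b; move=> eA' eA.
(* [A] and [A'] are the units belonging to [w] and [1 / w]; the square of this identity expresses
   ['X * rho ^+ 2] by their fourth powers. *)
have key : v * (a + b) ^+ 2 = w * A' ^+ 2 + wi * A ^+ 2.
  rewrite /A /A' !sqrDx /v.
  have -> : w * (a ^+ 2 + (wi * b) ^+ 2) + wi * (a ^+ 2 + (w * b) ^+ 2) =
    (w + wi) * a ^+ 2 + (w * wi) * (w + wi) * b ^+ 2 by ring.
  by rewrite wwi mul1r mulrDr.
have -> : V * (a + b) ^+ 2 ^+ 2 = lam ^+ 2 * (w ^+ 2 * A' ^+ 4 + wi ^+ 2 * A ^+ 4).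
  have -> : V * (a + b) ^+ 2 ^+ 2 = lam ^+ 2 * (v * (a + b) ^+ 2) ^+ 2 by rewrite /V; ring.
  by rewrite key sqrDx; ring.
have eA4 : w ^+ (4 * i) * A ^+ 4 = c0 ^+ 4 * w ^+ (4 * j).
  by rewrite ![(4 * _)%N]mulnC !exprM -!exprMn eA.
have eA4' : wi ^+ (4 * i) * A' ^+ 4 = c0 ^+ 4 * wi ^+ (4 * j).
  by rewrite ![(4 * _)%N]mulnC !exprM -!exprMn eA'.
rewrite Dz Du.
have ex x n : (lam ^+ 2 * x ^+ 2) ^+ n = lam ^+ (2 * n) * x ^+ (2 * n).
  by rewrite exprMn -!exprM.
rewrite !ex.
have -> : (2 * (2 * i + 1) = 4 * i + 2)%N by clear; lia.
have -> : (2 * (2 * j) = 4 * j)%N by clear; lia.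
have -> : (2 * i + 1 + 2 * i + 1 + 2 = 4 * i + 4)%N by clear; lia.
rewrite !(exprD _ (4 * i)).
transitivity (lam ^+ (4 * j) * lam ^+ (4 * i) * lam ^+ (4 * i) * lam ^+ 6 *
   (w * wi) ^+ 2 * (w ^+ 2 * w ^+ (4 * i) * (wi ^+ (4 * i) * A' ^+ 4) +
      wi ^+ 2 * wi ^+ (4 * i) * (w ^+ (4 * i) * A ^+ 4))); first by ring.
by rewrite eA4 eA4' wwi; ring.
Qed.

End CharTwo.

(** * From ramification patterns to Dickson polynomials *)

Definition dickson_pair (F : fieldType) l m (h hs : {poly F}) :=
  exists z a b b' : F, [/\ z != 0, l%:R != 0 :> F, m%:R != 0 :> F,
    h = dickson l z \Po ('X + a%:P) + b%:P &
    hs = dickson m z \Po ('X + a%:P) + b'%:P].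

Lemma size_deriv_natr (F : fieldType) n (p : {poly F}) : p \is monic ->
  size p = n.+1 -> size p^`() = n -> (0 < n)%N -> n%:R != 0 :> F.
Proof.
move=> pm sp sd n0; have : lead_coef p^`() != 0.
  by rewrite lead_coef_eq0 -size_poly_gt0 sd.
rewrite lead_coefE sd coef_deriv prednK //.
by move/monicP: pm; rewrite lead_coefE sp /= => ->.
Qed.

Lemma simple_root (F : fieldType) t (p : {poly F}) : mup t p = 1%N -> p^`().[t] != 0.
Proof.
move=> m1; have p0 : p != 0 by apply: contra_eq_neq m1 => ->; rewrite mup0.
have [q qt [_ ->]] := deriv_mup t p0; rewrite m1 /= mulr0n addr0 !mulr1n expr0 mul1r.
by rewrite hornerD hornerM hornerXsubC subrr mul0r addr0.
Qed.

Section TwoValues.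
Variable K : closedFieldType.
Implicit Types (p q : {poly K}) (t c : K).

Lemma mup_two p c c' t : (1 < size p)%N -> c != c' ->
  mup t ((p - c%:P) * (p - c'%:P)) =
    if (p.[t] == c) || (p.[t] == c') then ram p t else 0%N.
Proof.
move=> sp cc'; rewrite mupM ?subC_neq0 //.
have nr d : p.[t] != d -> mup t (p - d%:P) = 0%N.
  by move=> ne; rewrite mupNroot // /root !hornerE subr_eq0.
have [e|ne] := eqVneq p.[t] c.
  by rewrite (mup_eq_ram e) nr ?e // addn0.
have [e'|ne'] := eqVneq p.[t] c'; last by rewrite !nr.
by rewrite (mup_eq_ram e') nr // add0n.
Qed.

Lemma monic_two p c c' : (1 < size p)%N -> p \is monic ->
  (p - c%:P) * (p - c'%:P) \is monic.
Proof. by move=> sp pm; rewrite monicMl monic_subC. Qed.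

Lemma odd_mup_sqr A q t : A != 0 -> q != 0 -> odd (mup t (A * q ^+ 2)) = odd (mup t A).
Proof. by move=> A0 q0; rewrite mupM ?expf_neq0 // mup_exp // oddD oddM addbF. Qed.

Lemma odd_part (G : {poly K}) t1 t2 : G \is monic -> t1 != t2 ->
  (forall t, odd (mup t G) = (t == t1) || (t == t2)) ->
  exists2 q, q \is monic & G = ('X - t1%:P) * ('X - t2%:P) * q ^+ 2.
Proof.
move=> Gm tt oG; have G0 := monic_neq0 Gm.
have odd_pos t : odd (mup t G) -> (0 < mup t G)%N by case: (mup t G).
have r1 : root G t1 by rewrite root_mup // odd_pos // oG eqxx.
have /factor_theorem[G1 D1] := r1.
have G1m : G1 \is monic by move: Gm; rewrite D1 monicMr // monicXsubC.
have m1 t : mup t G = (mup t G1 + (t == t1))%N.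
  by rewrite D1 mupM ?polyXsubC_eq0 ?monic_neq0 // (@mup_XsubCX _ 1) eq_sym; case: eqP.
have r2 : root G1 t2.
  rewrite root_mup ?monic_neq0 //; have := oG t2; have := m1 t2.
  by rewrite eqxx orbT eq_sym (negPf tt) addn0 => <- /odd_pos.
have /factor_theorem[G2 D2] := r2.
have G2m : G2 \is monic by move: G1m; rewrite D2 monicMr // monicXsubC.
have m2 t : mup t G1 = (mup t G2 + (t == t2))%N.
  by rewrite D2 mupM ?polyXsubC_eq0 ?monic_neq0 // (@mup_XsubCX _ 1) eq_sym; case: eqP.
have [t|q qm Dq] := root_extract (n := 2) G2m.
  rewrite dvdn2; have := oG t; rewrite m1 m2 !oddD.
  have [->|n1] := eqVneq t t1; first by rewrite (negPf tt); case: odd.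
  by have [->|n2] := eqVneq t t2; case: odd.
by exists q; rewrite // D1 D2 Dq; ring.
Qed.

(** The square of the normalised derivative [r] divides the product, with quotient of degree
    [2 (n + 1) - 2 n = 2]. A double zero of the quotient would be a point of index two that is not
    critical, or a critical point of index at least four. *)
Lemma two_values_poly n p c c' : p \is monic -> size p = n.+2 -> size p^`() = n.+1 ->
  c != c' ->
  (forall t, (0 < dif p t)%N -> [/\ p.[t] = c \/ p.[t] = c', ram p t = 2%N & dif p t = 1%N]) ->
  exists t1 t2 r, [/\ t1 != t2, r != 0 &
    (p - c%:P) * (p - c'%:P) = ('X - t1%:P) * ('X - t2%:P) * r ^+ 2].
Proof.
move=> pm sp sd cc' crit; have sp1 : (1 < size p)%N by rewrite sp.
have n0 : n.+1%:R != 0 :> K by apply: size_deriv_natr sd _.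
have dp0 : p^`() != 0 by rewrite -size_poly_gt0 sd.
pose r := n.+1%:R^-1 *: p^`(); have r0 : r != 0 by rewrite scaler_eq0 invr_eq0 negb_or n0.
have mr t : mup t r = dif p t by rewrite mupZ // invr_eq0.
set G := _ * _; have Gm : G \is monic by rewrite monic_two.
have Gt t : mup t G = if (p.[t] == c) || (p.[t] == c') then ram p t else 0%N by exact: mup_two.
have Gpos t : (0 < dif p t)%N -> mup t G = 2%N.
  by move=> /crit[e r2 _]; rewrite Gt r2; case: e => ->; rewrite eqxx ?orbT.
have /dvdpP[q Dq] : r ^+ 2 %| G.
  apply: mup_le_dvdp => [||t]; [exact: expf_neq0 | exact: monic_neq0 |].
  rewrite mup_exp // mr; have [->|d0] := posnP (dif p t); first by rewrite muln0.
  by rewrite Gpos //; have [_ _ ->] := crit _ d0.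
have rm : r \is monic.
  rewrite monicE lead_coefZ lead_coefE sd coef_deriv /=.
  by move/monicP: pm; rewrite lead_coefE sp /= => ->; rewrite mulVf.
have rm2 : r ^+ 2 \is monic := monic_exp 2 rm.
have qm : q \is monic by move: Gm; rewrite Dq (monicMr _ rm2).
have sq : size q = 3%N.
  have := congr1 (fun u : {poly K} => size u) Dq.
  rewrite /G /= size_Mmonic ?monic_subC ?subC_neq0 // !size_subC // sp.
  rewrite size_Mmonic ?monic_exp ?monic_neq0 //.
  have := size_exp r 2; rewrite size_scale ?invr_eq0 // sd /=.
  have : (0 < size (r ^+ 2)%R)%N by rewrite size_poly_gt0 expf_neq0.
  by clear; slia.
have := zeros_monic qm; have := size_zeros (monic_neq0 qm); rewrite sq.
case: (zeros q) => [|t1 [|t2 [|]]] // _; rewrite big_cons big_seq1 => Dq'.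
exists t1, t2, r; split=> //; last by rewrite Dq Dq'.
apply/negP => /eqP tt; have m2 : mup t1 q = 2%N.
  by rewrite Dq' -tt -expr2 mup_XsubCX eqxx.
have mG : mup t1 G = (2 + 2 * dif p t1)%N.
  by rewrite Dq mupM ?expf_neq0 ?monic_neq0 // mup_exp // mr m2.
have [d0|d0] := posnP (dif p t1); last by have := Gpos _ d0; rewrite mG; lia.
move: mG; rewrite d0 Gt; case: ifP => // _ r2.
by have := dif_ge t1 dp0; rewrite d0 r2.
Qed.

End TwoValues.

Section TameDickson.
Variable K : closedFieldType.
Implicit Types (x y t c : K).
Variables (l m : nat) (g h gs hs : {poly K}).
Hypothesis B : bidec l m g h gs hs.

Let sg1 : (1 < size g)%N := bidec_sg1 B.
Let shs1 : (1 < size hs)%N := bidec_shs1 B.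
Let sgs1 : (1 < size gs)%N := bidec_sgs1 B.
Let sh1 : (1 < size h)%N := bidec_sh1 B.

Lemma size_dh : size gs^`() = l -> size h^`() = l.
Proof.
move=> e; have := size_balance B; rewrite e subnn muln0 => /eqP.
have : (size h^`() <= l)%N := size_deriv_le (bidec_sh B).
by move: (size h^`()) => k; clear; lia.
Qed.

(** By [tot_unram_branch] the critical points of [h] lie over [x1] and [x1']. For [hs] the critical
    points are not located; instead [(f - c) (f - c')], with [f] the composite, is computed modulo
    squares through both decompositions, so the product for [hs] has odd multiplicity exactly at the
    same [t1], [t2]. Hence [z] and [a] are common. *)
Lemma tame_dickson : tame_data l m g h gs hs -> dickson_pair l m h hs.
Proof.
case=> c [c' [x1 [x1' [[two cc'] [[x1c r1 x1c' r1'] r2] crit sg' [sgs' te]]]]].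
have l1 := bidec_l B; have m1 := bidec_m B.
have [n ln] : exists n, l = n.+1 by case: l l1 => // n _; exists n.
have [n' mn] : exists n, m = n.+1 by case: m m1 => // n' _; exists n'.
have ml : m%:R != 0 :> K by apply: size_deriv_natr sg' (ltnW m1); rewrite ?(bidec_gm B) ?(bidec_sg B).
have ll : l%:R != 0 :> K by apply: size_deriv_natr sgs' (ltnW l1); rewrite ?(bidec_gsm B) ?(bidec_sgs B).
have xx : x1 != x1' by apply: contra_neq cc' => e; rewrite -x1c -x1c' e.
have crith t : (0 < dif h t)%N ->
    [/\ h.[t] = x1 \/ h.[t] = x1', ram h t = 2%N & dif h t = 1%N].
  move=> d0; have dy : (0 < dif gs hs.[t])%N.
    rewrite -te (totE B) (big_rem t) /= ?(leq_trans d0) ?leq_addr //.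
    by rewrite mem_fibre.
  have [[yc|yc] ry dy1] := crit _ dy.
    have [a1 a2 a3] := tot_unram_branch B te (etrans x1c (esym yc)) r1 d0.
    by rewrite a1 a2 a3; split=> //; left.
  have [a1 a2 a3] := tot_unram_branch B te (etrans x1c' (esym yc)) r1' d0.
  by rewrite a1 a2 a3; split=> //; right.
have [t1 [t2 [r [tt r0 Dh]]]] : exists t1 t2 r, [/\ t1 != t2, r != 0 &
    (h - x1%:P) * (h - x1'%:P) = ('X - t1%:P) * ('X - t2%:P) * r ^+ 2].
  apply: (@two_values_poly _ n h) crith => //; rewrite ?(bidec_hm B) ?(bidec_sh B) ?ln //.
  by rewrite size_dh -?ln.
have [y1 [y2 [rs [yy rs0 Dgs]]]] : exists t1 t2 r, [/\ t1 != t2, r != 0 &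
    (gs - c%:P) * (gs - c'%:P) = ('X - t1%:P) * ('X - t2%:P) * r ^+ 2].
  by apply: (@two_values_poly _ n gs) crit => //; rewrite ?(bidec_gsm B) ?(bidec_sgs B) -?ln.
have gm := bidec_gm B; have hsm := bidec_hsm B; have hm := bidec_hm B.
have [q qm Dg] : exists2 q, q \is monic &
    (g - c%:P) * (g - c'%:P) = ('X - x1%:P) * ('X - x1'%:P) * q ^+ 2.
  apply: odd_part => //; first exact: monic_two.
  move=> x; rewrite mup_two //.
  have [->|n1] := eqVneq x x1; first by rewrite x1c eqxx r1.
  have [->|n1'] := eqVneq x x1'; first by rewrite x1c' eqxx orbT r1'.
  have [e|_] := eqVneq g.[x] c; first by rewrite r2 //; left.
  by have [e|_] := eqVneq g.[x] c'; first by rewrite r2 //; right.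
have XX u v : ('X - u%:P) * ('X - v%:P) != 0 :> {poly K}.
  by rewrite mulf_neq0 ?polyXsubC_eq0.
have two_comp (p A : {poly K}) u v R : (p - c%:P) * (p - c'%:P) = ('X - u%:P) * ('X - v%:P) * R ^+ 2 ->
   ((p \Po A) - c%:P) * ((p \Po A) - c'%:P) = (A - u%:P) * (A - v%:P) * (R \Po A) ^+ 2.
  move=> e; have := congr1 (fun p0 => p0 \Po A) e.
  by rewrite /= !expr2 !comp_polyM !comp_polyB !comp_polyX !comp_polyC.
have [qs qsm Dhs] : exists2 q, q \is monic &
    (hs - y1%:P) * (hs - y2%:P) = ('X - t1%:P) * ('X - t2%:P) * q ^+ 2.
  apply: odd_part => //; first exact: monic_two.
  move=> t; have N1 : (hs - y1%:P) * (hs - y2%:P) != 0 by rewrite mulf_neq0 ?subC_neq0.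
  have N2 : (h - x1%:P) * (h - x1'%:P) != 0 by rewrite mulf_neq0 ?subC_neq0.
  rewrite -(@odd_mup_sqr _ _ (rs \Po hs)) ?comp_poly_eq0 // -(two_comp _ _ _ _ _ Dgs).
  have qh : q \Po h != 0 by rewrite comp_poly_eq0 // monic_neq0.
  rewrite -(bidec_eq B) (two_comp _ _ _ _ _ Dg) odd_mup_sqr //.
  rewrite Dh odd_mup_sqr // mupM ?polyXsubC_eq0 // oddD !(@mup_XsubCX _ 1).
  rewrite ![_ == t]eq_sym.
  have [->|n1] := eqVneq t t1; first by rewrite (negPf tt).
  by case: eqP.
pose z : K := ((t1 - t2) / 4%:R) ^+ 2; pose a : K := - (t1 + t2) / 2%:R.
pose b : K := (x1 + x1') / 2%:R; pose b' : K := (y1 + y2) / 2%:R.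
exists z, a, b, b'.
have four : 4%:R != 0 :> K by rewrite (natrM _ 2 2) mulf_neq0.
split=> //.
- by rewrite expf_neq0 // mulf_neq0 ?invr_eq0 // subr_eq0.
- by rewrite ln; apply: two_values_dickson Dh => //; rewrite (bidec_sh B) ln.
- by rewrite mn; apply: two_values_dickson Dhs => //; rewrite (bidec_shs B) mn.
Qed.

End TameDickson.

Section WildPoly.
Variable K : closedFieldType.
Hypothesis two0 : 2%:R = 0 :> K.
Implicit Types (p q r : {poly K}) (x y t c : K).

Lemma natr_char2 n : n%:R = (odd n)%:R :> K.
Proof. by rewrite -[in LHS](odd_double_half n) natrD -mul2n natrM two0 mul0r addr0. Qed.

Lemma deriv_sqr p : (p ^+ 2)^`() = 0.
Proof. by rewrite expr2 derivM mulrC (addpp2 two0). Qed.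

Lemma deriv_mul_sqr p q : (p * q ^+ 2)^`() = p^`() * q ^+ 2.
Proof. by rewrite derivM deriv_sqr mulr0 addr0. Qed.

Lemma wild_poly n p c : p \is monic -> size p = n.+2 -> size p^`() = n.+1 ->
  (forall t, (0 < dif p t)%N -> [/\ p.[t] = c, ram p t = 2%N & dif p t = 2%N]) ->
  exists t1 r, [/\ r \is monic, p - c%:P = ('X - t1%:P) * r ^+ 2, p^`() = r ^+ 2,
    (forall t, root r t -> mup t r = 1%N) & ~~ root r t1].
Proof.
move=> pm sp sd crit; have sp1 : (1 < size p)%N by rewrite sp.
have n0 : n.+1%:R != 0 :> K by apply: size_deriv_natr sd _.
have dm : p^`() \is monic.
  rewrite monicE lead_coefE sd coef_deriv /=.
  move/monicP: pm; rewrite lead_coefE sp /= => ->.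
  by rewrite natr_char2 in n0 *; case: odd n0; rewrite ?eqxx.
have [t|r rm Dr] := root_extract (n := 2) dm.
  rewrite -/(dif p t); have [->|d0] := posnP (dif p t); first exact: dvdn0.
  by have [_ _ ->] := crit _ d0.
have mr t : root r t -> mup t r = 1%N /\ (0 < dif p t)%N.
  rewrite root_mup ?monic_neq0 // => r0.
  have e : dif p t = (2 * mup t r)%N by rewrite /dif Dr mup_exp ?monic_neq0.
  have d0 : (0 < dif p t)%N by rewrite e muln_gt0.
  by have [_ _ d2] := crit _ d0; split=> //; lia.
have /dvdpP[q Dq] : r ^+ 2 %| p - c%:P.
  apply: mup_le_dvdp => [||t]; rewrite ?expf_neq0 ?monic_neq0 ?monic_subC //.
  have [rt|nrt] := boolP (root r t); last by rewrite mup_exp ?monic_neq0 // mupNroot.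
  have [m1 d0] := mr _ rt; have [pt r2 _] := crit _ d0.
  by rewrite mup_exp ?monic_neq0 // m1 (mup_eq_ram pt) r2.
have r2m : r ^+ 2 \is monic := monic_exp 2 rm.
have pcm : p - c%:P \is monic by rewrite monic_subC.
have qm : q \is monic by move: pcm; rewrite Dq (monicMr _ r2m).
have sq : size q = 2%N.
  have := congr1 (fun u : {poly K} => size u) Dq.
  rewrite /= size_subC // sp size_Mmonic ?monic_neq0 // -Dr sd.
  by clear; slia.
have := zeros_monic qm; have := size_zeros (monic_neq0 qm); rewrite sq.
case: (zeros q) => [|t1 [|]] // _; rewrite big_seq1 => Dq'.
exists t1, r; split=> //; first by rewrite Dq Dq'.
  by move=> t /mr[].
apply/negP => /mr[m1 d0]; have [pt r2 _] := crit _ d0.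
have : mup t1 (p - c%:P) = 3%N.
  by rewrite Dq Dq' mupM ?polyXsubC_eq0 ?monic_neq0 // (@mup_XsubCX _ 1) eqxx mup_exp ?monic_neq0 // m1.
by rewrite (mup_eq_ram pt) r2.
Qed.

(** Differentiating [rho * (q \Po h) = sig * (r \Po hs)] at a zero of [rho] transports the equation
    for [r] to one for [rho], as [char2_dickson] requires. The parameter depends only on [kap] and
    on the value of this common product at [t1], so [h] and [hs] receive the same one. *)
Lemma wild_dickson_half d (h hs rho sig q r : {poly K}) x1 y1 t1 kap :
  rho \is monic -> size rho = d.+1 -> ~~ root rho t1 -> kap != 0 ->
  h - x1%:P = ('X - t1%:P) * rho ^+ 2 ->
  hs - y1%:P = ('X - t1%:P) * sig ^+ 2 ->
  rho * (q \Po h) = sig * (r \Po hs) ->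
  (forall t, root rho t -> ~~ root sig t) ->
  ~~ root q x1 ->
  (forall y, root r y -> (y - y1) ^+ 3 * r^`().[y] ^+ 2 = kap ^+ 2) ->
  h = dickson (2 * d).+1 ((kap / (rho * (q \Po h)).[t1]) ^+ 4) \Po ('X + (- t1)%:P)
      + x1%:P.
Proof.
move=> rm sr rt1 k0 Dh Dhs phi nocommon qx1 Hr.
have ht t : root rho t -> h.[t] = x1.
  move=> rt; have := congr1 (horner^~ t) Dh.
  rewrite /= hornerD hornerN hornerC hornerM horner_exp (rootP rt).
  by rewrite expr0n mulr0 => /eqP; rewrite subr_eq0 => /eqP.
have ht1 : h.[t1] = x1.
  have := congr1 (horner^~ t1) Dh.
  by rewrite /= hornerD hornerN hornerC hornerM hornerXsubC subrr mul0r => /eqP; rewrite subr_eq0 => /eqP.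
have hst t : hs.[t] - y1 = (t - t1) * sig.[t] ^+ 2.
  have := congr1 (horner^~ t) Dhs.
  by rewrite /= hornerD hornerN hornerC hornerM hornerXsubC horner_exp.
have dhs : hs^`() = sig ^+ 2.
  have := congr1 (fun p : {poly K} => p^`()) Dhs.
  by rewrite /= derivB derivC subr0 deriv_mul_sqr derivXsubC mul1r.
pose Z := 'X + t1%:P : {poly K}.
have sZ : size Z = 2%N by rewrite size_XaddC.
pose R := rho \Po Z.
have Rm : R \is monic.
  by rewrite monicE lead_coef_comp ?sZ // /Z -[t1]opprK polyCN lead_coefXsubC expr1n mulr1 -monicE.
have sR : size R = d.+1 by rewrite size_comp_poly2.
have Zv v : Z.[v] = v + t1 by rewrite /Z hornerD hornerX hornerC.
have Rv v : R.[v] = rho.[v + t1] by rewrite horner_comp Zv.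
have R0 : R.[0] != 0 by rewrite Rv add0r.
have kq : kap / q.[x1] != 0 by rewrite mulf_neq0 // invr_eq0.
have key := @char2_dickson K two0 d R (kap / q.[x1]) Rm sR R0 kq.
have -> : kap / (rho * (q \Po h)).[t1] = kap / q.[x1] / R.[0].
  rewrite Rv add0r hornerM horner_comp ht1; field.
  by rewrite qx1; move: rt1; rewrite /root => ->.
rewrite -key => [|v]; last first.
  rewrite /root Rv => rt; have rr : root rho (v + t1) by [].
  have dR : R^`().[v] = rho^`().[v + t1].
    by rewrite deriv_comp /Z derivD derivX derivC addr0 mulr1 horner_comp -/Z Zv.
  rewrite dR; set t := v + t1 in rr rt *; have vt : v = t - t1 by rewrite addrK.
  have sn := nocommon _ rr; have ey := hst t.
  have ry : root r hs.[t].
    have := congr1 (horner^~ t) phi.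
    rewrite /= !hornerM !horner_comp (rootP rr) mul0r => /esym/eqP.
    by rewrite mulf_eq0; move: sn; rewrite /root => /negPf ->.
  have := congr1 (fun p : {poly K} => p^`().[t]) phi.
  rewrite /= !derivM !deriv_comp dhs expr2 !(hornerD, hornerM, horner_comp).
  rewrite (rootP rr) (rootP ry) ht // mul0r mulr0 addr0 add0r => ed.
  have -> : v ^+ 3 * rho^`().[t] ^+ 2 =
     (hs.[t] - y1) ^+ 3 * r^`().[hs.[t]] ^+ 2 / q.[x1] ^+ 2.
    apply: (mulIf (x := q.[x1] ^+ 2)); first by rewrite expf_neq0.
    rewrite divfK ?expf_neq0 // -mulrA -exprMn ed ey vt; ring.
  by rewrite Hr // expr_div_n.
rewrite comp_polyM comp_polyX /R.
have -> : ((rho \Po Z) ^+ 2) \Po ('X + (- t1)%:P) = rho ^+ 2.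
  rewrite expr2 comp_polyM -comp_polyA.
  have -> : Z \Po ('X + (- t1)%:P) = 'X.
    by rewrite /Z comp_polyD comp_polyX comp_polyC -addrA -polyCD addNr addr0.
  by rewrite comp_polyXr expr2.
by rewrite polyCN -Dh subrK.
Qed.

End WildPoly.

Section WildDickson.
Variable K : closedFieldType.
Implicit Types (x y t c : K).
Variables (l m : nat) (g h gs hs : {poly K}).
Hypothesis B : bidec l m g h gs hs.

Let sg1 : (1 < size g)%N := bidec_sg1 B.
Let shs1 : (1 < size hs)%N := bidec_shs1 B.
Let sgs1 : (1 < size gs)%N := bidec_sgs1 B.
Let sh1 : (1 < size h)%N := bidec_sh1 B.

Lemma wild_dickson : wild_data l g h gs hs -> dickson_pair l m h hs.
Proof.
case=> c [x1 [x2 [two0 [x1c r1 x21 x2c] r2 crit [sgs' te]]]].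
have l1 := bidec_l B; have m1 := bidec_m B.
have [n ln] : exists n, l = n.+1 by case: l l1 => // n _; exists n.
have gm : g - c%:P \is monic by rewrite monic_subC // (bidec_gm B).
have hm := bidec_hm B; have hsm := bidec_hsm B; have gsm := bidec_gsm B.
have [y1 [r [rm Dgs dgs rsimple ry1]]] : exists t1 r, [/\ r \is monic,
    gs - c%:P = ('X - t1%:P) * r ^+ 2, gs^`() = r ^+ 2,
    (forall t, root r t -> mup t r = 1%N) & ~~ root r t1].
  by apply: (@wild_poly _ two0 n) => //; rewrite ?(bidec_sgs B) -?ln.
have [t1 [rho [rhom Dh dh rhosimple rt1]]] : exists t1 r, [/\ r \is monic,
    h - x1%:P = ('X - t1%:P) * r ^+ 2, h^`() = r ^+ 2,
    (forall t, root r t -> mup t r = 1%N) & ~~ root r t1].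
  apply: (@wild_poly _ two0 n) => //; rewrite ?(bidec_sh B) ?(size_dh B) -?ln // => t d0.
  have dy : (0 < dif gs hs.[t])%N.
    rewrite -te (totE B) (big_rem t) /= ?(leq_trans d0) ?leq_addr //.
    by rewrite mem_fibre.
  have [yc ry dy2] := crit _ dy.
  by have [a1 a2 a3] := tot_unram_branch B te (etrans x1c (esym yc)) r1 d0; rewrite a1 a2 a3.
have [q [qm Dg qsimple qx1]] : exists q, [/\ q \is monic, g - c%:P = ('X - x1%:P) * q ^+ 2,
    (forall x, root q x -> mup x q = 1%N) & ~~ root q x1].
  have [p pm [Dp mp]] := mup_split x1 gm.
  rewrite (mup_eq_ram x1c) r1 expr1 in Dp.
  have mp2 x : mup x p = 0%N \/ mup x p = 2%N.
    rewrite mp; case: eqP => [_|/eqP xx1]; first by left.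
    have [e|ne] := eqVneq g.[x] c; last by left; rewrite mupNroot // /root !hornerE subr_eq0.
    by right; rewrite (mup_eq_ram e); have [-> _] := r2 _ xx1 e.
  have [x|q qm Dq] := root_extract (n := 2) pm; first by case: (mp2 x) => ->.
  have mq x : (2 * mup x q)%N = mup x p by rewrite Dq mup_exp // monic_neq0.
  exists q; split=> //; first by rewrite -Dq.
    move=> x; rewrite root_mup ?monic_neq0 // => q0.
    by have := mq x; case: (mp2 x) => ->; move: q0; clear; lia.
  rewrite root_mup ?monic_neq0 // -eqn0Ngt; have := mq x1.
  by rewrite mp eqxx; clear; lia.
have gv x : root q x -> g.[x] = c.
  move=> /rootP qx; have := congr1 (horner^~ x) Dg.
  by rewrite /= hornerD hornerN hornerC hornerM horner_exp qx expr0n mulr0 => /eqP; rewrite subr_eq0 => /eqP.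
have gsv y : root r y -> gs.[y] = c.
  move=> /rootP qx; have := congr1 (horner^~ y) Dgs.
  by rewrite /= hornerD hornerN hornerC hornerM horner_exp qx expr0n mulr0 => /eqP; rewrite subr_eq0 => /eqP.
have dg : g^`() = q ^+ 2.
  have := congr1 (fun p : {poly K} => p^`()) Dg.
  by rewrite /= derivB derivC subr0 (deriv_mul_sqr two0) derivXsubC mul1r.
pose phi := rho * (q \Po h).
have sqc (p A : {poly K}) : (p ^+ 2) \Po A = (p \Po A) ^+ 2 by rewrite !expr2 comp_polyM.
have phi0 : phi != 0 by rewrite mulf_neq0 ?comp_poly_eq0 ?monic_neq0.
have rhs0 : r \Po hs != 0 by rewrite comp_poly_eq0 ?monic_neq0.
have Df : (g \Po h) - c%:P = ('X - t1%:P) * phi ^+ 2.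
  rewrite -[c%:P](comp_polyC c h) -comp_polyB Dg comp_polyM sqc comp_polyB comp_polyX comp_polyC.
  by rewrite Dh /phi; ring.
have Df' : (gs \Po hs) - c%:P = (hs - y1%:P) * (r \Po hs) ^+ 2.
  by rewrite -[c%:P](comp_polyC c hs) -comp_polyB Dgs comp_polyM sqc comp_polyB comp_polyX comp_polyC.
have df : phi ^+ 2 = hs^`() * (r \Po hs) ^+ 2.
  have := deriv_bidec B; rewrite dg dh dgs !sqc mulrC [in RHS]mulrC => <-.
  by rewrite /phi; ring.
(* [df] comes from the chain rule; it makes [sig] a square root of the derivative of [hs]. *)
have /dvdpP[sig Dsig] : r \Po hs %| phi.
  by rewrite -(@dvdp_pexp2r _ _ _ 2) // df dvdp_mulIr.
have sig0 : sig != 0 by apply: contra_neq phi0; rewrite Dsig => ->; rewrite mul0r.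
have r2hs0 : (r \Po hs) ^+ 2 != 0 by rewrite expf_neq0.
have dhs : hs^`() = sig ^+ 2.
  by apply: (mulIf r2hs0); rewrite -df Dsig; ring.
have Dhs : hs - y1%:P = ('X - t1%:P) * sig ^+ 2.
  by apply: (mulIf r2hs0); rewrite -Df' -(bidec_eq B) Df Dsig; ring.
have sigm : sig \is monic.
  have := monic_subC y1 shs1 hsm; rewrite Dhs monicMl ?monicXsubC // => s2.
  have : phi \is monic by rewrite monicMl // monicE lead_coef_comp // (monicP qm) mul1r (monicP hm) expr1n.
  rewrite Dsig monicMr // monicE lead_coef_comp // (monicP rm) mul1r (monicP hsm) expr1n //.
have ht1 : h.[t1] = x1.
  have := congr1 (horner^~ t1) Dh.
  by rewrite /= hornerD hornerN hornerC hornerM hornerXsubC subrr mul0r => /eqP; rewrite subr_eq0 => /eqP.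
have hst1 : hs.[t1] = y1.
  have := congr1 (horner^~ t1) Dhs.
  by rewrite /= hornerD hornerN hornerC hornerM hornerXsubC subrr mul0r => /eqP; rewrite subr_eq0 => /eqP.
have hv t : h.[t] - x1 = (t - t1) * rho.[t] ^+ 2.
  have := congr1 (horner^~ t) Dh.
  by rewrite /= hornerD hornerN hornerC hornerM hornerXsubC horner_exp.
have hsv t : hs.[t] - y1 = (t - t1) * sig.[t] ^+ 2.
  have := congr1 (horner^~ t) Dhs.
  by rewrite /= hornerD hornerN hornerC hornerM hornerXsubC horner_exp.
have y1c : gs.[y1] = c by rewrite -hst1 -(bidec_val t1 B) ht1.
have only t : h.[t] = x1 -> hs.[t] = y1 -> t = t1.
  move=> e1 e2; have [u fu _] := fib_unram B (etrans x1c (esym y1c)) r1.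
  have : t \in fib h hs x1 y1 by rewrite (mem_fib B) e1 e2 !eqxx.
  have : t1 \in fib h hs x1 y1 by rewrite (mem_fib B) ht1 hst1 !eqxx.
  by rewrite fu !inE => /eqP -> /eqP ->.
have nocommon t : root rho t -> ~~ root sig t.
  move=> r0; apply: contraNN rt1 => /rootP s0; rewrite -(@only t) //.
    by apply/eqP; rewrite -subr_eq0 hv (rootP r0) expr0n mulr0.
  by apply/eqP; rewrite -subr_eq0 hsv s0 expr0n mulr0.
have sigt1 : ~~ root sig t1.
  have : root (r \Po hs) t1 = false by rewrite /root horner_comp hst1; apply: negbTE.
  have phit1 : phi.[t1] != 0.
    by rewrite /phi hornerM mulf_neq0 // horner_comp ht1.
  by move=> _; apply: contraNN phit1; rewrite Dsig hornerM => /rootP ->; rewrite mul0r.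
(* The line from [(x1, y1)] to [(x, y)] has the slope [mu] of the curve at every point over
   [(x, y)], so it meets the curve there with multiplicity at least four. This links the derivatives
   of [q] and [r], and makes both expressions independent of the chosen zeros. *)
have cross x y : root q x -> root r y ->
    (x - x1) ^+ 3 * q^`().[x] ^+ 2 = (y - y1) ^+ 3 * r^`().[y] ^+ 2.
  move=> qx ry; have xx1 : x != x1 by apply: contraNneq qx1 => <-.
  have yy1 : y != y1 by apply: contraNneq ry1 => <-.
  have [rgx dgx] := r2 _ xx1 (gv _ qx).
  have xy : g.[x] = gs.[y] by rewrite gv // gsv.
  have rgs : ram gs y = 2%N.
    rewrite -(mup_eq_ram (gsv _ ry)) Dgs mupM ?polyXsubC_eq0 ?expf_neq0 ?monic_neq0 //.
    by rewrite (@mup_XsubCX _ 1) eq_sym (negPf yy1) mup_exp ?monic_neq0 // rsimple.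
  pose mu := (x - x1) / (y - y1).
  have mu0 : mu != 0 by rewrite mulf_neq0 ?invr_eq0 // subr_eq0.
  have fibP t : t \in fib h hs x y -> [/\ h.[t] = x, hs.[t] = y,
      ram h t = 1%N & h^`().[t] = mu * hs^`().[t]].
    rewrite (mem_fib B) => /andP[/eqP e1 /eqP e2]; have tt1 : t - t1 != 0.
      by rewrite subr_eq0; apply: contra_neq xx1 => e; rewrite -e1 e ht1.
    have a1 := hv t; have a2 := hsv t; rewrite e1 in a1; rewrite e2 in a2.
    split=> //.
      apply: ram1_dif0 => //; first exact: bidec_dh B.
      rewrite /dif dh mupNroot // /root horner_exp expf_eq0 /=.
      by apply: contra_neq xx1 => r0; apply/eqP; rewrite -subr_eq0 a1 r0 expr0n mulr0.
    rewrite dh dhs !horner_exp; apply: (mulfI tt1); rewrite -a1 mulrCA -a2 /mu.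
    by rewrite divfK // subr_eq0.
  pose X0 := x1%:P + mu *: ('X - y1%:P) : {poly K}.
  have X0v y' : X0.[y'] = x1 + mu * (y' - y1).
    by rewrite /X0 hornerD hornerC hornerZ hornerXsubC.
  have X0y : X0.[y] = x by rewrite X0v /mu divfK ?subr_eq0 // addrC subrK.
  have dX0 : X0^`() = mu%:P.
    by rewrite /X0 derivD derivC add0r derivZ derivXsubC -mul_polyC mulr1.
  have [N0 N1] := norm_mup B X0 (fib_uniq h hs x y)
    (fun u us => let: And4 _ e _ _ := fibP u us in e).
  have four : (4 <= mup y ((g \Po X0) - gs))%N.
    apply: leq_trans N1; have <- : (\sum_(t <- fib h hs x y) 2 = 4)%N.
      have : (\sum_(t <- fib h hs x y) 2 = \sum_(t <- fib h hs x y) 2 * ram h t)%N.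
        by rewrite big_seq [RHS]big_seq; apply: eq_bigr => t /fibP[_ _ -> _].
      by rewrite -big_distrr /= (fib_ram_h B xy) rgs.
    rewrite big_seq [leqRHS]big_seq; apply: leq_sum => t /fibP[e1 e2 _ slope].
    apply: mup_ge2; first exact: (comp_neq B).
      by rewrite hornerD hornerN horner_comp e2 X0y e1 subrr.
    by rewrite derivB deriv_comp dX0 comp_polyC hornerD hornerN hornerM hornerC slope subrr.
  have [s Ds] := sqrt_ex mu.
  have s0 : s != 0 by apply: contra_neq mu0 => e; rewrite -Ds e expr0n.
  (* In characteristic two the intersection polynomial is ['X - y1%:P] times the square of [W];
     multiplicity four makes [y] a multiple zero of [W]. *)
  pose W := s *: (q \Po X0) + r.
  have DW : (g \Po X0) - gs = ('X - y1%:P) * W ^+ 2.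
    have -> : (g \Po X0) - gs = (g - c%:P \Po X0) - (gs - c%:P).
      by rewrite comp_polyB comp_polyC opprB addrA subrK.
    rewrite Dg Dgs comp_polyM sqc comp_polyB comp_polyX comp_polyC (oppp2 two0 (_ * r ^+ 2)).
    rewrite /W (sqrDp two0) exprZn Ds /X0 [x1%:P + _]addrC addrK -!mul_polyC; ring.
  have W0 : W != 0 by apply: contra_neq N0 => e; rewrite DW e expr0n mulr0.
  have mW : (1 < mup y W)%N.
    move: four; rewrite DW mupM ?polyXsubC_eq0 ?expf_neq0 // (@mup_XsubCX _ 1).
    by rewrite eq_sym (negPf yy1) mup_exp //; clear; lia.
  have : root W^`() y.
    have [dW0|dW0] := eqVneq W^`() 0; first by rewrite dW0 root0.
    rewrite root_mup //; apply: leq_trans (mup_deriv_ge y dW0).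
    by move: mW; case: (mup y W) => [|[]].
  rewrite /root /W derivD derivZ deriv_comp dX0 hornerD hornerZ hornerM hornerC horner_comp X0y.
  rewrite addr_eq0 (oppr2 two0 r^`().[y]) => /eqP <-.
  have -> : x - x1 = s ^+ 2 * (y - y1) by rewrite Ds /mu divfK // subr_eq0.
  by rewrite -Ds; ring.
have rt_ex (p : {poly K}) : (1 < size p)%N -> exists x, root p x.
  by move=> sp; apply/closed_rootP; rewrite neq_ltn sp orbT.
have sr2 : size (r ^+ 2) = l by rewrite -dgs.
have sr : (2 * (size r).-1)%N = l.-1 by rewrite mulnC -size_exp sr2.
have [y0 ry0] : exists y, root r y.
  apply: rt_ex; move: sr l1; have : (0 < size r)%N by rewrite size_poly_gt0 monic_neq0.
  by move: (size r) => k; clear; case: l; lia.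
have qx2 : root q x2.
  have := congr1 (horner^~ x2) Dg.
  rewrite /= hornerD hornerN hornerC x2c subrr hornerM hornerXsubC horner_exp => /esym/eqP.
  by rewrite mulf_eq0 subr_eq0 (negPf x21) expf_eq0 /=.
(* By [cross] this value is common to all zeros of [q] and [r]; it is nonzero as [x2] is a simple
   zero of [q] other than [x1]. *)
have [kap Dkap] := sqrt_ex ((x2 - x1) ^+ 3 * q^`().[x2] ^+ 2).
have k0 : kap != 0.
  have : kap ^+ 2 != 0.
    rewrite Dkap mulf_neq0 ?expf_neq0 ?subr_eq0 // simple_root // qsimple //.
  by rewrite expf_eq0.
have Hr y : root r y -> (y - y1) ^+ 3 * r^`().[y] ^+ 2 = kap ^+ 2.
  by move=> ry; rewrite Dkap -(cross x2).
have Hq x : root q x -> (x - x1) ^+ 3 * q^`().[x] ^+ 2 = kap ^+ 2.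
  by move=> qx; rewrite (cross _ y0) // Hr.
have [d sd] : exists d, size rho = d.+1.
  by exists (size rho).-1; rewrite prednK // size_poly_gt0 monic_neq0.
have [d' sd'] : exists d, size sig = d.+1.
  by exists (size sig).-1; rewrite prednK // size_poly_gt0 monic_neq0.
have size_of (p u : {poly K}) k e z : size p = k.+1 -> (1 < k)%N -> p - z%:P = ('X - t1%:P) * u ^+ 2 ->
   size u = e.+1 -> k = (2 * e).+1.
  move=> sp k1 /(congr1 (fun v : {poly K} => size v)) /= + su.
  rewrite size_subC ?sp ?ltnS 1?ltnW // mulrC size_Mmonic ?monicXsubC ?expf_neq0 ?size_XsubC //.
    have u0 : u != 0 by rewrite -size_poly_gt0 su.
    have := size_exp u 2; rewrite su /=.
    have : (0 < size (u ^+ 2)%R)%N by rewrite size_poly_gt0 expf_neq0.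
    by clear; slia.
  by rewrite -size_poly_gt0 su.
have ld := size_of _ _ _ _ _ (bidec_sh B) l1 Dh sd.
have md := size_of _ _ _ _ _ (bidec_shs B) m1 Dhs sd'.
pose z : K := (kap / phi.[t1]) ^+ 4; pose a : K := - t1.
exists z, a, x1, y1.
have phit1 : phi.[t1] != 0.
  by rewrite /phi hornerM mulf_neq0 // horner_comp ht1.
split.
- by rewrite expf_neq0 // mulf_neq0 // invr_eq0.
- by rewrite (natr_char2 two0) ld /= oddM oner_neq0.
- by rewrite (natr_char2 two0) md /= oddM oner_neq0.
- rewrite {1}ld; apply: (@wild_dickson_half _ two0 d h hs rho sig q r x1 y1 t1 kap) => //.
rewrite {1}md /z Dsig.
apply: (@wild_dickson_half _ two0 d' hs h sig rho r q y1 x1 t1 kap) => //.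
by move=> t st; apply: contraTN st => /nocommon.
Qed.

End WildDickson.

(** * Composition, coefficients and outer components of Dickson polynomials *)

Section DicksonField.
Variable F : fieldType.
Implicit Types (z a : F) (n l m : nat) (p : {poly F}).

(** The Dickson recursion with ['X] and [z] replaced by [dickson l z] and [z ^+ l]; it makes
    [dickson_comp] an induction on [m]. *)
Lemma dickson_add l n z :
  dickson (n + 2 * l) z = dickson l z * dickson (n + l) z - (z ^+ l)%:P * dickson n z :> {poly F}.
Proof.
elim/ltn_ind: l n => -[|[|l]] IH n.
- by rewrite muln0 addn0 expr0 mul1r [dickson 0 z]/= mulr_natl mulr2n addrK.
- by rewrite addn2 addn1 expr1 dicksonSS.
have e1 := IH l.+1 (ltnSn _) n.+1; have e2 := IH l (leqnSn _) n.+2.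
have -> : (n + 2 * l.+2 = (n + 2 * l).+4)%N by lia.
have a1 : (n.+1 + 2 * l.+1 = (n + 2 * l).+3)%N by lia.
have a2 : (n.+2 + 2 * l = (n + 2 * l).+2)%N by lia.
have a3 : (n.+1 + l.+1 = (n + l).+2)%N by lia.
have a4 : (n.+2 + l = (n + l).+2)%N by lia.
have a5 : (n + l.+2 = (n + l).+2)%N by lia.
rewrite a1 a3 in e1; rewrite a2 a4 in e2; rewrite a5.
rewrite dicksonSS e1 e2 (dicksonSS l) (dicksonSS n) !exprS !polyCM; ring.
Qed.

Lemma dickson_comp l m z :
  dickson m (z ^+ l) \Po dickson l z = dickson (l * m) z :> {poly F}.
Proof.
elim/ltn_ind: m => -[|[|m]] IH.
- by rewrite muln0 /= -polyC_natr comp_polyC.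
- by rewrite muln1 /= comp_polyX.
have -> : (l * m.+2 = l * m + 2 * l)%N by lia.
rewrite dickson_add dicksonSS comp_polyB !comp_polyM comp_polyX comp_polyC.
by rewrite !IH ?leqnSn // mulnS [(l + _)%N]addnC.
Qed.

(** From these two coefficients the parameters of a translate are recovered: the first yields the
    shift, the second [z]. *)
Lemma dickson_coef n z :
  (dickson n.+2 z : {poly F})`_n.+1 = 0 /\ (dickson n.+2 z)`_n = - (n.+2%:R * z).
Proof.
elim/ltn_ind: n => -[|[|n]] IH.
- by rewrite dicksonSS /= -polyC_natr -polyCM !coefB !coefXM !coefC coefX /= !subr0 sub0r mulrC.
- have [c1 c0] := IH 0%N isT.
  rewrite dicksonSS [dickson 1 z]/= !coefB !coefXM !coefCM !coefX c1 c0 /= mulr0 mulr1 subr0.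
  by split=> //; ring.
have [c1 c0] := IH n.+1 (ltnSn _); have [d1 d0] := IH n (leqnSn _).
have [sn mn] := dickson_lead n.+1 z.
rewrite dicksonSS !coefB !coefXM !coefCM c1 c0 /=.
have -> : (dickson n.+2 z)`_n.+3 = 0 by rewrite nth_default // sn.
have -> : (dickson n.+2 z)`_n.+2 = 1.
  by move/monicP: mn; rewrite lead_coefE sn.
by rewrite mulr0 mulr1 subr0 -[n.+4]addn1 natrD; split=> //; ring.
Qed.

Lemma coef_shift n p a : size p = n.+2 -> p \is monic ->
  (p \Po ('X + a%:P))`_n = p`_n + n.+1%:R * a.
Proof.
move=> sp pm; have sXa i : size (('X + a%:P) ^+ i) = i.+1.
  by rewrite -(size_exp_XsubC i (- a)) polyCN opprK.
rewrite comp_polyE sp coef_sum !big_ord_recr /= big1 ?add0r => [|i _]; last first.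
  by rewrite coefZ [X in _ * X]nth_default ?mulr0 // sXa ltn_ord.
have pl : p`_n.+1 = 1 by move/monicP: pm; rewrite lead_coefE sp.
rewrite pl scale1r coefZ; congr (_ + _).
  rewrite -[RHS]mulr1; congr (_ * _).
  have := monic_exp n (monicXsubC (- a)); rewrite monicE lead_coefE size_exp_XsubC.
  by rewrite polyCN opprK => /eqP.
elim: (n) => [|k IHk]; first by rewrite expr1 coefD coefX coefC add0r mul1r.
rewrite exprS mulrDl coefD coefXM /= IHk coefCM.
have := monic_exp k.+1 (monicXsubC (- a)); rewrite monicE lead_coefE size_exp_XsubC /=.
by rewrite polyCN opprK => /eqP ->; rewrite -[k.+2]addn1 natrD; ring.
Qed.

(** The differences satisfy [u \Po h = v \Po hs], so [m] divides the degree of [u], which is below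
    [m]; both are the same constant. Primes do not denote derivatives here. *)
Lemma outer_unique l m (g h gs hs g' gs' : {poly F}) : coprime l m ->
  (0 < l)%N -> (0 < m)%N ->
  size h = l.+1 -> size hs = m.+1 -> (size (g - g')%R <= m)%N ->
  g \Po h = gs \Po hs -> g' \Po h = gs' \Po hs ->
  exists e : F, g = g' + e%:P /\ gs = gs' + e%:P.
Proof.
move=> co l0 m0 sh shs su e1 e2; set u := g - g' in su; set v := gs - gs'.
have uv : u \Po h = v \Po hs by rewrite !comp_polyB e1 e2.
have sz := congr1 (fun p : {poly F} => (size p).-1) uv.
rewrite !size_comp_poly sh shs /= in sz.
have dv : (m %| (size u).-1)%N.
  have : (m %| (size u).-1 * l)%N by rewrite sz dvdn_mull.
  by rewrite Gauss_dvdl // coprime_sym.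
have u1 : (size u <= 1)%N.
  move: su dv; case: (size u) => // k km /= /dvdn_leq.
  by case: k km => // k km /(_ isT); rewrite leqNgt km.
have v1 : (size v <= 1)%N.
  move: sz; have -> : (size u).-1 = 0%N by move: u1; case: (size u) => [|[]].
  rewrite mul0n => /esym/eqP; rewrite muln_eq0 [m == _]eqn0Ngt m0 orbF.
  by case: (size v) => [|[]].
have Du := size1_polyC u1; have Dv := size1_polyC v1.
have uv0 : u`_0 = v`_0.
  by apply: polyC_inj; rewrite -(comp_polyC u`_0 h) -(comp_polyC v`_0 hs) -Du -Dv.
exists u`_0; split; first by rewrite -Du addrC subrK.
by rewrite uv0 -Dv addrC subrK.
Qed.

Lemma dickson_outer l m (g h gs hs : {poly F}) z a b b' : coprime l m ->
  (0 < l)%N -> (0 < m)%N -> g \is monic -> size g = m.+1 ->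
  g \Po h = gs \Po hs ->
  h = dickson l z \Po ('X + a%:P) + b%:P ->
  hs = dickson m z \Po ('X + a%:P) + b'%:P ->
  exists e : F, g = (dickson m (z ^+ l) \Po ('X + (- b)%:P)) + e%:P /\
    gs = (dickson l (z ^+ m) \Po ('X + (- b')%:P)) + e%:P.
Proof.
move=> co l0 m0 gm sg e Dh Dhs.
have lead n z' : (0 < n)%N -> size (dickson n z' : {poly F}) = n.+1 /\ (dickson n z' : {poly F}) \is monic.
  by case: n => // n _; exact: dickson_lead.
have sX (c : F) : size ('X + c%:P) = 2%N by rewrite size_XaddC.
have sh : size h = l.+1.
  have [s1 _] := lead l z l0.
  by rewrite Dh size_polyDl size_comp_poly2 // s1 // size_polyC; case: (b != 0); rewrite ?ltnS // .
have shs : size hs = m.+1.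
  have [s1 _] := lead m z m0.
  by rewrite Dhs size_polyDl size_comp_poly2 // s1 // size_polyC; case: (b' != 0); rewrite ?ltnS // .
have val n1 n2 c p : p = dickson n1 z \Po ('X + a%:P) + c%:P ->
   (dickson n2 (z ^+ n1) \Po ('X + (- c)%:P)) \Po p = dickson (n1 * n2) z \Po ('X + a%:P).
  move=> ->; rewrite -comp_polyA comp_polyD comp_polyX comp_polyC -addrA -polyCD subrr addr0.
  by rewrite comp_polyA dickson_comp.
apply: (outer_unique co l0 m0 sh shs _ e); last by rewrite (val _ _ _ _ Dh) (val _ _ _ _ Dhs) mulnC.
have [s1 m1] := lead m (z ^+ l) m0.
apply: size_monicB => //; last by rewrite size_comp_poly2.
by rewrite monicE lead_coef_comp ?sX // -[X in 'X + X]opprK -polyCN lead_coefXsubC expr1n mulr1 -monicE.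
Qed.

End DicksonField.

(** * The power case and the classification over a closed field *)

Section PowerShape.
Variable K : closedFieldType.
Implicit Types (p q : {poly K}) (x t c : K).

Lemma monic_exp_inj n p q : (0 < n)%N -> p \is monic -> q \is monic ->
  p ^+ n = q ^+ n -> p = q.
Proof.
move=> n0 pm qm e; apply: monic_mup_ext => // x.
by apply/eqP; rewrite -(eqn_pmul2l n0) -!mup_exp ?monic_neq0 // e.
Qed.

Lemma root_exists n x : (0 < n)%N -> exists w : K, w ^+ n = x.
Proof.
move=> n0; have /closed_rootP[w] : size ('X^n - x%:P : {poly K}) != 1%N.
  by rewrite size_XnsubC // eqSS -lt0n.
by rewrite /root !hornerE subr_eq0 => /eqP; exists w.
Qed.

Lemma coef_power_shape k n q c i :
  (0 < n)%N -> (i != k %[mod n])%N ->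
  ('X^k * (q \Po ('X^n + c%:P)))`_i = 0.
Proof.
move=> n0 ik; rewrite coefXnM; case: ltnP => // ki.
have -> : q \Po ('X^n + c%:P) = (q \Po ('X + c%:P)) \Po 'X^n.
  by rewrite -comp_polyA comp_polyD comp_polyX comp_polyC.
rewrite coef_comp_poly_Xn //; case: ifP => // dv.
by move: ik; rewrite eqn_mod_dvd // dv.
Qed.

(** The exponents of [p] are congruent modulo [n > 1], so the coefficient of degree [d - 1] vanishes
    and, [d] being nonzero in [K], the ramified point is zero; [k > 0] makes its value zero too. *)
Lemma shape_eqXn k n q c p d : (1 < n)%N -> (0 < k)%N -> (1 < d)%N ->
  p = 'X^k * (q \Po ('X^n + c%:P)) -> p \is monic -> size p = d.+1 -> 
  p^`() != 0 -> totram p -> p = 'X^d.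
Proof.
move=> n1 k0 d1 Dp pm sp dp [c0 [x0 e]].
rewrite sp /= in e.
have p0 : p.[0] = 0 by rewrite Dp hornerM hornerXn expr0n gtn_eqF // mul0r.
have dk : (d = k %[mod n])%N.
  apply/eqP/negPn/negP => ne; have := coef_power_shape q c (ltnW n1) ne.
  rewrite -Dp; move/monicP: pm; rewrite lead_coefE sp /= => ->.
  by move/eqP; rewrite oner_eq0.
have cd : p`_d.-1 = 0.
  rewrite Dp; apply: coef_power_shape; first exact: ltnW.
  have : (d.-1.+1 != d.-1 %[mod n])%N.
    by rewrite eqn_mod_dvd ?leqnSn // subSnn dvdn1 neq_ltn n1 orbT.
  by rewrite prednK ?(ltnW d1) // dk eq_sym.
have dn : d%:R != 0 :> K.
  apply: contra_neq dp => d0.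
  have -> : p^`() = (p - c0%:P)^`() by rewrite derivB derivC subr0.
  by rewrite e deriv_exp -mulr_natr -polyC_natr d0 mulr0.
have x00 : x0 = 0.
  have [j dj] : exists j, d = j.+2 by case: d d1 {e sp dk cd dn} => [|[|j]] // _; exists j.
  have := congr1 (fun u : {poly K} => u`_j.+1) e.
  rewrite /= coefB coefC /= subr0; have -> : p`_j.+1 = 0 by move: cd; rewrite dj.
  have := @coef_shift _ j.+1 'X^(j.+2) (- x0).
  rewrite size_polyXn => /(_ erefl (monicXn _ _)).
  rewrite coefXn ltn_eqF // add0r polyCN comp_Xn_poly -dj => -> /esym/eqP.
  by rewrite mulf_eq0 (negPf dn) oppr_eq0 => /eqP.
have := congr1 (horner^~ 0) e.
rewrite /= hornerD hornerN hornerC p0 x00 horner_exp hornerXsubC subrr expr0n.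
rewrite gtn_eqF ?(ltnW d1) // => /eqP; rewrite add0r oppr_eq0 => /eqP c00.
by move: e; rewrite c00 x00 !subr0.
Qed.

(** A zero [x != x1] of [q] would give, through an [n]-th root of [x - x1], a nonzero zero of a
    monomial. *)
Lemma shape_totram n k q c x1 (g : {poly K}) : (0 < n)%N ->
  'X^k * (q \Po ('X^n + x1%:P)) = 'X^((size ('X^k * (q \Po ('X^n + x1%:P)))).-1) ->
  (forall x, g.[x] = c -> x != x1 -> root q x) ->
  (forall x, g.[x] = c -> x = x1).
Proof.
move=> n0 e H x gx; apply/eqP/negPn/negP => xx1; have qx := H _ gx xx1.
have [w Dw] := root_exists (x - x1) n0.
have eL : ('X^k * (q \Po ('X^n + x1%:P))).[w] = 0.
  rewrite hornerM horner_comp.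
  have -> : ('X^n + x1%:P).[w] = x by rewrite hornerD hornerXn hornerC Dw subrK.
  by rewrite (rootP qx) mulr0.
have := congr1 (horner^~ w) e; rewrite /= eL hornerXn => /esym/eqP.
rewrite expf_eq0 => /andP[_ /eqP w0].
by move: Dw; rewrite w0 expr0n gtn_eqF // => /esym/eqP; rewrite subr_eq0 (negPf xx1).
Qed.

(** The coefficient of degree [d - 2] is nonzero for [d > 2], so [n] divides two. For [d = 2] it
    merges with the constant [e], and [p.[0] = 0] leaves ['X^2]. *)
Lemma shape_dickson n k q c p d z b e : (1 < n)%N -> (0 < k)%N -> (1 < d)%N ->
  p = 'X^k * (q \Po ('X^n + c%:P)) -> p \is monic -> size p = d.+1 -> 
  z != 0 -> d%:R != 0 :> K ->
  p = (dickson d z \Po ('X + b%:P)) + e%:P -> p = 'X^d \/ n = 2%N.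
Proof.
move=> n1 k0 d1 Dp pm sp z0 dn Dd.
have p0 : p.[0] = 0 by rewrite Dp hornerM hornerXn expr0n gtn_eqF // mul0r.
have dk : (d = k %[mod n])%N.
  apply/eqP/negPn/negP => ne; have := coef_power_shape q c (ltnW n1) ne.
  rewrite -Dp; move/monicP: pm; rewrite lead_coefE sp /= => ->.
  by move/eqP; rewrite oner_eq0.
have [j dj] : exists j, d = j.+2 by case: d d1 {sp Dd dk dn} => [|[|j]] // _; exists j.
have cd i : (i <= d)%N -> ~~ (n %| d - i)%N -> p`_i = 0.
  move=> le nd; rewrite Dp; apply: coef_power_shape; first exact: ltnW.
  by rewrite -dk eq_sym eqn_mod_dvd.
have [sd md] := dickson_lead j.+1 z; have [c1 c0] := dickson_coef j z.
have b0 : b = 0.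
  have : p`_j.+1 = 0 by apply: cd; rewrite dj ?leqnSn // subSnn dvdn1 neq_ltn n1 orbT.
  rewrite Dd dj coefD coefC addr0 coef_shift // c1 add0r -dj => /eqP.
  by rewrite mulf_eq0 (negPf dn) => /eqP.
have Dd' : p = dickson d z + e%:P by rewrite Dd b0 addr0 comp_polyXr.
case: j dj sd md c1 c0 => [|j] dj sd md c1 c0.
  left; have e0 : e = (2%:R * z).
    move: p0; rewrite Dd' dj hornerD hornerC horner_coef0 c0 addrC => /eqP.
    by rewrite subr_eq0 => /eqP.
  rewrite Dd' dj dicksonSS [dickson 1 z]/= [dickson 0 z]/= e0 polyCM polyC_natr.
  by rewrite expr2 [z%:P * _]mulrC subrK.
right; have : p`_j.+1 != 0.
  by rewrite Dd' coefD coefC addr0 dj c0 oppr_eq0 mulf_neq0 // -dj.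
apply: contra_neq_eq => n2; apply: cd; rewrite dj; first by rewrite ltnW.
have -> : (j.+3 - j.+1 = 2)%N by clear; lia.
by apply: contra n2 => /(dvd2_eq n1) ->.
Qed.

End PowerShape.

Section Core.
Variable K : closedFieldType.
Implicit Types (x y t c : K) (g h gs hs : {poly K}).

Definition core l m g h gs hs :=
  [\/ totram g, totram gs | @dickson_pair K l m h hs].

Lemma dickson_pair_sym l m h hs : @dickson_pair K l m h hs -> dickson_pair m l hs h.
Proof. by case=> z [a [b [b' [z0 l0 m0 e1 e2]]]]; exists z, a, b', b. Qed.

Lemma core_sym l m g h gs hs : core l m g h gs hs -> core m l gs hs g h.
Proof.
by case=> [?|?|/dickson_pair_sym ?]; [constructor 2 | constructor 1 | constructor 3].
Qed.

Lemma classify_core l m g h gs hs : bidec l m g h gs hs ->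
  core l m g h gs hs \/ power_data g.
Proof.
move=> B; case: (classify B) => [[tr|tr]|w|t|p]; last by right.
- by left; constructor 1.
- by left; constructor 2.
- by left; constructor 3; apply: wild_dickson B w.
- by left; constructor 3; apply: tame_dickson B t.
Qed.

Section PowerReduction.
Variables (l m : nat) (g h gs hs : {poly K}).
Hypothesis B : bidec l m g h gs hs.
Variables (c c' : K) (A A' : nat).
Hypotheses (A1 : (1 < A)%N) (A1' : (1 < A')%N).
Hypothesis HA : forall x, g.[x] = c -> (A %| ram g x)%N.
Hypothesis HA' : forall y, gs.[y] = c' -> (A' %| ram gs y)%N.

Let sg1 : (1 < size g)%N := bidec_sg1 B.
Let shs1 : (1 < size hs)%N := bidec_shs1 B.
Let sgs1 : (1 < size gs)%N := bidec_sgs1 B.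
Let sh1 : (1 < size h)%N := bidec_sh1 B.

Lemma power_dvd : (A %| m)%N.
Proof.
rewrite -(ram_sum_g B c) big_seq; elim/big_ind: _ => [|u v|x]; rewrite ?dvdn0 //.
  exact: dvdn_add.
by rewrite mem_fibre // => /eqP /HA.
Qed.

Lemma power_heavy x : g.[x] = c' -> ~~ (A' %| ram g x)%N -> heavy h x.
Proof.
move=> gx nd t ht; apply: (ram_gt1 B); rewrite ht; apply: contraNN nd => dv.
by apply: dvdn_trans dv; apply: HA'; rewrite -(bidec_val t B) ht.
Qed.

(** By [power_heavy] an exceptional [x] is a heavy value of [h], and there is at most one. *)
Lemma power_exc : exists2 x1, g.[x1] = c' &
  forall x, x != x1 -> g.[x] = c' -> (A' %| ram g x)%N.
Proof.
have [/hasP[x1]|/hasPn all] :=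
  boolP (has (fun x => ~~ (A' %| ram g x)%N) (rts (g - c'%:P))).
  rewrite mem_fibre // => /eqP x1y n1; exists x1 => // x xx1 xy.
  apply: contraNT xx1 => n2; apply/eqP.
  exact: (heavy_unique (bidec_dh B) sh1 (power_heavy xy n2) (power_heavy x1y n1)).
have [x1 x1y] := fibre_nonempty B c'; exists x1 => // x _ xy.
by have := all x; rewrite mem_fibre // xy eqxx negbK; apply.
Qed.

(** Over different values the fibres of [g] would have at most [m / 2] and [(m + 1) / 2] points,
    together at most [m], so the different of [g] would have degree at least [m]. *)
Lemma power_same : c = c'.
Proof.
apply/eqP/negPn/negP => cc'.
have [x1 x1c e1] := power_exc.
have [|s1 _] := half_count B x1c.
  move=> x xx1 xc; apply: leq_trans A1' (dvdn_leq _ (e1 _ xx1 xc)); exact: ram_gt0.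
have s2 : (2 * size (rts (g - c%:P)) <= m)%N.
  rewrite -[leqRHS](ram_sum_g B c) -sum1_size big_distrr /= big_seq [leqRHS]big_seq.
  apply: leq_sum => x; rewrite mem_fibre // => /eqP xc.
  by apply: leq_trans A1 (dvdn_leq _ (HA xc)); exact: ram_gt0.
have DD := sum_dif_le B (fibres_uniq B cc'); rewrite big_cat /= in DD.
have D1 := dif_fibre_ge B c; have D2 := dif_fibre_ge B c'.
have m1 := bidec_m B; move: s1 s2 DD D1 D2 m1; clear.
set s := size _; set s' := size (rts (g - c%:P)).
set d := (\sum_(_ <- _) _)%N; set d' := (\sum_(_ <- rts (g - c'%:P)) _)%N.
lia.
Qed.

End PowerReduction.

(** A common divisor of [A'] and [ram g x1] divides [l] and all indices over [c], hence also [m]. So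
    [A'] is coprime to [ram g x1], and [ram_mul] makes it divide every index of [h] over [x1]. The
    case [A = 1] serves total ramification. *)
Lemma power_shape l m g h gs hs c A A' : bidec l m g h gs hs ->
  (1 < A')%N -> coprime A A' ->
  (forall x, g.[x] = c -> (A %| ram g x)%N) ->
  (forall y, gs.[y] = c -> (A' %| ram gs y)%N) ->
  exists x1 k q v, [/\ (0 < k)%N, q \is monic, v \is monic,
    g - c%:P = ('X - x1%:P) ^+ (A * k) * q ^+ (A * A') & h - x1%:P = v ^+ A'].
Proof.
move=> B A1' co HA HA'.
have sg1 := bidec_sg1 B.
have sh1 := bidec_sh1 B.
have sgs1 := bidec_sgs1 B.
have [x1 x1c e1] := power_exc B HA'.
have dl : (A' %| l)%N := power_dvd (bidec_sym B) HA'.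
have cop : coprime A' (ram g x1).
  rewrite /coprime -dvdn1; have := bidec_co B; rewrite /coprime => /eqP <-.
  rewrite dvdn_gcd (dvdn_trans (dvdn_gcdl _ _) dl) -(ram_sum_g B c) big_seq.
  elim/big_ind: _ => [|u v|x]; rewrite ?dvdn0 //; first exact: dvdn_add.
  rewrite mem_fibre // => /eqP xc; have [->|xx1] := eqVneq x x1; first exact: dvdn_gcdr.
  exact: dvdn_trans (dvdn_gcdl _ _) (e1 _ xx1 xc).
have gm : g - c%:P \is monic by rewrite monic_subC // (bidec_gm B).
have hm : h - x1%:P \is monic by rewrite monic_subC // (bidec_hm B).
have [r rm [Dg mr]] := mup_split x1 gm.
rewrite (mup_eq_ram x1c) in Dg.
have [k Dk] : exists k, ram g x1 = (A * k)%N.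
  by have /dvdnP[k ->] := HA _ x1c; exists k; rewrite mulnC.
have [x|q qm Dr] := root_extract (n := (A * A')%N) rm.
  rewrite mr; case: eqP => [|/eqP xx1]; first by rewrite dvdn0.
  have [/eqP xc|/eqP nxc] := boolP (g.[x] == c).
    by rewrite (mup_eq_ram xc) Gauss_dvd // HA // e1.
  rewrite mupNroot ?dvdn0 // /root !hornerE subr_eq0; exact/eqP.
have [t|v vm Dh] := root_extract (n := A') hm.
  have [/eqP ht|/eqP nht] := boolP (h.[t] == x1); last first.
    by rewrite mupNroot ?dvdn0 // /root !hornerE subr_eq0; exact/eqP.
  rewrite (mup_eq_ram ht).
  have : (A' %| ram g x1 * ram h t)%N.
    rewrite -{1}ht (ram_mul B) dvdn_mulr // HA' // -(bidec_val t B) ht //.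
  by rewrite Gauss_dvdr.
exists x1, k, q, v; split=> //; last by rewrite -Dk Dg Dr.
by have := ram_gt0 x1 sg1; rewrite Dk muln_gt0 => /andP[].
Qed.

End Core.

(** * Lowering the degrees by taking roots *)

Section CoreInduction.
Variable K : closedFieldType.
Implicit Types (x y t c : K) (g h gs hs : {poly K}).

Lemma size_root n (p v : {poly K}) c d : p - c%:P = v ^+ n -> size p = d.+1 ->
  (0 < d)%N -> v != 0 -> d = (n * (size v).-1)%N.
Proof.
move=> e sp d0 v0; have := size_exp v n; rewrite -e size_subC ?sp //= => ->.
by rewrite mulnC.
Qed.

Section Shape.
Variables (k A A' : nat) (x1 : K) (q : {poly K}).
Hypotheses (k0 : (0 < k)%N) (A0 : (0 < A)%N) (A0' : (0 < A')%N) (qm : q \is monic).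
(** The outer polynomial that remains after taking roots: if [h - x1%:P = v ^+ A'], then by
    [shape_comp] the composite is the [A * A']-th power of [Q \Po v], up to the constant [c]. *)
Let Q : {poly K} := 'X^k * (q \Po ('X^A' + x1%:P)).

Let sXA : size ('X^A' + x1%:P : {poly K}) = A'.+1.
Proof. by rewrite -[x1]opprK polyCN size_XnsubC. Qed.

Lemma shape_monic : Q \is monic.
Proof.
rewrite monicMl ?monicXn // monicE lead_coef_comp ?sXA //.
by rewrite (monicP qm) mul1r -[x1]opprK polyCN lead_coefXnsubC // expr1n.
Qed.

Lemma shape_size : size Q = (k + (size q).-1 * A').+1.
Proof.
have q0 := monic_neq0 qm.
have c0 : q \Po ('X^A' + x1%:P) != 0 by rewrite comp_poly_eq0 // sXA.
rewrite size_monicM ?monicXn // size_polyXn.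
have := size_comp_poly q ('X^A' + x1%:P); rewrite sXA /= => <-.
by move: c0; rewrite -size_poly_gt0; case: (size _) => // j _; rewrite addnS.
Qed.

Lemma shape_small : (1 < A')%N -> (size Q <= 2)%N -> Q = 'X^((size Q).-1).
Proof.
move=> a1; rewrite shape_size /= ltnS => le.
have s0 : ((size q).-1 * A' = 0)%N.
  by have := leq_trans le k0; rewrite -[leqRHS]addn0 leq_add2l leqn0 => /eqP.
have q1 : q = 1.
  move/eqP: s0; rewrite muln_eq0 [A' == _]gtn_eqF // orbF => /eqP s0.
  have /size1_polyC e : (size q <= 1)%N by move: s0; clear; case: (size q) => [|[]].
  by move/monicP: qm; rewrite e lead_coefC => ->.
by rewrite s0 addn0 /Q q1 -polyC1 comp_polyC mulr1.
Qed.

Lemma shape_comp (h v : {poly K}) : h - x1%:P = v ^+ A' ->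
  (('X - x1%:P) ^+ (A * k) * q ^+ (A * A')) \Po h = (Q \Po v) ^+ (A * A').
Proof.
move=> e; have vh : v ^+ A' + x1%:P = h by rewrite -e subrK.
rewrite comp_polyM !rmorphXn /= comp_polyB comp_polyX comp_polyC e.
rewrite /Q comp_polyM comp_Xn_poly -comp_polyA comp_polyD comp_Xn_poly comp_polyC vh.
by rewrite exprMn -!exprM; congr (_ ^+ _ * _); rewrite mulnCA mulnA mulnC.
Qed.

Lemma shape_deriv (g : {poly K}) c : g^`() != 0 -> A'%:R != 0 :> K ->
  g - c%:P = ('X - x1%:P) ^+ (A * k) * q ^+ (A * A') -> Q^`() != 0.
Proof.
move=> dg An e; have e2 : ('X^A' + x1%:P) - x1%:P = 'X ^+ A' :> {poly K} by rewrite addrK.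
have := shape_comp e2; rewrite -e comp_polyXr comp_polyB comp_polyC => eQ.
apply/eqP => Q0; have := congr1 (fun p : {poly K} => p^`()) eQ.
rewrite /= deriv_exp Q0 mul0r mul0rn derivB derivC subr0 deriv_comp => /eqP.
rewrite mulf_eq0 comp_poly_eq0 ?sXA // (negPf dg) /=.
rewrite derivD derivC addr0 derivXn -mulr_natr -polyC_natr mulf_eq0 polyC_eq0 (negPf An).
by rewrite orbF expf_eq0 polyX_eq0 andbF.
Qed.

Lemma shape_totram_g (g : {poly K}) c : (1 < size g)%N -> g \is monic ->
  g - c%:P = ('X - x1%:P) ^+ (A * k) * q ^+ (A * A') ->
  Q = 'X^((size Q).-1) -> totram g.
Proof.
move=> sg gm e eQ.
have un : forall x, g.[x] = c -> x = x1.
  apply: (shape_totram A0' eQ) => x gx xx1.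
  have := congr1 (horner^~ x) e.
  rewrite /= hornerD hornerN hornerC gx subrr hornerM !horner_exp hornerXsubC => /esym/eqP.
  rewrite mulf_eq0 !expf_eq0 subr_eq0 (negPf xx1) andbF /= => /andP[_].
  by [].
exists c, x1; have gcm : g - c%:P \is monic by rewrite monic_subC.
have [r rm [Dg mr]] := mup_split x1 gcm.
have r1 : r = 1.
  apply: monic_mup_ext; rewrite ?monic1 // => x.
  rewrite mr [RHS]mupNroot ?root1 //; case: eqP => // xx1.
  rewrite mupNroot // /root !hornerE subr_eq0; apply/eqP => /un; exact: xx1.
rewrite Dg r1 mulr1; congr (_ ^+ _).
have := congr1 (fun p : {poly K} => size p) Dg.
by rewrite /= r1 mulr1 size_subC // size_exp_XsubC => ->.
Qed.

End Shape.

(** The reduced degrees are [l / A'] and [m / A]. Total ramification of [Q] or [Q'] lifts back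
    because of their special shape; failing that, a Dickson pair would force [A = A' = 2], against
    coprimality. A reduced degree one falls outside [bidec] and is settled by [shape_small]. *)
Lemma power_step l m g h gs hs : bidec l m g h gs hs ->
  (forall l' m' g' h' gs' hs', (l' + m' < l + m)%N -> bidec l' m' g' h' gs' hs' ->
     @core K l' m' g' h' gs' hs') ->
  power_data g -> power_data gs -> core l m g h gs hs.
Proof.
move=> B IH [c [A A1 HA]] [c' [A' A1' HA']].
have cc' := power_same B A1 A1' HA HA'; rewrite -cc' in HA'.
have l1 := bidec_l B; have m1 := bidec_m B.
have sg1 : (1 < size g)%N by rewrite (bidec_sg B) ltnS ltnW.
have sgs1 : (1 < size gs)%N by rewrite (bidec_sgs B) ltnS ltnW.
have dm : (A %| m)%N := power_dvd B HA.
have dl : (A' %| l)%N := power_dvd (bidec_sym B) HA'.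
have co : coprime A A'.
  by apply: coprime_dvdl dm (coprime_dvdr dl _); rewrite coprime_sym (bidec_co B).
have co' : coprime A' A by rewrite coprime_sym.
have [x1 [k [q [v [k0 qm vm Dg Dh]]]]] := power_shape B A1' co HA HA'.
have [y1 [k' [q' [v' [k0' qm' vm' Dgs Dhs]]]]] :=
  power_shape (bidec_sym B) A1 co' HA' HA.
have A0 := ltnW A1; have A0' := ltnW A1'.
pose Q := 'X^k * (q \Po ('X^A' + x1%:P)).
pose Q' := 'X^k' * (q' \Po ('X^A + y1%:P)).
have Qm : Q \is monic by apply: shape_monic.
have Qm' : Q' \is monic by apply: shape_monic.
have el : l = (A' * (size v).-1)%N.
  by apply: size_root Dh (bidec_sh B) (ltnW l1) (monic_neq0 vm).
have em : m = (A * (size v').-1)%N.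
  by apply: size_root Dhs (bidec_shs B) (ltnW m1) (monic_neq0 vm').
set lr := (size v).-1 in el; set mr := (size v').-1 in em.
have sv : size v = lr.+1 by rewrite prednK // size_poly_gt0 monic_neq0.
have sv' : size v' = mr.+1 by rewrite prednK // size_poly_gt0 monic_neq0.
have lr0 : (0 < lr)%N by move: l1; rewrite el; case: (lr) => //; rewrite muln0.
have mr0 : (0 < mr)%N by move: m1; rewrite em; case: (mr) => //; rewrite muln0.
have QQ : Q \Po v = Q' \Po v'.
  apply: (@monic_exp_inj _ (A * A')); first by rewrite muln_gt0 A0.
  - by rewrite monicE lead_coef_comp ?sv // (monicP Qm) (monicP vm) expr1n mul1r.
  - by rewrite monicE lead_coef_comp ?sv' // (monicP Qm') (monicP vm') expr1n mul1r.
  rewrite -(shape_comp k A q Dh) -Dg [in RHS]mulnC -(shape_comp k' A' q' Dhs) -Dgs.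
  by rewrite !comp_polyB !comp_polyC (bidec_eq B).
have sQ : size Q = mr.+1.
  have := congr1 (fun p : {poly K} => size p) Dg.
  rewrite /= size_subC // (bidec_sg B) size_monicM ?monic_exp ?monicXsubC ?expf_neq0 ?monic_neq0 //.
  rewrite size_exp_XsubC shape_size // => e.
  have := size_exp q (A * A'); have : (0 < size (q ^+ (A * A'))%R)%N by rewrite size_poly_gt0 expf_neq0 // monic_neq0.
  move: e; case: (size (q ^+ _)) => // j; rewrite addnS /= => -[e] _ je.
  congr _.+1; apply/eqP; rewrite -(eqn_pmul2l A0) -em e je.
  by rewrite mulnDr mulnCA.
have sQ' : size Q' = lr.+1.
  have := congr1 (fun p : {poly K} => (size p).-1) QQ.
  rewrite /= !size_comp_poly sv sv' /= sQ /= mulnC => e.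
  have s0 : (0 < size Q')%N by rewrite size_poly_gt0 monic_neq0.
  rewrite -(prednK s0); congr _.+1; apply/eqP; rewrite -(eqn_pmul2r mr0) -e.
  by rewrite mulnC.
have dgs := bidec_dgs B; have dg := bidec_dg B.
have tame_exp (p u w : {poly K}) n n' z e : p^`() != 0 -> p - z%:P = u ^+ (n * n') * w ^+ (n * e) ->
    n%:R != 0 :> K.
  move=> dp eq; apply: contra_neq dp => n00.
  have -> : p^`() = (p - z%:P)^`() by rewrite derivB derivC subr0.
  have -> : p - z%:P = (u ^+ n' * w ^+ e) ^+ n by rewrite eq exprMn -!exprM ![(_ * n)%N]mulnC.
  by rewrite deriv_exp -mulr_natr -polyC_natr n00 mulr0.
have An : A%:R != 0 :> K := tame_exp _ _ _ _ _ _ _ dg Dg.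
have An' : A'%:R != 0 :> K := tame_exp _ _ _ _ _ _ _ dgs Dgs.
have dQ : Q^`() != 0 .
  by apply: shape_deriv Dg.
have dQ' : Q'^`() != 0 .
  by apply: shape_deriv Dgs.
have trg : Q = 'X^mr -> core l m g h gs hs.
  move=> e; constructor 1; apply: (shape_totram_g A0' sg1 (bidec_gm B) Dg).
  by rewrite -/Q sQ.
have trgs : Q' = 'X^lr -> core l m g h gs hs.
  move=> e; constructor 2; apply: (shape_totram_g A0 sgs1 (bidec_gsm B) Dgs).
  by rewrite -/Q' sQ'.
have [lr1|lr1] := leqP lr 1; first by apply: trgs; rewrite [LHS]shape_small ?sQ'.
have [mr1|mr1] := leqP mr 1; first by apply: trg; rewrite [LHS]shape_small ?sQ.
have B' : bidec lr mr Q v Q' v'.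
  constructor=> //; apply: (coprime_dvdl (dvdn_mull A' (dvdnn lr))).
  by apply: (coprime_dvdr (dvdn_mull A (dvdnn mr))); rewrite -el -em (bidec_co B).
have lt : (lr + mr < l + m)%N.
  by rewrite el em -addnS leq_add //; [rewrite leq_pmull | rewrite ltn_Pmull].
case: (IH _ _ _ _ _ _ lt B') => [tr|tr|].
- by apply: trg; apply: (shape_eqXn A1' k0 mr1 (erefl Q)).
- by apply: trgs; apply: (shape_eqXn A1 k0' lr1 (erefl Q')).
case=> z [a [b [b' [z0 ln mn Dv Dv']]]].
have [e [DQ DQ']] := dickson_outer (bidec_co B') lr0 mr0 Qm sQ QQ Dv Dv'.
have zl : z ^+ lr != 0 by rewrite expf_neq0.
have zm : z ^+ mr != 0 by rewrite expf_neq0.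
have [/trg //|A'2] := shape_dickson A1' k0 mr1 (erefl Q) Qm sQ zl mn DQ.
have [/trgs //|A2] := shape_dickson A1 k0' lr1 (erefl Q') Qm' sQ' zm ln DQ'.
by move: co; rewrite A2 A'2.
Qed.

Theorem core_closed l m g h gs hs : bidec l m g h gs hs -> core l m g h gs hs.
Proof.
have [n] := ubnP (l + m); elim: n l m g h gs hs => // n IHn l m g h gs hs lt B.
have [//|pg] := classify_core B.
have [/core_sym //|pgs] := classify_core (bidec_sym B).
apply: power_step B _ pg pgs => l' m' g' h' gs' hs' lt' B'.
by apply: IHn B'; rewrite -ltnS; apply: leq_trans lt' _.
Qed.

End CoreInduction.

(** * Descent from an algebraic closure *)

Section GeneratedField.
Variables (F : fieldType) (s : seq F).
Notation tree := (GenTree.tree nat).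

(** Labels 0, 1, 2 stand for difference, product and inverse, and a leaf for a generator. Other
    trees denote one, from which zero, opposites and sums arise by differences. *)
Fixpoint gen_eval (t : tree) : F :=
  match t with
  | GenTree.Leaf i => s`_i
  | GenTree.Node 0 [:: a; b] => gen_eval a - gen_eval b
  | GenTree.Node 1 [:: a; b] => gen_eval a * gen_eval b
  | GenTree.Node 2 [:: a] => (gen_eval a)^-1
  | _ => 1
  end.

Definition gen_norm t : tree := choose (fun u => gen_eval u == gen_eval t) t.

Lemma gen_norm_eval t : gen_eval (gen_norm t) = gen_eval t.
Proof. exact/eqP/(@chooseP _ (fun u => gen_eval u == gen_eval t)). Qed.

Lemma gen_norm_eq t u : gen_eval t = gen_eval u -> gen_norm t = gen_norm u.
Proof.
move=> e; rewrite /gen_norm e; apply: choose_id; by rewrite ?e.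
Qed.

(* The subfield generated by [s], as a countable type: each element is
   represented by the chosen term among those with the same value. *)
Definition gen_field := {t : tree | gen_norm t == t}.

HB.instance Definition _ := [Countable of gen_field by <:].

Definition gen_val (x : gen_field) : F := gen_eval (val x).

Lemma gen_val_inj : injective gen_val.
Proof.
move=> [t tP] [u uP]; rewrite /gen_val /= => /gen_norm_eq e; apply: val_inj => /=.
by rewrite -(eqP tP) -(eqP uP).
Qed.

Lemma gen_normP t : gen_norm (gen_norm t) == gen_norm t.
Proof. exact/eqP/gen_norm_eq/gen_norm_eval. Qed.

Definition gen_class t : gen_field := exist _ (gen_norm t) (gen_normP t).

Lemma gen_val_class t : gen_val (gen_class t) = gen_eval t.
Proof. exact: gen_norm_eval. Qed.

Definition gen_one := gen_class (GenTree.Node 3 [::]).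
Definition gen_sub (x y : gen_field) := gen_class (GenTree.Node 0 [:: val x; val y]).
Definition gen_zero := gen_sub gen_one gen_one.
Definition gen_opp x := gen_sub gen_zero x.
Definition gen_add x y := gen_sub x (gen_opp y).
Definition gen_mul (x y : gen_field) := gen_class (GenTree.Node 1 [:: val x; val y]).
Definition gen_inv (x : gen_field) := gen_class (GenTree.Node 2 [:: val x]).

Lemma gen_val1 : gen_val gen_one = 1. Proof. by rewrite gen_val_class. Qed.
Lemma gen_valB x y : gen_val (gen_sub x y) = gen_val x - gen_val y.
Proof. by rewrite gen_val_class. Qed.
Lemma gen_val0 : gen_val gen_zero = 0. Proof. by rewrite gen_valB subrr. Qed.
Lemma gen_valN x : gen_val (gen_opp x) = - gen_val x.
Proof. by rewrite gen_valB gen_val0 sub0r. Qed.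
Lemma gen_valD x y : gen_val (gen_add x y) = gen_val x + gen_val y.
Proof. by rewrite gen_valB gen_valN opprK. Qed.
Lemma gen_valM x y : gen_val (gen_mul x y) = gen_val x * gen_val y.
Proof. by rewrite gen_val_class. Qed.
Lemma gen_valV x : gen_val (gen_inv x) = (gen_val x)^-1.
Proof. by rewrite gen_val_class. Qed.

Let genE := (gen_val1, gen_val0, gen_valN, gen_valD, gen_valM, gen_valV).

Fact gen_addA : associative gen_add.
Proof. by move=> x y z; apply: gen_val_inj; rewrite !genE addrA. Qed.
Fact gen_addC : commutative gen_add.
Proof. by move=> x y; apply: gen_val_inj; rewrite !genE addrC. Qed.
Fact gen_add0 : left_id gen_zero gen_add.
Proof. by move=> x; apply: gen_val_inj; rewrite !genE add0r. Qed.
Fact gen_addN : left_inverse gen_zero gen_opp gen_add.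
Proof. by move=> x; apply: gen_val_inj; rewrite !genE addNr. Qed.

HB.instance Definition _ :=
  GRing.isZmodule.Build gen_field gen_addA gen_addC gen_add0 gen_addN.

Fact gen_mulA : associative gen_mul.
Proof. by move=> x y z; apply: gen_val_inj; rewrite !genE mulrA. Qed.
Fact gen_mulC : commutative gen_mul.
Proof. by move=> x y; apply: gen_val_inj; rewrite !genE mulrC. Qed.
Fact gen_mul1 : left_id gen_one gen_mul.
Proof. by move=> x; apply: gen_val_inj; rewrite !genE mul1r. Qed.
Fact gen_mulDl : left_distributive gen_mul +%R.
Proof. by move=> x y z; apply: gen_val_inj; rewrite !genE mulrDl. Qed.
Fact gen_one_neq0 : gen_one != 0.
Proof.
apply/eqP => /(congr1 gen_val); rewrite [in RHS](_ : 0 = gen_zero) // !genE.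
exact/eqP/oner_neq0.
Qed.

HB.instance Definition _ := GRing.Zmodule_isComNzRing.Build gen_field
  gen_mulA gen_mulC gen_mul1 gen_mulDl gen_one_neq0.

Fact gen_mulV (x : gen_field) : x != 0 -> gen_mul (gen_inv x) x = 1.
Proof.
move=> x0; apply: gen_val_inj; rewrite !genE mulVf //.
by apply: contra_neq x0 => e; apply: gen_val_inj; rewrite e [in RHS](_ : 0 = gen_zero) // genE.
Qed.
Fact gen_inv0 : gen_inv 0 = 0.
Proof.
by apply: gen_val_inj; rewrite genE (_ : 0 = gen_zero) // genE invr0.
Qed.

HB.instance Definition _ := GRing.ComNzRing_isField.Build gen_field gen_mulV gen_inv0.

Fact gen_val_zmod_morphism : zmod_morphism gen_val.
Proof. by move=> x y; rewrite -gen_valN -gen_valD. Qed.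
Fact gen_val_monoid_morphism : monoid_morphism gen_val.
Proof. by split; [exact: gen_val1 | exact: gen_valM]. Qed.

HB.instance Definition _ := GRing.isZmodMorphism.Build gen_field F gen_val gen_val_zmod_morphism.
HB.instance Definition _ := GRing.isMonoidMorphism.Build gen_field F gen_val gen_val_monoid_morphism.

Lemma gen_val_surj x : x \in s -> exists y, gen_val y = x.
Proof.
move=> xs; exists (gen_class (GenTree.Leaf (index x s))).
by rewrite gen_val_class /= nth_index.
Qed.

End GeneratedField.

(** [F0], generated by finitely many elements, is countable and maps both to [F] and to its own
    algebraic closure [K]. Normal forms are pulled back along [j] and pushed forward along [i]. *)
Lemma closed_embedding (F : fieldType) (s : seq F) :
  exists (F0 : fieldType) (K : closedFieldType) (i : {rmorphism F0 -> F})
    (j : {rmorphism F0 -> K}), forall x, x \in s -> exists y, i y = x.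
Proof.
have [K [j _]] := countable_algebraic_closure (gen_field s).
by exists (gen_field s), K, (@gen_val F s), j; exact: gen_val_surj.
Qed.

Section ClosedShape.
Variable K : closedFieldType.
Implicit Types (x y t c : K) (g h gs hs : {poly K}).

(** The index of [g] over [c] is [m], larger than any index of [gs], and so divides none of them.
    Hence every point of [gs] over [c] is a heavy value of [hs], and there is only one. *)
Lemma totram_transfer l m g h gs hs : bidec l m g h gs hs -> (l < m)%N ->
  totram g -> totram gs.
Proof.
move=> B lm [c [x1]]; rewrite (bidec_sg B) /= => e.
have sgs1 := bidec_sgs1 B.
have shs1 := bidec_shs1 B.
have gx x : g.[x] = c -> x = x1.
  move=> xc; have := congr1 (horner^~ x) e; rewrite /= hornerD hornerN hornerC horner_exp hornerXsubC xc subrr.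
  by move/esym/eqP; rewrite expf_eq0 subr_eq0 => /andP[_ /eqP].
have hv y : gs.[y] = c -> heavy hs y.
  move=> yc t ty; apply: (ram_gt1 (bidec_sym B)).
  have gc : g.[h.[t]] = c by rewrite (bidec_val t B) ty.
  rewrite (gx _ gc) -(mup_eq_ram (c := c)) -?(gx _ gc) // (gx _ gc) e.
  rewrite mup_XsubCX eqxx
 ty; apply/negP => /dvdn_leq; rewrite ram_gt0 // leqNgt => /(_ isT).
  move/negP; apply; apply: leq_ltn_trans lm.
  by rewrite -(ram_sum_g (bidec_sym B) c) (big_rem y) ?leq_addr // mem_fibre // yc.
have [y yc] := fibre_nonempty (bidec_sym B) c.
apply: (totram_one (bidec_sym B) yc) => y' yc'.
exact: heavy_unique (bidec_dh (bidec_sym B)) shs1 (hv _ yc') (hv _ yc).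
Qed.

(** [power_shape] with [A = 1] and [A' = l] makes [v] linear. *)
Lemma totram_shape l m g h gs hs : bidec l m g h gs hs -> totram gs ->
  exists t x y c, h = ('X - t%:P) ^+ l + x%:P /\ gs = ('X - y%:P) ^+ l + c%:P.
Proof.
move=> B [c [y]]; rewrite (bidec_sgs B) /= => e.
have l0 : (0 < l)%N := ltnW (bidec_l B).
have [x|y' yc|x1 [k [q [v [_ _ vm _ e2]]]]] :=
    power_shape (c := c) B (bidec_l B) (coprime1n l).
- by rewrite dvd1n.
- rewrite -(mup_eq_ram yc) e mup_exp ?polyXsubC_eq0 //.
  by rewrite dvdn_mulr.
have sv : size v = 2%N.
  have := size_root e2 (bidec_sh B) l0 (monic_neq0 vm).
  have := monic_neq0 vm; rewrite -size_poly_gt0.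
  move: l0; case: (size v) => // k' l0 _ /= /eqP.
  by rewrite -{1}[l]muln1 eqn_pmul2l // => /eqP <-.
have [t Dv] : exists t, v = 'X - t%:P.
  exists (- v`_0); apply/polyP => i; rewrite coefB coefX coefC.
  case: i => [|[|i]] /=; rewrite ?sub0r ?opprK ?subr0 //.
    by move/monicP: vm => <-; rewrite lead_coefE sv.
  by rewrite oppr0 nth_default // sv.
exists t, x1, y, c; split; first by rewrite -Dv -e2 subrK.
by rewrite -e subrK.
Qed.

Lemma closed_shape l m g h gs hs : bidec l m g h gs hs -> (l < m)%N ->
  (exists t x y c, h = ('X - t%:P) ^+ l + x%:P /\ gs = ('X - y%:P) ^+ l + c%:P) \/
  dickson_pair l m h hs.
Proof.
move=> B lm; case: (core_closed B) => [/(totram_transfer B lm)|tr|]; last by right.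
- by move=> tr; left; apply: totram_shape B tr.
- by left; apply: totram_shape B tr.
Qed.

End ClosedShape.

(** * Normal forms along a field embedding *)

Section MapForms.
Variables (E F : fieldType) (r : {rmorphism E -> F}).
Implicit Types p q : {poly E}.

Lemma map_dickson n z : map_poly r (dickson n z) = dickson n (r z).
Proof.
elim/ltn_ind: n => -[|[|n]] IH; first by rewrite /= -polyC_natr map_polyC /= rmorph_nat polyC_natr.
  by rewrite /= map_polyX.
rewrite !dicksonSS -(IH n.+1) // -(IH n) //.
by move: (dickson n.+1 z) (dickson n z) => u v; rewrite rmorphB !rmorphM /= map_polyX map_polyC.
Qed.

Lemma bidec_map l m g h gs hs : bidec l m g h gs hs <->
  bidec l m (map_poly r g) (map_poly r h) (map_poly r gs) (map_poly r hs).
Proof.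
split=> -[]; rewrite ?map_monic ?size_map_poly ?deriv_map ?map_poly_eq0 -?map_comp_poly => *.
  by constructor; rewrite ?map_monic ?size_map_poly ?deriv_map ?map_poly_eq0 -?map_comp_poly //; congr map_poly.
by constructor => //; apply: (map_poly_inj r).
Qed.

Lemma map_poly_lift (s : seq F) : (forall x, x \in s -> exists y, r y = x) ->
  exists q, map_poly r q = Poly s.
Proof.
elim: s => [|a s IH] H; first by exists 0; rewrite rmorph0.
have [x|q Dq] := IH; first by move=> xs; apply: H; rewrite inE xs orbT.
have [b Db] := H a (mem_head _ _).
by exists (q * 'X + b%:P); rewrite /= cons_poly_def rmorphD rmorphM /= map_polyX map_polyC /= Dq Db.
Qed.

Lemma map_poly_diff_const p q x : map_poly r p = map_poly r q + x%:P ->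
  exists y, p = q + y%:P.
Proof.
move=> e; have s1 : (size (p - q)%R <= 1)%N.
  by rewrite -(size_map_poly r) rmorphB /= e addrAC subrr add0r size_polyC_leq1.
by exists (p - q)`_0; rewrite -size1_polyC // addrC subrK.
Qed.

Lemma natr_map n : (r n%:R != 0) = (n%:R != 0 :> E).
Proof. by rewrite fmorph_eq0. Qed.

Lemma coef_shift_map n p q b x : size q = n.+3 -> q \is monic -> q`_n.+1 = 0 -> 
  n.+2%:R != 0 :> E ->
  map_poly r p = (map_poly r q \Po ('X + b%:P)) + x%:P -> exists a, r a = b.
Proof.
move=> sq qm q0 n0 /(congr1 (fun u : {poly F} => u`_n.+1)).
rewrite coefD coefC addr0 coef_map /= coef_shift ?size_map_poly ?map_monic //.
rewrite coef_map q0 /= rmorph0 add0r => e; exists (p`_n.+1 / n.+2%:R).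
by rewrite fmorph_div e rmorph_nat mulrAC mulfV ?mul1r // -(rmorph_nat r) fmorph_eq0.
Qed.

Lemma power_pull n p t x : n.+2%:R != 0 :> E ->
  map_poly r p = ('X + t%:P) ^+ n.+2 + x%:P ->
  exists t0 x0, p = ('X + t0%:P) ^+ n.+2 + x0%:P.
Proof.
move=> n0 e; have [||||t0 Dt] := @coef_shift_map n p 'X^(n.+2) t x _ _ _ n0.
- by rewrite size_polyXn.
- exact: monicXn.
- by rewrite coefXn ltn_eqF.
- by rewrite map_polyXn comp_Xn_poly.
exists t0; apply: (@map_poly_diff_const _ _ x).
by rewrite e -Dt rmorphXn rmorphD /= map_polyX map_polyC.
Qed.

(** The parameters are read off [hs], of degree at least three: in degree two the coefficient
    carrying [z] would be mixed with the constant [b']. *)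
Lemma dickson_pull l n h hs : dickson_pair l n.+3 (map_poly r h) (map_poly r hs) ->
  dickson_pair l n.+3 h hs.
Proof.
case=> z [a [b [b' [z0 l0 m0 e1 e2]]]].
have n0 : n.+3%:R != 0 :> E by rewrite -natr_map rmorph_nat.
have [sm mm] := dickson_lead n.+2 z; have [c1 c0] := dickson_coef n.+1 z.
have [a0 Da] : exists a0, r a0 = a.
  move/(congr1 (fun u : {poly F} => u`_n.+2)): e2.
  rewrite coefD coefC addr0 coef_map /= coef_shift // c1 add0r => e.
  exists (hs`_n.+2 / n.+3%:R).
  by rewrite fmorph_div e rmorph_nat mulrAC mulfV ?mul1r.
have [z1 Dz] : exists z1, r z1 = z.
  have : map_poly r (hs \Po ('X - a0%:P)) = dickson n.+3 z + b'%:P.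
    rewrite map_comp_poly e2; move: (dickson _ _) => T.
    rewrite rmorphB /= map_polyX map_polyC /= comp_polyD comp_polyC.
    rewrite -comp_polyA comp_polyD comp_polyX comp_polyC Da.
    by rewrite subrK comp_polyXr.
  move/(congr1 (fun u : {poly F} => u`_n.+1)).
  rewrite coefD coefC addr0 coef_map /= c0 => e.
  exists (- ((hs \Po ('X - a0%:P))`_n.+1 / n.+3%:R)).
  by rewrite rmorphN fmorph_div e rmorph_nat mulNr opprK mulrAC mulfV ?mul1r.
have Dm k : dickson k z \Po ('X + a%:P) = map_poly r (dickson k z1 \Po ('X + a0%:P)).
  rewrite map_comp_poly map_dickson Dz -Da.
  by rewrite rmorphD /= map_polyX map_polyC.
have [b0 D1] : exists y, h = (dickson l z1 \Po ('X + a0%:P)) + y%:P.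
  by apply: (@map_poly_diff_const _ _ b); rewrite e1 Dm.
have [b0' D2] : exists y, hs = (dickson n.+3 z1 \Po ('X + a0%:P)) + y%:P.
  by apply: (@map_poly_diff_const _ _ b'); rewrite e2 Dm.
exists z1, a0, b0, b0'; split=> //; last by rewrite -natr_map rmorph_nat.
by rewrite -(fmorph_eq0 r) Dz.
Qed.

Lemma dickson_push l m h hs : dickson_pair l m h hs ->
  dickson_pair l m (map_poly r h) (map_poly r hs).
Proof.
case=> z [a [b [b' [z0 l0 m0 e1 e2]]]].
exists (r z), (r a), (r b), (r b').
by split; rewrite ?fmorph_eq0 ?e1 ?e2 -?map_dickson // -?(rmorph_nat r) ?fmorph_eq0 //
   rmorphD /= map_comp_poly rmorphD /= map_polyX !map_polyC.
Qed.

End MapForms.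

Lemma bidec_shape (F : fieldType) l m (g h gs hs : {poly F}) :
  bidec l m g h gs hs -> (l < m)%N ->
  (exists t x y c, [/\ l%:R != 0 :> F, h = ('X + t%:P) ^+ l + x%:P &
     gs = ('X + y%:P) ^+ l + c%:P]) \/ dickson_pair l m h hs.
Proof.
move=> B lm.
have [E [K [i [j H]]]] := closed_embedding ((g : seq F) ++ h ++ gs ++ hs).
have lift (p : {poly F}) : {subset (p : seq F) <= (g : seq F) ++ h ++ gs ++ hs} ->
    exists q, map_poly i q = p.
  by move=> sp; rewrite -[p]polyseqK; apply: map_poly_lift => x /sp /H.
have [g0 Dg] : exists q, map_poly i q = g.
  by apply: lift => x; rewrite !mem_cat => ->.
have [h0 Dh] : exists q, map_poly i q = h.
  by apply: lift => x; rewrite !mem_cat => ->; rewrite !orbT.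
have [gs0 Dgs] : exists q, map_poly i q = gs.
  by apply: lift => x; rewrite !mem_cat => ->; rewrite !orbT.
have [hs0 Dhs] : exists q, map_poly i q = hs.
  by apply: lift => x; rewrite !mem_cat => ->; rewrite !orbT.
move: B; rewrite -Dg -Dh -Dgs -Dhs => B'; have {B'} B := (bidec_map _ _ _ _ _ _ _).2 B'.
move=> {lift H g h gs hs Dg Dh Dgs Dhs}.
have l1 := bidec_l B.
have Bj : bidec l m (map_poly j g0) (map_poly j h0) (map_poly j gs0) (map_poly j hs0).
  exact: (bidec_map j l m g0 h0 gs0 hs0).1 B.
case: (closed_shape Bj lm) => [[t [x [y [c [e1 e2]]]]]|d]; last first.
  right; apply: dickson_push; move: d; have : (2 < m)%N by apply: leq_trans lm.
  by case: m {B Bj lm} => [|[|[|n]]] // _; exact: dickson_pull.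
left; have l0 : l%:R != 0 :> E.
  rewrite -(natr_map j); have := bidec_dh Bj; apply: contraNneq => l0.
  rewrite e1 derivD derivC addr0 deriv_exp -mulr_natr -polyC_natr -(rmorph_nat j) l0.
  by rewrite mulr0.
have -> : (l%:R != 0 :> F) by rewrite -(rmorph_nat i) natr_map.
have pull p u v : map_poly j p = ('X - u%:P) ^+ l + v%:P ->
    exists t x, map_poly i p = ('X + t%:P) ^+ l + x%:P.
  case: l l1 l0 {lm B Bj e1 e2} => [|[|n]] // _ n0; rewrite -polyCN => /(power_pull n0)[t0 [x0 ->]].
  exists (i t0), (i x0).
  by rewrite rmorphD rmorphXn rmorphD /= map_polyX !map_polyC.
have [t1 [x1 D1]] := pull _ _ _ e1; have [y1 [c1 D2]] := pull _ _ _ e2.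
by exists t1, x1, y1, c1; split.
Qed.

(** * The two cases *)

Section TwoCases.
Variable F : fieldType.
Implicit Types (p q u w P Q f g h gs hs : {poly F}) (a b c d x y z t : F) (l m n k : nat).

Lemma modn_coprime_gt0 l m : (1 < l)%N -> coprime l m -> (0 < m %% l)%N.
Proof.
move=> l1; rewrite lt0n coprime_sym -coprime_modl; apply: contraTneq => ->.
by rewrite /coprime gcd0n gtn_eqF.
Qed.

Lemma char_ndvdP n : (0 < n)%N -> char_ndvd F n <-> n%:R != 0 :> F.
Proof.
move=> n0; split=> [H|nn p pc]; last by rewrite (dvdn_pcharf pc).
apply/negP => e; have [p pc] := natf0_pchar n0 e.
by have := H p pc; rewrite (dvdn_pcharf pc) e.
Qed.

Lemma lincompE c P b : lincomp c P b = (P \Po ('X + b%:P)) - c%:P.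
Proof. by rewrite /lincomp comp_polyB comp_polyX comp_polyC comp_polyB comp_polyC. Qed.

Lemma comp_addK P b : (P \Po ('X + b%:P)) \Po ('X - b%:P) = P.
Proof. by rewrite -comp_polyA comp_polyD comp_polyX comp_polyC subrK comp_polyXr. Qed.

Lemma comp_subK P b : (P \Po ('X - b%:P)) \Po ('X + b%:P) = P.
Proof. by rewrite -comp_polyA comp_polyB comp_polyX comp_polyC addrK comp_polyXr. Qed.

Lemma lincomp_comp c d P Q a : lincomp c P d \Po lincomp d Q a = lincomp c (P \Po Q) a.
Proof.
rewrite !lincompE comp_polyB comp_polyC -!comp_polyA; congr (P \Po _ - _).
by rewrite comp_polyD comp_polyX comp_polyC subrK.
Qed.

Lemma size_lincomp c P b : (1 < size P)%N -> size (lincomp c P b) = size P.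
Proof.
move=> sP; have sQ : size (P \Po ('X + b%:P)) = size P by rewrite size_comp_poly2 // size_XaddC.
by rewrite lincompE size_polyDl ?sQ // -polyCN size_polyC; case: (- c != 0) => //; exact: ltnW.
Qed.

Lemma monic_lincomp c P b : (1 < size P)%N -> P \is monic -> lincomp c P b \is monic.
Proof.
move=> sP mP; have sQ : size (P \Po ('X + b%:P)) = size P by rewrite size_comp_poly2 // size_XaddC.
rewrite lincompE monicE lead_coefDl.
  rewrite lead_coef_comp ?size_XaddC // lead_coefXaddC expr1n mulr1.
  by rewrite (monicP mP).
by rewrite sQ -polyCN size_polyC; case: (- c != 0) => //; exact: ltnW.
Qed.

Lemma original_lincomp c P b : P.[b] = c -> original (lincomp c P b).
Proof. by move=> e; rewrite /original lincompE !hornerE horner_comp !hornerE e subrr. Qed.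

Lemma deriv_lincomp c P b : (lincomp c P b)^`() = P^`() \Po ('X + b%:P).
Proof.
by rewrite lincompE derivB derivC subr0 deriv_comp derivD derivX derivC addr0 mulr1.
Qed.

Lemma deriv_lincomp_eq0 c P b : ((lincomp c P b)^`() == 0) = (P^`() == 0).
Proof.
rewrite deriv_lincomp; apply/eqP/eqP => [e|->]; last by rewrite comp_poly0.
by rewrite -(comp_addK P^`() b) e comp_poly0.
Qed.

(** Common to both converses: inner and outer shifts cancel in the composites, and the subtracted
    constants are the values that make everything original. *)
Lemma hyp_lincomp l m P Q Ps Qs a d ds c : (0 < l)%N -> (0 < m)%N ->
  P \is monic -> Q \is monic -> Ps \is monic -> Qs \is monic ->
  size P = m.+1 -> size Q = l.+1 -> size Ps = l.+1 -> size Qs = m.+1 ->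
  P \Po Q = Ps \Po Qs -> P^`() != 0 -> Ps^`() != 0 ->
  Q.[a] = d -> Qs.[a] = ds -> P.[d] = c ->
  hyp l m (lincomp c (P \Po Q) a) (lincomp c P d) (lincomp d Q a)
    (lincomp c Ps ds) (lincomp ds Qs a).
Proof.
move=> l0 m0 mP mQ mPs mQs sP sQ sPs sQs e dP dPs Qa Qsa Pd.
have Psd : Ps.[ds] = c.
  by rewrite -Pd -Qa -Qsa -!horner_comp e.
have sPQ : size (P \Po Q) = (m * l).+1.
  by have := size_comp_poly P Q; rewrite sP sQ /= => <-; rewrite prednK // size_poly_gt0
    comp_poly_eq0 ?monic_neq0 // sQ.
have mPQ : P \Po Q \is monic.
  by rewrite monicE lead_coef_comp ?sQ // (monicP mP) (monicP mQ) expr1n mulr1.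
split.
- by split; apply: monic_lincomp; rewrite ?sPQ ?sP ?sQ ?sPs ?sQs ?ltnS ?muln_gt0 ?m0 ?l0.
- split; apply: original_lincomp => //.
  by rewrite horner_comp Qa.
- by split; rewrite size_lincomp ?sP ?sQ ?sPs ?sQs ?ltnS.
- by rewrite mulf_neq0 ?deriv_lincomp_eq0.
- by rewrite !lincomp_comp e.
Qed.

Lemma hyp_bidec l m f g h gs hs : (1 < l)%N -> (l < m)%N -> coprime l m ->
  hyp l m f g h gs hs -> bidec l m g h gs hs.
Proof.
move=> l1 lm co [[_ gm hm gsm hsm] _ [sg shs sh sgs] dd [e1 e2]].
move: dd; rewrite mulf_eq0 negb_or => /andP[dg dgs].
by constructor; rewrite -?e1 // ltnW // (leq_trans _ lm).
Qed.

Lemma dickson_leadS n z : (0 < n)%N ->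
  size (dickson n z : {poly F}) = n.+1 /\ (dickson n z : {poly F}) \is monic.
Proof. by case: n => // n _; exact: dickson_lead. Qed.

Lemma deriv_tame_neq0 n p : (0 < n)%N -> p \is monic -> size p = n.+1 ->
  n%:R != 0 :> F -> p^`() != 0.
Proof.
move=> n0 pm sp nn; rewrite -size_poly_gt0 (size_deriv_tame pm sp) //.
Qed.

Lemma hyp_second l m z a : (1 < l)%N -> (l < m)%N ->
  char_ndvd F (l * m) ->
  hyp l m (f2 l m z a) (g2 l m z a) (h2 l z a) (gs2 l m z a) (hs2 m z a).
Proof.
move=> l1 lm; have l0 := ltnW l1; have m0 : (0 < m)%N by apply: leq_trans lm.
move/(char_ndvdP (n := l * m)); rewrite muln_gt0 l0 m0 natrM mulf_eq0 negb_or.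
move=> /(_ isT)/andP[nl nm].
have [sP mP] := dickson_leadS (z ^+ l) m0; have [sQ mQ] := dickson_leadS z l0.
have [sPs mPs] := dickson_leadS (z ^+ m) l0; have [sQs mQs] := dickson_leadS z m0.
rewrite /f2 /g2 /h2 /gs2 /hs2 -{2}dickson_comp; apply: hyp_lincomp => //.
- by rewrite !dickson_comp mulnC.
- exact: deriv_tame_neq0 mP sP nm.
- exact: deriv_tame_neq0 mPs sPs nl.
- by rewrite -horner_comp dickson_comp.
Qed.

(** The cofactor of [p - q] is a sum of [l] monic terms of equal degree, so its leading coefficient
    is [l], nonzero in [F]. *)
Lemma size_subXX l (d : nat) p q : l%:R != 0 :> F -> p \is monic -> q \is monic ->
  size p = d.+1 -> size q = d.+1 -> p != q ->
  (size (p ^+ l - q ^+ l)%R = size (p - q)%R + l.-1 * d)%N.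
Proof.
move=> ln pm qm sp sq pq.
have l0 : (0 < l)%N by case: l ln; rewrite ?eqxx.
have sT (i : 'I_l) : p ^+ (l.-1 - i) * q ^+ i \is monic /\
    size (p ^+ (l.-1 - i) * q ^+ i) = (l.-1 * d).+1.
  split; first by rewrite monicMl ?monic_exp.
  rewrite size_monicM ?monic_exp ?monic_neq0 ?monic_exp //.
  rewrite -[size (p ^+ _)]prednK ?size_poly_gt0 ?monic_neq0 ?monic_exp // size_exp sp /=.
  rewrite -[size (q ^+ _)]prednK ?size_poly_gt0 ?monic_neq0 ?monic_exp // size_exp sq /=.
  have := ltn_ord i; move: (nat_of_ord i) => j jl; rewrite addnS /= -mulnDr subnK 1?mulnC //.
  by rewrite -ltnS prednK.
have cS : (\sum_(i < l) p ^+ (l.-1 - i) * q ^+ i)`_(l.-1 * d) = l%:R.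
  rewrite coef_sum -[l in RHS]card_ord -sumr_const; apply: eq_bigr => i _.
  by have [/monicP + si] := sT i; rewrite lead_coefE si.
have sS : size (\sum_(i < l) p ^+ (l.-1 - i) * q ^+ i) = (l.-1 * d).+1.
  apply/eqP; rewrite eqn_leq; apply/andP; split; last first.
    by rewrite ltnNge; apply: contra ln => /leq_sizeP/(_ _ (leqnn _)); rewrite cS => ->.
  apply: leq_trans (size_sum _ _ _) _; apply/bigmax_leqP => i _.
  by have [_ ->] := sT i.
rewrite subrXX size_mul ?subr_eq0 // -?size_poly_gt0 sS //.
by rewrite addnS.
Qed.

Lemma monic_exp_inj_tame l p q : l%:R != 0 :> F -> p \is monic -> q \is monic ->
  size p = size q -> p ^+ l = q ^+ l -> p = q.
Proof.
move=> ln pm qm s e; apply/eqP/negPn/negP => pq.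
have := @size_subXX l (size q).-1 p q ln pm qm.
rewrite prednK ?size_poly_gt0 ?monic_neq0 // => /(_ s erefl pq).
by rewrite e subrr size_poly0 => /esym/eqP; rewrite addn_eq0 size_poly_eq0 subr_eq0 (negPf pq).
Qed.

Lemma comp_XnI l p q : (0 < l)%N -> p \Po 'X^l = q \Po 'X^l -> p = q.
Proof.
move=> l0 /eqP; rewrite -subr_eq0 -comp_polyB comp_poly_eq0 ?size_polyXn //.
by rewrite subr_eq0 => /eqP.
Qed.

Lemma shape_inner l m w : (0 < l)%N -> w \is monic -> size w = (m %/ l).+1 ->
  'X^(m %% l) * (w \Po 'X^l) \is monic /\ size ('X^(m %% l) * (w \Po 'X^l)) = m.+1.
Proof.
move=> l0 wm sw; split.
  rewrite monicMl ?monicXn // monicE lead_coef_comp ?size_polyXn // lead_coefXn.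
  by rewrite expr1n mulr1 (monicP wm).
have wX0 : w \Po 'X^l != 0 by rewrite comp_poly_eq0 ?monic_neq0 ?size_polyXn.
rewrite mulrC size_mulXn // -[size _]prednK ?size_poly_gt0 // size_comp_poly.
by rewrite sw size_polyXn /= addnS addnC -divn_eq.
Qed.

Lemma shape_power l k w : ('X^k * (w \Po 'X^l)) ^+ l = ('X^k * w ^+ l) \Po 'X^l.
Proof. by rewrite exprMn comp_polyM comp_Xn_poly rmorphXn -!exprM mulnC. Qed.

Lemma shape_outer l m w : (0 < l)%N -> w \is monic -> size w = (m %/ l).+1 ->
  'X^(m %% l) * w ^+ l \is monic /\ size ('X^(m %% l) * w ^+ l) = m.+1.
Proof.
move=> l0 wm sw; split; first by rewrite monicMl ?monicXn ?monic_exp.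
rewrite mulrC size_mulXn ?expf_neq0 ?monic_neq0 //.
rewrite -[size _]prednK ?size_poly_gt0 ?expf_neq0 ?monic_neq0 // size_exp sw /=.
by rewrite addnS addnC -divn_eq.
Qed.

Lemma deriv_shape l k w : (0 < k)%N -> (0 < l)%N ->
  ('X^k * w ^+ l)^`() = 'X^(k.-1) * w ^+ l.-1 * (w *+ k + ('X * w^`()) *+ l).
Proof.
case: k l => // k [|l] // _ _; rewrite derivM derivXn deriv_exp /=.
rewrite !exprS; ring.
Qed.

(* If [H ^+ l] is a polynomial in [X^l], then [H] agrees with the part [U] of [H]
   of exponents congruent to [deg H]: otherwise [deg (H ^+ l - U ^+ l)] would be
   [deg (H - U) + (l - 1) deg H], which is not a multiple of [l]. *)
Lemma power_root_shape l m G H : l%:R != 0 :> F -> H \is monic -> size H = m.+1 ->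
  G \Po 'X^l = H ^+ l ->
  exists w, [/\ w \is monic, size w = (m %/ l).+1, H = 'X^(m %% l) * (w \Po 'X^l) &
    G = 'X^(m %% l) * w ^+ l].
Proof.
move=> ln Hm sH e; have l0 : (0 < l)%N by case: l ln {e}; rewrite ?eqxx.
have lc : H`_m = 1 by move/monicP: Hm; rewrite lead_coefE sH.
pose w := \poly_(i < (m %/ l).+1) H`_(m %% l + i * l).
have ws : w`_(m %/ l) = 1 by rewrite coef_poly ltnSn addnC -divn_eq lc.
have sw : size w = (m %/ l).+1 by rewrite size_poly_eq // addnC -divn_eq lc oner_neq0.
have wm : w \is monic by rewrite monicE lead_coefE sw /= ws.
pose U := 'X^(m %% l) * (w \Po 'X^l).
have [Um sU] : U \is monic /\ size U = m.+1 by exact: shape_inner.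
have Ul : U ^+ l = ('X^(m %% l) * w ^+ l) \Po 'X^l by rewrite shape_power.
have HU : H = U.
  apply/eqP/negPn/negP => ne.
  have := size_subXX ln Hm Um sH sU ne; rewrite Ul -e -comp_polyB.
  set D := G - _ => sD; have V0 : (0 < size (H - U)%R)%N by rewrite size_poly_gt0 subr_eq0.
  have sDX := size_comp_poly D 'X^l; rewrite size_polyXn sD /= in sDX.
  have Vl : lead_coef (H - U) != 0 by rewrite lead_coef_eq0 subr_eq0.
  pose j := (size (H - U)%R).-1; have jl : (j %% l = m %% l)%N.
    have jD : (j + l.-1 * m = (size D).-1 * l)%N.
      by rewrite -sDX /j; move: V0; case: (size _).
    have : (j + l.-1 * m + m = (size D).-1 * l + m)%N by rewrite jD.
    rewrite -addnA -mulSnr prednK // => e1.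
    by rewrite -(modnMDl m j) -(modnMDl (size D).-1 m) -e1 addnC [(l * m)%N]mulnC.
  have jm : (j %/ l <= m %/ l)%N.
    apply: leq_div2r; rewrite -ltnS /j prednK // -[m.+1]maxnn -{1}sH -sU.
    by rewrite -(size_polyN U) size_polyD.
  have Dj : j = (m %% l + j %/ l * l)%N by rewrite -jl addnC -divn_eq.
  have Uj : U`_j = H`_j.
    rewrite {1}Dj /U coefXnM ltnNge leq_addr /= addKn.
    by rewrite coef_comp_poly_Xn // dvdn_mull // mulnK // coef_poly ltnS jm -Dj.
  by move: Vl; rewrite lead_coefE -/j coefB Uj subrr eqxx.
exists w; split=> //.
by apply: (comp_XnI l0); rewrite e HU Ul.
Qed.

Lemma f1E l m w a :
  f1 l m w a = lincomp (c1 l m w a) (('X^(m %% l) * w ^+ l) \Po 'X^l) a.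
Proof.
by rewrite /f1 comp_polyM comp_Xn_poly rmorphXn /= -exprM mulnC.
Qed.

Lemma shape_value l m w a : ('X^(m %% l) * w ^+ l).[a ^+ l] = c1 l m w a.
Proof. by rewrite hornerM hornerXn horner_exp /c1 -exprM mulnC. Qed.

Lemma hyp_first l m w a : (1 < l)%N -> (l < m)%N -> coprime l m ->
  w \is monic -> size w = (m %/ l).+1 -> wcond l m w != 0 -> char_ndvd F l ->
  hyp l m (f1 l m w a) (g1 l m w a) (h1 l a) (gs1 l m w a) (hs1 l m w a).
Proof.
move=> l1 lm co wm sw wc /char_ndvdP; have l0 := ltnW l1; move=> /(_ l0) nl.
have m0 : (0 < m)%N by apply: leq_trans lm.
have k0 := modn_coprime_gt0 l1 co.
have [mP sP] := shape_outer l0 wm sw; have [mQs sQs] := shape_inner l0 wm sw.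
rewrite f1E; apply: hyp_lincomp; rewrite ?monicXn ?size_polyXn //.
- by rewrite comp_Xn_poly shape_power.
- rewrite deriv_shape //; rewrite !mulf_neq0 ?expf_neq0 ?polyX_eq0 //.
  exact: monic_neq0.
- by apply: (deriv_tame_neq0 l0); rewrite ?monicXn ?size_polyXn.
- by rewrite hornerXn.
- by rewrite hornerM hornerXn horner_comp hornerXn.
- exact: shape_value.
Qed.

Lemma coef_lincomp n c P b : size P = n.+3 -> P \is monic ->
  (lincomp c P b)`_n.+1 = P`_n.+1 + n.+2%:R * b.
Proof. by move=> sP mP; rewrite lincompE coefB coefC subr0 coef_shift. Qed.

Lemma lincomp_shift_inj n c c' P P' b b' : size P = n.+3 -> size P' = n.+3 ->
  P \is monic -> P' \is monic -> n.+2%:R != 0 :> F -> P`_n.+1 = P'`_n.+1 ->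
  lincomp c P b = lincomp c' P' b' -> b = b' /\ P = P' + (c - c')%:P.
Proof.
move=> sP sP' mP mP' nn e1 e.
have bb : b = b'.
  move/(congr1 (fun u : {poly F} => u`_n.+1)): (e).
  by rewrite !coef_lincomp // e1 => /addrI/(mulfI nn).
split=> //; move: e; rewrite -bb !lincompE => /(canRL (subrK _)) e.
rewrite -(comp_addK P b) e comp_polyD comp_polyB comp_addK !comp_polyC.
by rewrite addrAC -addrA -polyCB.
Qed.

(** A polynomial in ['X^l] has no term of degree [m * l - 1], so this coefficient of [f] determines
    [a]. Evaluation at zero, where the remainder [m %% l > 0] kills both power shapes, removes the
    constant; [l]-th roots of monic polynomials are then compared. *)
Lemma first_unique l m w w' a a' : (1 < l)%N -> (l < m)%N -> coprime l m ->
  l%:R != 0 :> F -> m%:R != 0 :> F ->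
  w \is monic -> size w = (m %/ l).+1 -> w' \is monic -> size w' = (m %/ l).+1 ->
  f1 l m w a = f1 l m w' a' -> w' = w /\ a' = a.
Proof.
move=> l1 lm co nl nm wm sw wm' sw'; have l0 := ltnW l1.
have k0 := modn_coprime_gt0 l1 co.
rewrite !f1E; set P := 'X^_ * w ^+ l; set P' := 'X^_ * w' ^+ l.
have [mP sP] := shape_outer l0 wm sw; have [mP' sP'] := shape_outer l0 wm' sw'.
have lead Q : Q \is monic -> size Q = m.+1 -> Q \Po 'X^l \is monic /\ size (Q \Po 'X^l) = (m * l).+1.
  move=> mQ sQ; split.
    by rewrite monicE lead_coef_comp ?size_polyXn // lead_coefXn expr1n mulr1 (monicP mQ).
  have := size_comp_poly Q 'X^l; rewrite sQ size_polyXn /= => <-.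
  by rewrite prednK // size_poly_gt0 comp_poly_eq0 ?size_polyXn // monic_neq0.
have [M S] := lead _ mP sP; have [M' S'] := lead _ mP' sP'.
have [n Dn] : exists n, (m * l = n.+2)%N.
  have : (1 < m * l)%N by apply: leq_trans (leq_pmull l _); rewrite // (leq_trans _ lm).
  by case: (m * l)%N => [|[|n]] // _; exists n.
have c0 Q : (Q \Po 'X^l)`_n.+1 = 0.
  rewrite coef_comp_poly_Xn //; case: ifP => // dv.
  have : (l %| n.+2 - n.+1)%N by rewrite dvdn_sub // -Dn dvdn_mull.
  by rewrite subSnn dvdn1 gtn_eqF.
rewrite Dn in S S'.
case/(lincomp_shift_inj S S' M M') => [||-> e]; rewrite ?c0 //.
  by rewrite -Dn natrM mulf_neq0.
split=> //.
have cc : c1 l m w a' - c1 l m w' a' = 0.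
  have z0 u : ('X^(m %% l) * u ^+ l).['X^l.[0]] = 0.
    by rewrite hornerM !hornerXn [0 ^+ l]expr0n (gtn_eqF l0) expr0n (gtn_eqF k0) mul0r.
  have := congr1 (horner^~ 0) e; rewrite /= hornerD !horner_comp hornerC !z0 add0r.
  by move=> <-.
rewrite cc addr0 in e; have /(mulfI _) e' := comp_XnI l0 e.
by apply: (monic_exp_inj_tame nl wm' wm); rewrite ?sw ?sw' // e' // expf_neq0 // polyX_eq0.
Qed.

Lemma first_of_power l m f g h gs hs t x y c : (1 < l)%N -> (l < m)%N -> coprime l m ->
  hyp l m f g h gs hs -> l%:R != 0 :> F ->
  h = ('X + t%:P) ^+ l + x%:P -> gs = ('X + y%:P) ^+ l + c%:P ->
  first_case l m f g h gs hs.
Proof.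
move=> l1 lm co hh nl Dh Dgs; have l0 := ltnW l1.
have k0 := modn_coprime_gt0 l1 co.
case: hh => -[_ _ _ _ hsm] [_ og oh ogs ohs] [sg shs sh sgs] dd [e1 e2].
(* These translations turn [g \Po h = gs \Po hs] into [G \Po 'X^l = H ^+ l]; the constants are
   forced afterwards by vanishing at the origin. *)
pose H := lincomp (- y) hs (- t); pose G := lincomp c g x.
have shs1 : (1 < size hs)%N by rewrite shs ltnS (leq_trans _ lm).
have [|||w [wm sw DH DG]] := @power_root_shape l m G H nl.
- exact: monic_lincomp.
- by rewrite size_lincomp.
- have Xl : 'X^l = (h \Po ('X - t%:P)) - x%:P.
    by rewrite Dh comp_polyD comp_polyC addrK -(comp_Xn_poly ('X + t%:P)) comp_addK.
  rewrite /G lincompE comp_polyB comp_polyC -comp_polyA comp_polyD comp_polyX comp_polyC.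
  rewrite {1}Xl subrK comp_polyA -e1 e2 -comp_polyA Dgs comp_polyD comp_polyC addrK.
  by rewrite -(comp_Xn_poly ('X + y%:P)) -comp_polyA comp_Xn_poly comp_polyD comp_polyX comp_polyC /H lincompE !polyCN opprK.
have Dx : x = - t ^+ l.
  move: oh; rewrite /original Dh hornerD horner_exp hornerD hornerX !hornerC add0r.
  by move/eqP; rewrite addrC addr_eq0 => /eqP.
have Dhs : hs = lincomp y ('X^(m %% l) * (w \Po 'X^l)) t.
  by rewrite -DH /H !lincompE comp_polyB comp_polyC polyCN comp_subK polyCN opprK addrK.
have Dg : g = lincomp (- c) ('X^(m %% l) * w ^+ l) (t ^+ l).
  by rewrite -DG /G !lincompE comp_polyB comp_polyC Dx polyCN comp_subK polyCN opprK subrK.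
have Dy : y = b1 l m w t.
  move: ohs; rewrite /original Dhs lincompE !hornerE horner_comp !hornerE horner_comp !hornerXn.
  by move/eqP; rewrite subr_eq0 /b1 => /eqP <-.
have Dc : - c = c1 l m w t.
  move: og; rewrite /original Dg lincompE hornerD hornerN hornerC horner_comp hornerD hornerX hornerC add0r.
  by rewrite shape_value => /eqP; rewrite subr_eq0 => /eqP <-.
have Eg : g = g1 l m w t by rewrite Dg Dc.
have Eh : h = h1 l t by rewrite Dh Dx /h1 lincompE comp_Xn_poly polyCN.
have Ef : f = f1 l m w t by rewrite e1 Eg Eh /g1 /h1 lincomp_comp f1E.
exists w, t; split=> //.
- split; last exact/char_ndvdP.
  apply: contraNneq dd => wc.
  by rewrite mulf_eq0 Eg /g1 deriv_lincomp_eq0 deriv_shape // -/(wcond l m w) wc mulr0 eqxx.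
- split=> //; last by rewrite Dhs Dy.
  by rewrite Dgs Dy /gs1 lincompE comp_Xn_poly -Dc polyCN opprK.
move=> /char_ndvdP nm w' a' wm' sw' e; rewrite Ef in e.
apply: (first_unique l1 lm co nl _ wm sw wm' sw' e); apply: nm.
exact: leq_trans lm.
Qed.

Lemma dickson_form_inj n z z' a a' c c' : n.+3%:R != 0 :> F ->
  lincomp c (dickson n.+3 z) a = lincomp c' (dickson n.+3 z') a' -> z = z' /\ a = a'.
Proof.
move=> nn; have [s m] := dickson_lead n.+2 z; have [s' m'] := dickson_lead n.+2 z'.
have [u v] := dickson_coef n.+1 z; have [u' v'] := dickson_coef n.+1 z'.
move: (dickson _ z) (dickson _ z') s m s' m' u v u' v' => P P' s m s' m' u v u' v'.
case/(lincomp_shift_inj s s' m m' nn) => [|->]; first by rewrite u u'.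
move/(congr1 (fun p : {poly F} => p`_n.+1)).
by rewrite coefD coefC addr0 v v' => /oppr_inj/(mulfI nn).
Qed.

Lemma lincomp_form P Q a b : Q = P \Po ('X + a%:P) + b%:P -> original Q ->
  b = - P.[a] /\ Q = lincomp P.[a] P a.
Proof.
move=> e; rewrite /original e hornerD horner_comp hornerD hornerX !hornerC add0r.
by move/eqP; rewrite addrC addr_eq0 => /eqP ->; rewrite lincompE polyCN.
Qed.

Lemma second_of_pair l m f g h gs hs : (1 < l)%N -> (l < m)%N -> coprime l m ->
  hyp l m f g h gs hs -> dickson_pair l m h hs -> second_case l m f g h gs hs.
Proof.
move=> l1 lm co [[_ gm _ _ _] [_ og oh ogs ohs] [sg _ _ _] _ [e1 e2]].
case=> z [a [b [b' [z0 nl nm Dh Dhs]]]].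
have l0 := ltnW l1; have m0 : (0 < m)%N by apply: leq_trans lm.
have [e [Dg Dgs]] := dickson_outer co l0 m0 gm sg (etrans (esym e1) e2) Dh Dhs.
have [Db Eh] := lincomp_form Dh oh; have [Db' Ehs] := lincomp_form Dhs ohs.
have [_ Eg] := lincomp_form Dg og; have [_ Egs] := lincomp_form Dgs ogs.
rewrite Db opprK -horner_comp dickson_comp in Eg.
rewrite Db' opprK -horner_comp dickson_comp mulnC in Egs.
have Ef : f = f2 l m z a by rewrite e1 Eg Eh lincomp_comp dickson_comp.
exists z, a; split=> //; last first.
  by apply/char_ndvdP; rewrite ?muln_gt0 ?l0 // natrM mulf_neq0.
move=> z' a' _; rewrite Ef /f2.
have [n Dn] : exists n, (l * m = n.+3)%N.
  have : (2 < l * m)%N by apply: leq_trans (leq_pmull m l0); apply: leq_trans lm.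
  by case: (l * m)%N => [|[|[|n]]] // _; exists n.
by rewrite Dn => /dickson_form_inj[|-> ->] //; rewrite -Dn natrM mulf_neq0.
Qed.

Lemma dickson0 n : dickson n.+1 0 = 'X^(n.+1) :> {poly F}.
Proof.
elim/ltn_ind: n => -[|n] IH; first by [].
by rewrite dicksonSS IH // mul0r subr0 -exprS.
Qed.

(** ['X^l] is [dickson l 0], so [h] would be a Dickson form for the parameters zero and [z != 0],
    against the uniqueness in degree at least three. *)
Lemma cases_exclusive l m f g h gs hs : (2 < l)%N -> (0 < m)%N ->
  first_case l m f g h gs hs -> second_case l m f g h gs hs -> False.
Proof.
move=> l2 m0 [w [a [_ _ [_ /char_ndvdP nl] [_ Dh _ _] _]]] [z [a' [z0 _ _ _ [_ Dh' _ _]]]].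
have := nl (ltnW (ltnW l2)).
move: Dh; rewrite Dh' /h1 /h2; case: l l2 {nl Dh'} => [|[|[|n]]] // _.
by rewrite -(dickson0 n.+2) => e /dickson_form_inj/(_ e)[z1 _]; rewrite z1 eqxx in z0.
Qed.

Lemma dickson2 z : dickson 2 z = 'X^2 - (2%:R * z)%:P :> {poly F}.
Proof.
by rewrite dicksonSS [dickson 1 z]/= [dickson 0 z]/= polyCM polyC_natr expr2 [_ * z%:P]mulrC.
Qed.

Lemma lincomp_dickson2 z c b : lincomp c (dickson 2 z) b =
  ('X + b%:P) ^+ 2 + (- (2%:R * z) - c)%:P.
Proof.
by rewrite lincompE dickson2 comp_polyB comp_polyC comp_Xn_poly polyCB polyCN addrA.
Qed.

Lemma second_first m f g h gs hs : (2 < m)%N -> coprime 2 m ->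
  hyp 2 m f g h gs hs -> second_case 2 m f g h gs hs -> first_case 2 m f g h gs hs.
Proof.
move=> m2 co hh [z [a [_ _ _ /char_ndvdP nn [_ Dh Dgs _]]]].
have n0 : (2%:R != 0 :> F).
  by have := nn; rewrite muln_gt0 (ltn_trans _ m2) // => /(_ isT); rewrite natrM mulf_eq0 negb_or => /andP[].
apply: (first_of_power _ m2 co hh n0) => //; first by rewrite Dh; exact: lincomp_dickson2.
by rewrite Dgs; exact: lincomp_dickson2.
Qed.

End TwoCases.

Theorem theorem4p3 (F : fieldType) (l m : nat)
    (Hl : (2 <= l)%N) (Hlm : (l < m)%N) (Hco : coprime l m) :
  (forall f g h gs hs : {poly F},
     hyp l m f g h gs hs ->
     (first_case l m f g h gs hs \/ second_case l m f g h gs hs) /\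
     ((3 <= l)%N -> ~ (first_case l m f g h gs hs /\ second_case l m f g h gs hs)) /\
     (l = 2%N -> second_case l m f g h gs hs -> first_case l m f g h gs hs))
  /\
  (forall (w : {poly F}) (a : F),
     w \is monic -> size w = (m %/ l).+1 ->
     wcond l m w != 0 -> char_ndvd F l ->
     hyp l m (f1 l m w a) (g1 l m w a) (h1 l a) (gs1 l m w a) (hs1 l m w a))
  /\
  (char_ndvd F (l * m) ->
   forall z a : F, z != 0 ->
     hyp l m (f2 l m z a) (g2 l m z a) (h2 l z a) (gs2 l m z a) (hs2 m z a)).
Proof.
have m0 : (0 < m)%N by apply: leq_trans Hlm.
split; [|split]; last 2 first.
- by move=> w a; exact: hyp_first.
- by move=> nn z a _; exact: hyp_second.
move=> f g h gs hs hh; split; [|split].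
- case: (bidec_shape (hyp_bidec Hl Hlm Hco hh) Hlm) => [[t [x [y [c [nl Dh Dgs]]]]]|d].
    by left; exact: (first_of_power Hl Hlm Hco hh nl Dh Dgs).
  by right; exact: (second_of_pair Hl Hlm Hco hh d).
- by move=> l3 [] /(cases_exclusive l3 m0).
- by move=> l2; move: Hlm Hco hh; rewrite l2; exact: second_first.
Qed.
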